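(* There is an absolute constant $b_0>0$ such that the following holds. Let $\lambda>0$ and $0<\alpha<1$. Then there are finite positive constants $b_9,b_{10},b_{11},b_{12}$, depending on both $\alpha$ and $\lambda$, such that the following statements hold for all finite connected transitive graphs $\mathbb G$ (with $V$ vertices of degree $\Omega$), provided the triangle condition $\nabla_{p_c}(x,y)\le\delta_{x,y}+a_0$ (for all $x,y\in\mathbb V$) holds at $p_c=p_c(\mathbb G,\lambda)$ for some constant $a_0\le b_0$, and $\lambda V^{1/3}\ge b_0^{-1}$. Let $p=p_c+\epsilon\Omega^{-1}\in[0,1]$ with $\epsilon>0$, let $N_\alpha=\epsilon^{-2}(\epsilon V^{1/3})^\alpha$ and $\theta_\alpha(p)=\mathbb P_p(|C(0)|\ge N_\alpha)$. (i) $$b_{10}\epsilon\le\theta_\alpha(p)\le27\epsilon,$$ where the lower bound holds when $b_9V^{-1/3}\le\epsilon\le1$ and the upper bound holds when $\epsilon V^{1/3}\ge1$. (ii) If $\max\{b_{12}V^{-1/3},V^{-\eta}\}\le\epsilon\le1$, where $\eta=\frac13\,\frac{3-2\alpha}{5-2\alpha}$, then $$\mathbb P_p\Big(|\mathcal C_{\max}|\le[1+(\epsilon V^\eta)^{-1}]\,\theta_\alpha(p)V\Big)\ge1-\frac{b_{11}}{(\epsilon V^\eta)^{3-2\alpha}}.$$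
   Context: $\mathbb G=(\mathbb V,\mathbb B)$ is a finite connected graph with vertex set $\mathbb V$ and bond (edge) set $\mathbb B$. It is transitive: for all $x,y\in\mathbb V$ there is a graph automorphism mapping $x$ to $y$. $V=|\mathbb V|$, and $\Omega$ is the common degree of the vertices. In percolation with parameter $p\in[0,1]$ each bond is independently occupied with probability $p$ and vacant otherwise; $\mathbb P_p,\mathbb E_p$ denote probability and expectation. $x\leftrightarrow y$ means there is a path of occupied bonds from $x$ to $y$ (and $x\leftrightarrow x$ always); $\tau_p(x,y)=\mathbb P_p(x\leftrightarrow y)$; $C(x)$ is the set of vertices connected to $x$; $0\in\mathbb V$ is a fixed vertex; $\chi(p)=\mathbb E_p|C(0)|$, a strictly increasing function of $p$ with $\chi(0)=1$, $\chi(1)=V$; $|\mathcal C_{\max}|=\max\{|C(x)|:x\in\mathbb V\}$. The triangle diagram is $\nabla_p(x,y)=\sum_{u,v\in\mathbb V}\tau_p(x,u)\tau_p(u,v)\tau_p(v,y)$. For $\lambda>0$, the critical threshold $p_c=p_c(\mathbb G,\lambda)$ is the unique solution of $\chi(p_c)=\lambda V^{1/3}$; it is always assumed that $1<\lambda V^{1/3}<V$, so that $p_c$ is well defined and $0<p_c<1$. *)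

(* Defs.v *)
From mathcomp Require Import all_boot all_order all_fingroup all_algebra reals exp.
Set Implicit Arguments.
Unset Strict Implicit.
Unset Printing Implicit Defensive.
Import Order.TTheory GRing.Theory Num.Theory.
Local Open Scope ring_scope.

Record sgraph := SGraph {
  vertex :> finType;
  bonds : {set {set vertex}};
  bonds_card2 : forall b, b \in bonds -> #|b| = 2%N
}.

Section Graph.
Variable G : sgraph.
Implicit Types (S : {set {set G}}) (x y : G).

Definition joined S : rel G := [rel x y | [set x; y] \in S].

Definition connected_graph := forall x y, connect (joined (bonds G)) x y.

Definition automorphism (f : {perm G}) :=
  forall x y, joined (bonds G) (f x) (f y) = joined (bonds G) x y.

Definition transitive_graph :=
  forall x y, exists f : {perm G}, automorphism f /\ f x = y.

Definition degree x : nat := #|[set y | joined (bonds G) x y]|.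

End Graph.

(* A percolation configuration is identified with its set w of occupied bonds,
   w \subset bonds G, so the probability space is powerset (bonds G). *)
Section Percolation.
Variables (R : realType) (G : sgraph).
Implicit Types (p : R) (w : {set {set G}}) (x y : G).

Definition weight p w : R :=
  \prod_(b in bonds G) (if b \in w then p else 1 - p).

Definition Expect p (X : {set {set G}} -> R) : R :=
  \sum_(w in powerset (bonds G)) weight p w * X w.

Definition Prob p (E : pred {set {set G}}) : R :=
  Expect p (fun w => (E w)%:R).

Definition linked w x y : bool := connect (joined w) x y.

Definition cluster w x : {set G} := [set y | linked w x y].

Definition Cmax w : nat := \max_(x : G) #|cluster w x|.

Definition tau p x y : R := Prob p (fun w => linked w x y).

Definition chi (o : G) p : R := Expect p (fun w => #|cluster w o|%:R).

Definition triangle p x y : R :=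
  \sum_(u : G) \sum_(v : G) tau p x u * tau p u v * tau p v y.

Definition nvert : R := #|G|%:R.

Definition is_pc (o : G) (lambda pc : R) :=
  0 <= pc <= 1 /\ chi o pc = lambda * nvert `^ (1 / 3).

Definition triangle_condition p (a0 : R) :=
  forall x y, triangle p x y <= (x == y)%:R + a0.

Definition Nsize (alpha eps : R) : R :=
  eps ^- 2 * (eps * nvert `^ (1 / 3)) `^ alpha.

Definition theta (o : G) (alpha eps p : R) : R :=
  Prob p (fun w => Nsize alpha eps <= #|cluster w o|%:R).

End Percolation.
Arguments nvert : clear implicits.

Definition eta (R : realType) (alpha : R) : R :=
  1 / 3 * ((3 - 2 * alpha) / (5 - 2 * alpha)).

(* Main.v *)
From mathcomp Require Import normedtype derive realfun.
Require Import Defs.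
From mathcomp Require Import all_boot all_order all_fingroup all_algebra reals exp.
From mathcomp Require Import ring lra.
Set Implicit Arguments.
Unset Strict Implicit.
Unset Printing Implicit Defensive.
Import Order.TTheory GRing.Theory Num.Theory.
Import numFieldNormedType.Exports.
Local Open Scope ring_scope.

(** Colour each vertex green independently with probability [h]. The
    magnetization [M (p, h)] is the probability that the cluster of a vertex
    contains a green vertex. At [h = 1 / N] it controls the tail of the cluster
    size at [N], and up to constants it exceeds this tail only by the
    contribution of clusters smaller than [N]. Everything is read off from four
    inequalities for [M], where [chig = (1 - h) dM/dh] is the mean size of a
    cluster without green vertex.

    - By Russo's formula [(1 - p) dM/dp] sums, over oriented bonds [uv], the
      probability that [u] is linked to the origin, but not to a green vertex,
      while [v] is linked to one. Given the cluster of [u], the cluster of [v]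
      lives off it, so [(1 - p) dM/dp <= Omega chig M] ([dmag_upper]).
    - The error made there is a connection from [v] to the cluster of [u].
      Tree-graph bounds, applied off the region connected to the green vertices,
      bound it by the triangle diagram at distinct points:
      [(1 - p) dM/dp >= (1 - a0) Omega chig M] at [pc] ([dmag_lower]).
    - Exploring a cluster until a green vertex appears reveals at most
      [Omega M / h] bonds on average, and Cauchy-Schwarz for the exploration
      martingale gives [(dM/dp)^2 <= M^2 Omega / (p (1 - p) h)]
      ([dmag_exploration]).
    - Leaving, in one copy of percolation, the region not linked to green
      vertices in another gives [M <= h chig + M^2 + p (1 - p) M dM/dp]
      ([aizenman_barsky]).

    At [pc] the second and the third give [chig <= C / sqrt h], hence
    [M <= C sqrt h] ([mag_sqrt]). The first inequality and concavity in [h]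
    bound the derivative of [1 / M] in [p], so at distance [eps / Omega] above
    [pc] one still has [M <= C eps] at [h] of order [eps^2] ([mag_near]). With
    explicit constants this is the bound [27 eps].

    For the lower bound, divide the fourth inequality by [M] and sum over a
    geometric sequence of [h] from order [V^(-2/3)] to order [1 / N_alpha]. The
    terms [(h / M) dM/dh] telescope to the logarithm of the ratio of the extreme
    values of [M], at most [ln X] up to constants, where [X = eps V^(1/3)]; the
    length of the sequence is proportional to [(2 - alpha) ln X]. Since
    [alpha < 1] a positive proportion of the terms is left for [p dM/dp], whence
    [M >= c eps] at [h = kappa / N_alpha] ([mag_lower_telescoped],
    [theta_lower]).

    For the largest cluster, the number of vertices in clusters of size at least
    [N_alpha] has mean [theta V]; by the Efron-Stein inequality its variance is
    at most of order [V N_alpha] times the mean size of the cluster restricted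
    to sizes below [N_alpha], which is at most of order [eps N_alpha], and
    Chebyshev's inequality concludes ([large_count_variance], [Cmax_deviation]). *)

(** * Product Bernoulli measures *)

Section ProductMeasure.
Variables (R : realType) (I : finType) (p : R).
Implicit Types (s : seq I) (w v D T : {set I}) (X Y : {set I} -> R).
Implicit Types (A B : pred {set I}).

(** Expectation of [X] when each coordinate listed in [s] belongs to the random
    set independently with probability [p]. The recursion on coordinates, rather
    than a sum over a powerset, is what makes the BK and Efron-Stein
    inequalities and Russo's formula short inductions. *)
Fixpoint mean s X : R :=
  if s is b :: s' then (1 - p) * mean s' X + p * mean s' (fun w => X (b |: w))
  else X set0.

Lemma mean_eq s X Y : (forall w, {subset w <= s} -> X w = Y w) -> mean s X = mean s Y.
Proof.
elim: s X Y => [|b s IH] X Y eXY /=; first by apply: eXY => x; rewrite inE.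
congr (_ * _ + _ * _); apply: IH => w sw; apply: eXY => x.
  by move/sw; rewrite inE => ->; rewrite orbT.
by rewrite !inE => /orP[->//|/sw ->]; rewrite orbT.
Qed.

Lemma eq_mean s X Y : X =1 Y -> mean s X = mean s Y.
Proof. by move=> e; apply: mean_eq. Qed.

Lemma meanD s X Y : mean s (fun w => X w + Y w) = mean s X + mean s Y.
Proof. by elim: s X Y => [|b s IH] X Y //=; rewrite !IH; ring. Qed.

Lemma meanZ s c X : mean s (fun w => c * X w) = c * mean s X.
Proof. by elim: s X => [|b s IH] X //=; rewrite !IH; ring. Qed.

Lemma meanN s X : mean s (fun w => - X w) = - mean s X.
Proof. by elim: s X => [|b s IH] X //=; rewrite !IH; ring. Qed.

Lemma meanB s X Y : mean s (fun w => X w - Y w) = mean s X - mean s Y.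
Proof. by rewrite meanD meanN. Qed.

Lemma mean_cst s c : mean s (fun=> c) = c.
Proof. by elim: s => [|b s IH] //=; rewrite !IH; ring. Qed.

Lemma mean_sum (J : Type) (r : seq J) (Q : pred J) s (F : J -> {set I} -> R) :
  mean s (fun w => \sum_(j <- r | Q j) F j w) = \sum_(j <- r | Q j) mean s (F j).
Proof.
elim: r => [|j r IH].
  by rewrite big_nil -[RHS](mean_cst s 0); apply: eq_mean => w; rewrite big_nil.
rewrite big_cons -IH; case Qj: (Q j); last first.
  by apply: eq_mean => w; rewrite big_cons Qj.
by rewrite -meanD; apply: eq_mean => w; rewrite big_cons Qj.
Qed.

Lemma mean_cat s1 s2 X :
  mean (s1 ++ s2) X = mean s1 (fun w1 => mean s2 (fun w2 => X (w1 :|: w2))).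
Proof.
elim: s1 X => [|b s IH] X /=.
  by apply: eq_mean => w; rewrite set0U.
rewrite !IH; congr (_ * _ + _ * _).
by apply: eq_mean => w1; apply: eq_mean => w2; rewrite setUA.
Qed.

Lemma mean_perm s1 s2 X : perm_eq s1 s2 -> mean s1 X = mean s2 X.
Proof.
elim: s1 s2 X => [|b s IH] s2 X pe.
  by have -> : s2 = [::] by apply/nilP; rewrite /nilp -(perm_size pe).
have bs2 : b \in s2 by rewrite -(perm_mem pe) mem_head.
move: pe; case/splitPr: s2 / bs2 => u v pe.
have {}pe : perm_eq s (u ++ v).
  by rewrite -(perm_cons b) (perm_trans pe) // perm_catC /= perm_cons perm_catC.
rewrite /= !(IH _ _ pe) !mean_cat /= meanD !meanZ; congr (_ * _ + _ * _).
by apply: eq_mean => w1; apply: eq_mean => w2; rewrite setUCA.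
Qed.

Lemma mean_filter s T X :
  mean s (fun w => X (w :&: T)) = mean [seq b <- s | b \in T] X.
Proof.
elim: s X => [|b s IH] X /=; first by rewrite set0I.
case: ifPn => bT /=.
  rewrite !IH; congr (_ * _ + _ * _); rewrite -IH.
  by apply: eq_mean => w; rewrite setIUl (setIidPl _) // sub1set.
have -> : mean s (fun w => X ((b |: w) :&: T)) = mean s (fun w => X (w :&: T)).
  by apply: eq_mean => w; rewrite setIUl; congr X; apply/setP=> x;
    rewrite !inE; case: eqP => // ->; rewrite (negbTE bT) andbF.
by rewrite IH; ring.
Qed.

(** Coordinates in [T] and coordinates outside [T] are independent, so the list
    of coordinates may be split and the expectation factorised by Fubini. *)
Lemma mean_indep s T X Y :
  (forall w, X w = X (w :\: T)) -> (forall w, Y w = Y (w :&: T)) ->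
  mean s (fun w => X w * Y w) = mean s X * mean s Y.
Proof.
move=> hX hY; pose s1 := [seq b <- s | b \in T].
pose s2 := [seq b <- s | b \notin T].
have pe : perm_eq s (s1 ++ s2) by rewrite perm_sym perm_filterC.
rewrite (mean_perm _ pe) mean_cat.
have eX : mean s X = mean s2 X.
  rewrite (eq_mean s hX) (_ : s2 = [seq b <- s | b \in ~: T]).
    by rewrite -mean_filter; apply: eq_mean => w; rewrite setDE.
  by apply: eq_filter => b; rewrite inE.
have eY : mean s Y = mean s1 Y by rewrite (eq_mean s hY) mean_filter.
rewrite eX eY mulrC -meanZ.
have h1 w : {subset w <= s1} -> w :&: T = w.
  by move=> sw; apply/setIidPl/subsetP => b /sw; rewrite mem_filter => /andP[].
have h2 w : {subset w <= s2} -> w :&: T = set0.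
  move=> sw; apply/setP=> b; rewrite !inE; apply/negP => /andP[/sw].
  by rewrite mem_filter => /andP[/negP].
rewrite [RHS](_ : _ = mean s1 (fun w1 => mean s2 X * Y w1)); last first.
  by rewrite !meanZ mulrC.
apply: mean_eq => w1 /h1 e1; rewrite mulrC -meanZ; apply: mean_eq => w2 /h2 e2.
rewrite mulrC [in LHS]hY setIUl e1 e2 setU0 [in LHS]hX setDUl.
have -> : w1 :\: T = set0 by apply/eqP; rewrite setD_eq0 -e1 subsetIr.
by rewrite set0U -hX mulrC.
Qed.

Hypothesis p01 : 0 <= p <= 1.
Let p0 : 0 <= p. Proof. by case/andP: p01. Qed.
Let q0 : 0 <= 1 - p. Proof. by rewrite subr_ge0; case/andP: p01. Qed.

Lemma mean_ge0 s X : (forall w, {subset w <= s} -> 0 <= X w) -> 0 <= mean s X.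
Proof.
elim: s X => [|b s IH] X hX /=; first by apply: hX => x; rewrite inE.
apply: addr_ge0; apply: mulr_ge0 => //; apply: IH => w sw; apply: hX => x.
  by move/sw; rewrite inE => ->; rewrite orbT.
by rewrite !inE => /orP[->//|/sw ->]; rewrite orbT.
Qed.

Lemma mean_le s X Y :
  (forall w, {subset w <= s} -> X w <= Y w) -> mean s X <= mean s Y.
Proof.
move=> le; rewrite -subr_ge0 -meanB; apply: mean_ge0 => w sw.
by rewrite subr_ge0 le.
Qed.

Definition increasing_event A := forall w v, w \subset v -> A w -> A v.

(** Disjoint occurrence of two increasing events. *)
Definition box A B : pred {set I} :=
  fun w => [exists v : {set I}, [&& v \subset w, A v & B (w :\: v)]].

Lemma box_increasing A B :
  increasing_event A -> increasing_event B -> increasing_event (box A B).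
Proof.
move=> iA iB w w' sw /existsP[v /and3P[sv Av Bv]]; apply/existsP; exists v.
by rewrite (subset_trans sv sw) Av (iB _ _ _ Bv) // setSD.
Qed.

Lemma box_sub A B A' B' w :
  (forall v, A v -> A' v) -> (forall v, B v -> B' v) ->
  box A B w -> box A' B' w.
Proof.
move=> iA iB /existsP[v /and3P[sv Av Bv]]; apply/existsP; exists v.
by rewrite sv iA // iB.
Qed.

Lemma increasing_add A b :
  increasing_event A -> increasing_event (fun w => A (b |: w)).
Proof. by move=> iA w v sw; apply: iA; rewrite setUS. Qed.

Lemma mean_prob s A : mean s (fun w => (A w)%:R) <= 1.
Proof.
rewrite -[leRHS](mean_cst s 1); apply: mean_le => w _.
by case: (A w).
Qed.

(** The van den Berg-Kesten inequality for increasing events. Writing [0], [1]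
    for the two values of the first coordinate and [C] for the event [box A B],
    [C0 <= A0 B0] and [C1 <= A1 B1] by induction, while [C0 + C1] is at most
    [box A0 B1 + box A1 B0]; the weights [q^2], [p^2], [p q] then recombine the
    three estimates into the product. *)
Lemma BK_inequality s A B : uniq s ->
  increasing_event A -> increasing_event B ->
  mean s (fun w => (box A B w)%:R) <=
  mean s (fun w => (A w)%:R) * mean s (fun w => (B w)%:R).
Proof.
elim: s A B => [|b s IH] A B /=.
  move=> _ iA iB; case e: (box A B set0); last by apply: mulr_ge0; apply: ler0n.
  case/existsP: e => v /and3P[].
  by rewrite subset0 => /eqP -> -> ; rewrite setD0 => ->; rewrite mulr1.
case/andP=> bs us iA iB.
pose A1 w := A (b |: w); pose B1 w := B (b |: w).
have iA1 : increasing_event A1 := increasing_add iA.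
have iB1 : increasing_event B1 := increasing_add iB.
have sA w : A w -> A1 w by apply: iA; rewrite subsetUr.
have sB w : B w -> B1 w by apply: iB; rewrite subsetUr.
(* the box event, with the first coordinate switched on, splits on the event that uses it *)
have C1 w : {subset w <= s} -> box A B (b |: w) -> box A1 B w || box A B1 w.
  move=> sw; have bw : b \notin w by apply: contra bs => /sw.
  case/existsP=> v /and3P[sv Av Bv]; have [bv|bv] := boolP (b \in v).
    apply/orP; left; apply/existsP; exists (v :\ b).
    rewrite /A1 setD1K // Av -(setU1K bw) setSD //=.
    apply: iB Bv; apply/subsetP => x; rewrite !inE.
    case: (eqVneq x b) => [->|] //=; first by rewrite bv.
  apply/orP; right; apply/existsP; exists v; rewrite Av /=; apply/andP; split.
    apply/subsetP => x xv; have := subsetP sv _ xv; rewrite !inE.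
    by case: eqP => // xb; move: bv; rewrite -xb xv.
  apply: iB Bv; apply/subsetP => x; rewrite !inE.
  by case: (eqVneq x b) => [->|].
have b0 := IH _ _ us iA iB; have b1 := IH _ _ us iA1 iB1.
have b01 := IH _ _ us iA iB1; have b10 := IH _ _ us iA1 iB.
have h1 : mean s (fun w => (box A B (b |: w))%:R) <= mean s (fun w => (box A1 B1 w)%:R).
  apply: mean_le => w sw; case e: (box A B (b |: w)); last exact: ler0n.
  case/orP: (C1 w sw e) => h.
    by rewrite (box_sub (fun v hv => hv) sB h).
  by rewrite (box_sub sA (fun v hv => hv) h).
have h2 : mean s (fun w => (box A B w)%:R) + mean s (fun w => (box A B (b |: w))%:R)
   <= mean s (fun w => (box A B1 w)%:R) + mean s (fun w => (box A1 B w)%:R).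
  rewrite -!meanD; apply: mean_le => w sw; rewrite -!natrD ler_nat.
  case e0: (box A B w).
    rewrite (box_sub (fun v hv => hv) sB e0) (box_sub sA (fun v hv => hv) e0).
    by case: (box A B _).
  case e1: (box A B (b |: w)) => //; have := C1 w sw e1.
  by case/orP => ->; rewrite ?addn1 ?add1n.
set a0 := mean s (fun w => (A w)%:R) in b0 b01 *.
set a1 := mean s (fun w => (A1 w)%:R) in b1 b10.
set c0 := mean s (fun w => (B w)%:R) in b0 b10 *.
set c1 := mean s (fun w => (B1 w)%:R) in b1 b01.
set C0 := mean s (fun w => (box A B w)%:R) in b0 h2 *.
set D1 := mean s (fun w => (box A B (b |: w))%:R) in h1 h2 *.
have -> : (1 - p) * C0 + p * D1 =
  (1 - p) ^+ 2 * C0 + p ^+ 2 * D1 + (1 - p) * p * (C0 + D1) by ring.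
have -> : ((1 - p) * a0 + p * a1) * ((1 - p) * c0 + p * c1) =
  (1 - p) ^+ 2 * (a0 * c0) + p ^+ 2 * (a1 * c1) +
  (1 - p) * p * (a0 * c1 + a1 * c0) by ring.
apply: lerD; first apply: lerD.
- by rewrite ler_wpM2l // exprn_ge0.
- by rewrite ler_wpM2l ?exprn_ge0 // (le_trans h1).
- by rewrite ler_wpM2l ?mulr_ge0 // (le_trans h2) // lerD.
Qed.

Lemma mean_sqr_le s X : (mean s X) ^+ 2 <= mean s (fun w => X w ^+ 2).
Proof.
pose c := mean s X.
have : 0 <= mean s (fun w => (X w - c) ^+ 2).
  by apply: mean_ge0 => w _; apply: sqr_ge0.
rewrite (@eq_mean s _ (fun w => X w ^+ 2 + (- (2 * c) * X w + c ^+ 2))); last first.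
  by move=> w; ring.
rewrite !meanD meanZ mean_cst -/c => h; rewrite -subr_ge0; apply: le_trans h _.
by rewrite le_eqVlt; apply/orP; left; apply/eqP; ring.
Qed.

Definition bond_diff X b w := X (b |: w) - X (w :\ b).

(** The Efron-Stein (Poincare) inequality. The first coordinate contributes
    [p q] times the squared mean of the discrete derivative; Jensen moves the
    square inside. *)
Lemma efron_stein s X : uniq s ->
  mean s (fun w => X w ^+ 2) - (mean s X) ^+ 2 <=
  p * (1 - p) * \sum_(b <- s) mean s (fun w => bond_diff X b w ^+ 2).
Proof.
elim: s X => [|b s IH] X /=; first by rewrite big_nil mulr0 subrr.
case/andP=> bs us; rewrite big_cons mulrDr.
set X1 := fun w => X (b |: w).
have h0 := IH X us; have h1 := IH X1 us.
have -> : (1 - p) * mean s (fun w => bond_diff X b w ^+ 2) +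
          p * mean s (fun w => bond_diff X b (b |: w) ^+ 2) =
          mean s (fun w => (X1 w - X w) ^+ 2).
  have e0 : mean s (fun w => bond_diff X b w ^+ 2) = mean s (fun w => (X1 w - X w) ^+ 2).
    apply: mean_eq => w sw; rewrite /bond_diff /X1.
    suff -> : w :\ b = w by [].
    by apply/setDidPl; rewrite disjoint_sym disjoints1; apply: contra bs => /sw.
  have e1 : mean s (fun w => bond_diff X b (b |: w) ^+ 2) = mean s (fun w => (X1 w - X w) ^+ 2).
    apply: mean_eq => w sw; rewrite /bond_diff /X1 setUA setUid setU1K //.
    by apply: contra bs => /sw.
  by rewrite e0 e1; ring.
have -> : \sum_(j <- s) ((1 - p) * mean s (fun w => bond_diff X j w ^+ 2) +
              p * mean s (fun w => bond_diff X j (b |: w) ^+ 2)) =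
   (1 - p) * \sum_(j <- s) mean s (fun w => bond_diff X j w ^+ 2) +
   p * \sum_(j <- s) mean s (fun w => bond_diff X1 j w ^+ 2).
  rewrite !big_distrr -big_split /=; apply: eq_big_seq => j js.
  congr (_ * _ + _ * _); apply: eq_mean => w; rewrite /bond_diff /X1 setUCA.
  suff -> : (b |: w) :\ j = b |: (w :\ j) by [].
  apply/setP=> x; rewrite !inE; case: (eqVneq x b) => [->|] //=.
  by rewrite andbT; apply/eqP => bj; move: bs; rewrite bj js.
have hd : (mean s X1 - mean s X) ^+ 2 <= mean s (fun w => (X1 w - X w) ^+ 2).
  by rewrite -meanB; apply: mean_sqr_le.
have -> : (1 - p) * mean s (fun w => X w ^+ 2) + p * mean s (fun w => X (b |: w) ^+ 2) -
   ((1 - p) * mean s X + p * mean s (fun w => X (b |: w))) ^+ 2 =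
   p * (1 - p) * (mean s X1 - mean s X) ^+ 2 +
   ((1 - p) * (mean s (fun w => X w ^+ 2) - (mean s X) ^+ 2) +
    p * (mean s (fun w => X1 w ^+ 2) - (mean s X1) ^+ 2)) by rewrite /X1; ring.
apply: lerD; first by rewrite ler_wpM2l // mulr_ge0.
apply: le_trans (lerD (ler_wpM2l q0 h0) (ler_wpM2l p0 h1)) _.
by rewrite le_eqVlt; apply/orP; left; apply/eqP; ring.
Qed.

Lemma chebyshev s X m (v t : R) : 0 < t -> mean s X = m ->
  mean s (fun w => X w ^+ 2) - m ^+ 2 <= v ->
  mean s (fun w => (t < X w - m)%R%:R) <= v / t ^+ 2.
Proof.
move=> t0 em hv; rewrite ler_pdivlMr ?exprn_gt0 //; apply: le_trans hv.
have -> : mean s (fun w => X w ^+ 2) - m ^+ 2 = mean s (fun w => (X w - m) ^+ 2).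
  rewrite (@eq_mean s (fun w => (X w - m) ^+ 2)
    (fun w => X w ^+ 2 + (- (2 * m) * X w + m ^+ 2))); last by move=> w; ring.
  by rewrite !meanD meanZ mean_cst em; ring.
rewrite mulrC -meanZ; apply: mean_le => w _; case: ltP => h; last first.
  by rewrite mulr0 sqr_ge0.
by rewrite mulr1 ler_sqr ?nnegrE ?(ltW t0) ?(ltW h) // (le_trans (ltW t0)) // ltW.
Qed.

End ProductMeasure.

Lemma mean_swap (R : realType) (I J : finType) (p q : R) (s : seq I) (t : seq J)
    (F : {set I} -> {set J} -> R) :
  mean p s (fun w => mean q t (F w)) = mean q t (fun v => mean p s (F ^~ v)).
Proof.
elim: s F => [|b s IH] F //=.
by rewrite [X in _ * X + _ * _]IH [X in _ * _ + _ * X]IH -!meanZ -meanD.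
Qed.

Lemma powerset_mean (R : realType) (I : finType) (p : R) (s : seq I)
    (X : {set I} -> R) : uniq s ->
  \sum_(w in powerset [set x in s])
     (\prod_(b <- s) (if b \in w then p else 1 - p)) * X w = mean p s X.
Proof.
elim: s X => [|b s IH] X /=.
  rewrite (_ : [set x in [::]] = set0); last by apply/setP=> x; rewrite !inE.
  by rewrite powerset0 big_set1 big_nil mul1r.
case/andP=> bs us; rewrite (bigID (fun w : {set I} => b \in w)) /= addrC.
have sE (w : {set I}) : (w \in powerset [set x in b :: s]) && (b \notin w) =
   (w \in powerset [set x in s]).
  rewrite !inE; apply/andP/idP => [[sw bw]|sw].
    apply/subsetP => x xw; have := subsetP sw _ xw; rewrite !inE.
    by case: eqP => // xb; move: bw; rewrite -xb xw.
  split; first by apply: subset_trans sw _; apply/subsetP=> x; rewrite !inE => ->; rewrite orbT.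
  by apply: contra bs => /(subsetP sw); rewrite inE.
congr (_ + _).
  rewrite -(IH X us) big_distrr (eq_bigl _ _ sE) /=; apply: eq_bigr => w.
  rewrite -sE => /andP[_ bw]; by rewrite big_cons (negbTE bw) mulrA.
rewrite -(IH _ us) big_distrr /=.
rewrite (reindex_onto (fun w => b |: w) (fun w => w :\ b)) /=; last first.
  by move=> w /andP[_ bw]; rewrite setD1K.
apply: eq_big => [w|w /andP[_ /eqP ew]].
  rewrite -sE !inE eqxx /= andbT.
  apply/andP/andP => [[sw /eqP ew]|[sw bw]].
    rewrite -ew; split; last by rewrite !inE eqxx.
    by apply: subset_trans sw; rewrite subsetDl.
  rewrite setU1K // eqxx; split=> //; rewrite subUset sw andbT.
  by rewrite sub1set inE mem_head.
have bw : b \notin w by rewrite -ew !inE eqxx.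
rewrite big_cons !inE eqxx /= mulrA; congr (_ * _ * _).
apply: eq_big_seq => j js; rewrite !inE; case: eqP => // jb.
by move: bs; rewrite -jb js.
Qed.

(** * Differentiation in the bond density *)

Section Russo.
Variables (R : realType) (I : finType).
Implicit Types (s : seq I) (X : {set I} -> R) (p : R).

(** The derivative in the density, by Russo's formula below; the recursion
    [diff_sum_cons] makes it computable one coordinate at a time. *)
Definition diff_sum p s X : R := \sum_(b <- s) mean p s (bond_diff X b).

Lemma diff_sum_cons p b s X : uniq (b :: s) ->
  diff_sum p (b :: s) X = mean p s (fun w => X (b |: w)) - mean p s X +
    ((1 - p) * diff_sum p s X + p * diff_sum p s (fun w => X (b |: w))).
Proof.
case/andP=> bs us; rewrite /diff_sum big_cons /=; set X1 := fun w => X (b |: w).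
congr (_ + _).
  have e0 : mean p s (bond_diff X b) = mean p s X1 - mean p s X.
    rewrite -meanB; apply: mean_eq => w sw; rewrite /bond_diff /X1.
    suff -> : w :\ b = w by [].
    by apply/setDidPl; rewrite disjoint_sym disjoints1; apply: contra bs => /sw.
  have e1 : mean p s (fun w => bond_diff X b (b |: w)) = mean p s X1 - mean p s X.
    rewrite -meanB; apply: mean_eq => w sw; rewrite /bond_diff /X1 setUA setUid setU1K //.
    by apply: contra bs => /sw.
  by rewrite e0 e1; ring.
rewrite !big_distrr -big_split /=; apply: eq_big_seq => j js.
congr (_ * _ + _ * _); apply: eq_mean => w; rewrite /bond_diff /X1 setUCA.
suff -> : (b |: w) :\ j = b |: (w :\ j) by [].
apply/setP=> x; rewrite !inE; case: (eqVneq x b) => [->|] //=.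
by rewrite andbT; apply/eqP => bj; move: bs; rewrite bj js.
Qed.

Lemma diff_sum_perm p s1 s2 X : perm_eq s1 s2 -> diff_sum p s1 X = diff_sum p s2 X.
Proof.
move=> pe; rewrite /diff_sum (perm_big _ pe) /=.
by apply: eq_bigr => b _; apply: mean_perm.
Qed.

(** Russo's formula, in a form valid for every function of the configuration. *)
Lemma russo s X p : uniq s -> is_derive p 1 (fun p => mean p s X) (diff_sum p s X).
Proof.
elim: s X => [|b s IH] X /=; first by rewrite /diff_sum big_nil => _; apply: is_derive_cst.
move=> ubs; have us : uniq s by case/andP: ubs.
have d0 := IH X us; have d1 := IH (fun w => X (b |: w)) us.
rewrite diff_sum_cons //; apply: is_derive_eq; rewrite /= /GRing.scale /=.
by ring.
Qed.
End Russo.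

(** * Clusters and explored bonds *)

Section Clusters.
Variable G : sgraph.
Implicit Types (w : {set {set G}}) (x y z u v a : G) (A B K P X : {set G}).

Definition cl w X : {set G} := [set y | [exists x in X, linked w x y]].

(** The bonds about which finding the cluster [A] gives no information. *)
Definition offb A : {set {set G}} := [set b : {set G} | [disjoint b & A]].
Definition inb P : {set {set G}} := [set b : {set G} | b \subset P].

Lemma joined_sym w : symmetric (joined w).
Proof. by move=> x y; rewrite /joined /= setUC. Qed.

Lemma linked_sym w : symmetric (linked w).
Proof. exact: sym_connect_sym (joined_sym w). Qed.

Lemma linked0 w x : linked w x x.
Proof. exact: connect0. Qed.

Lemma linked_trans w : transitive (linked w).
Proof. exact: connect_trans. Qed.

Lemma linked1 w x y : [set x; y] \in w -> linked w x y.
Proof. by move=> xy; apply: connect1. Qed.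

Lemma linked_closed w K x y :
  (forall a b : G, a \in K -> [set a; b] \in w -> b \in K) ->
  linked w x y -> x \in K -> y \in K.
Proof.
move=> cK /connectP[q]; elim: q x => [|z q IH] x /=; first by move=> _ ->.
by case/andP=> xz qz ey xK; apply: IH qz ey _; apply: cK xK xz.
Qed.

Lemma linked_sub w w' x y : w \subset w' -> linked w x y -> linked w' x y.
Proof.
move=> sw h; suff: y \in [set z | linked w' x z] by rewrite inE.
apply: linked_closed h _; last by rewrite inE linked0.
move=> a b; rewrite !inE => xa ab; apply: linked_trans xa _.
by apply: linked1; apply: (subsetP sw).
Qed.

Lemma mem_cluster w x y : (y \in cluster w x) = linked w x y.
Proof. by rewrite inE. Qed.

Lemma mem_cluster_self w x : x \in cluster w x.
Proof. by rewrite inE linked0. Qed.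

Lemma cluster_eq w x y : linked w x y -> cluster w x = cluster w y.
Proof.
move=> xy; apply/setP=> z; rewrite !inE; apply/idP/idP => h.
  by apply: linked_trans h; rewrite linked_sym.
exact: linked_trans h.
Qed.

Lemma cluster_sub w w' x : w \subset w' -> cluster w x \subset cluster w' x.
Proof. by move=> sw; apply/subsetP=> y; rewrite !inE; apply: linked_sub. Qed.

Lemma clP w X y : reflect (exists2 x, x \in X & linked w x y) (y \in cl w X).
Proof. by rewrite inE; apply: exists_inP. Qed.

Lemma sub_cl w X : X \subset cl w X.
Proof. by apply/subsetP=> x xX; apply/clP; exists x => //; apply: linked0. Qed.

Lemma cl_linked w X x y : linked w x y -> x \in cl w X -> y \in cl w X.
Proof.
move=> xy /clP[z zX zx]; apply/clP; exists z => //; exact: linked_trans xy.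
Qed.

Lemma cl_closed w X x y : x \in cl w X -> [set x; y] \in w -> y \in cl w X.
Proof. by move=> xX xy; apply: cl_linked xX; apply: linked1. Qed.

Lemma cl_min w X K : X \subset K ->
  (forall a b : G, a \in K -> [set a; b] \in w -> b \in K) -> cl w X \subset K.
Proof.
move=> sX cK; apply/subsetP=> y /clP[x xX xy].
by apply: linked_closed cK xy _; apply: (subsetP sX).
Qed.

Lemma cl_subw w w' X : w \subset w' -> cl w X \subset cl w' X.
Proof.
move=> sw; apply: cl_min; first exact: sub_cl.
by move=> a b aK ab; apply: cl_closed aK _; apply: (subsetP sw).
Qed.

Lemma cl_set1 w x : cl w [set x] = cluster w x.
Proof.
apply/setP=> y; rewrite [in RHS]inE; apply/clP/idP => [[z]|xy].
  by rewrite inE => /eqP ->.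
by exists x; rewrite ?inE.
Qed.

Lemma in_offb2 A x y : ([set x; y] \in offb A) = (x \notin A) && (y \notin A).
Proof. by rewrite inE disjoints_subset subUset !sub1set !inE. Qed.

Lemma in_inb2 P x y : ([set x; y] \in inb P) = (x \in P) && (y \in P).
Proof. by rewrite inE subUset !sub1set. Qed.

(** Finding that the clusters of [X] cover exactly [A] reveals only bonds that
    touch [A]: occupied ones that connect, vacant ones on the boundary. *)
Lemma cl_setD_offb w X A : (cl (w :\: offb A) X == A) = (cl w X == A).
Proof.
have sub := cl_subw X (subsetDl w (offb A)).
apply/eqP/eqP => e; rewrite e in sub; apply/eqP; rewrite eqEsubset sub ?andbT //=.
  apply: cl_min; first by rewrite -e sub_cl.
  move=> a b aA ab; rewrite -e; apply: (@cl_closed _ _ a); first by rewrite e.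
  by rewrite in_setD ab in_offb2 aA.
rewrite -{1}e; apply: cl_min; first exact: sub_cl.
move=> a b aK ab; have aA := subsetP sub _ aK; apply: cl_closed aK _.
by rewrite in_setD ab in_offb2 aA.
Qed.

Lemma linked_offb_notin w A u y :
  u \notin A -> linked (w :&: offb A) u y -> y \notin A.
Proof.
move=> uA /linked_closed h; have := h (~: A); rewrite !inE; apply => //.
by move=> a b; rewrite inE [b \in _]inE in_setI in_offb2 => _ /and3P[].
Qed.

Lemma linked_offb_cl w X u y :
  u \notin cl w X -> linked (w :&: offb (cl w X)) u y = linked w u y.
Proof.
move=> uA; apply/idP/idP; first by apply: linked_sub; rewrite subsetIl.
pose K := cluster (w :&: offb (cl w X)) u :\: cl w X.
move=> h; suff: y \in K by rewrite in_setD mem_cluster => /andP[].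
apply: linked_closed h _; last by rewrite in_setD uA mem_cluster_self.
move=> a b; rewrite !in_setD !mem_cluster => /andP[aA ua] ab.
have bA : b \notin cl w X.
  by apply: contra aA => bA; apply: cl_closed bA _; rewrite setUC.
rewrite bA /=; apply: linked_trans ua _; apply: linked1.
by rewrite in_setI ab in_offb2 aA bA.
Qed.

Lemma cluster_offb_cl w X u :
  u \notin cl w X -> cluster (w :&: offb (cl w X)) u = cluster w u.
Proof. by move=> uA; apply/setP=> y; rewrite !mem_cluster linked_offb_cl. Qed.

Lemma cluster_offb_cluster w v u : ~~ linked w v u ->
  cluster (w :&: offb (cluster w v)) u = cluster w u.
Proof.
rewrite -[cluster w v]cl_set1 => vu; apply: cluster_offb_cl.
by rewrite cl_set1 mem_cluster.
Qed.

Definition exits w B a := [exists u in B, [set u; a] \in w].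

(** An occupied path leaving the complement of [A] first runs inside it, then
    crosses one bond into [A], and may then be assumed not to come back to [B].
    *)
Lemma first_exit_cover w A v : v \notin A ->
  cluster w v \subset cluster (w :&: offb A) v :|:
    \bigcup_(a in A | exits w (cluster (w :&: offb A) v) a)
       cluster (w :&: offb (cluster (w :&: offb A) v)) a.
Proof.
move=> vA; set B := cluster (w :&: offb A) v.
have BA x : x \in B -> x \notin A by rewrite mem_cluster => /(linked_offb_notin vA).
rewrite -[cluster w v]cl_set1; apply: cl_min.
  by rewrite sub1set in_setU mem_cluster_self.
move=> y z; rewrite in_setU => /orP[yB|yU] yz.
  have [zB|zB] := boolP (z \in B); first by rewrite in_setU zB.
  have zA : z \in A.
    apply: contraR zB => zA; rewrite mem_cluster.
    apply: (@linked_trans _ y); first by rewrite -mem_cluster.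
    by apply: linked1; rewrite in_setI yz in_offb2 zA BA.
  rewrite in_setU; apply/orP; right; apply/bigcupP; exists z.
    by rewrite zA /=; apply/existsP; exists y; rewrite yB yz.
  exact: mem_cluster_self.
case/bigcupP: yU => a /andP[aA ea]; rewrite mem_cluster => ay.
rewrite in_setU; have [zB//|zB] := boolP (z \in B).
have yB : y \notin B.
  by apply: linked_offb_notin ay; apply/negP=> /BA; rewrite aA.
apply/bigcupP; exists a; first by rewrite aA.
rewrite mem_cluster; apply: linked_trans ay _; apply: linked1.
by rewrite in_setI yz in_offb2 yB.
Qed.

Definition reach x y : pred {set {set G}} := fun w => linked w x y.

Lemma reach_increasing x y : increasing_event (reach x y).
Proof. by move=> w w' sw; apply: linked_sub. Qed.

(** If [u] is linked to [a] and to [z], take a simple path from [u] to [a] and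
    let [x] be the point where a path from [z] first meets it: the three arms at
    [x] use disjoint bonds. *)
Lemma tree_graph_event w u a z : (forall b, b \in w -> #|b| = 2%N) ->
  linked w u a -> linked w u z ->
  exists x, box (reach u x) (box (reach x a) (reach x z)) w.
Proof.
move=> card2 /connectP[q0 uq0 ->] uz.
case/shortenP: uq0 => q uq uniq_q _ {q0}.
pose P := [set y in u :: q].
have : z \in \bigcup_(x in P) cluster (w :\: inb P) x.
  apply: linked_closed uz _; last first.
    by apply/bigcupP; exists u; rewrite ?mem_cluster_self // !inE eqxx.
  move=> y y' /bigcupP[x xP]; rewrite mem_cluster => xy yy'.
  have [y'P|y'P] := boolP (y' \in P).
    by apply/bigcupP; exists y' => //; apply: mem_cluster_self.
  apply/bigcupP; exists x => //; rewrite mem_cluster.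
  apply: linked_trans xy _; apply: linked1.
  by rewrite in_setD yy' andbT in_inb2 (negbTE y'P) andbF.
case/bigcupP=> x; rewrite inE => xq; rewrite mem_cluster => xz; exists x.
rewrite /P in xz; clear P.
move: xq uq uniq_q xz; case/splitPl => q1 q2 eux.
rewrite cat_path eux => /andP[p1 p2] uniq_q xz.
pose P1 := [set y in u :: q1]; pose P2 := [set y in x :: q2].
have in_path (y : G) r : path (joined w) y r ->
    linked (w :&: inb [set t in y :: r]) y (last y r).
  move=> yr; apply/connectP; exists r => //; apply: sub_in_path yr; last first.
    exact: (allss (y :: r)).
  move=> s t ys yt; rewrite /joined /= => st; rewrite in_setI st in_inb2.
  rewrite [s \in _]inE [t \in _]inE. by rewrite ys yt.
have disj b : b \in w -> b \in inb P1 -> b \in inb P2 -> False.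
  move=> bw; rewrite !inE => b1 b2.
  have : b \subset [set x].
    apply/subsetP=> y yb; rewrite inE.
    have := subsetP b1 _ yb; have := subsetP b2 _ yb; rewrite !inE.
    case: eqP => //= _ yq2; move: uniq_q; rewrite -cat_cons cat_uniq.
    by case/and3P=> _ /hasPn /(_ _ yq2) /= /negP yq1 _ /yq1.
  by move/subset_leq_card; rewrite card2 // cards1.
have sub1 : w :&: inb P1 \subset w by rewrite subsetIl.
apply/existsP; exists (w :&: inb P1); rewrite sub1 /=; apply/andP; split.
  by rewrite /reach -eux; apply: in_path.
apply/existsP; exists (w :&: inb P2); apply/and3P; split.
- apply/subsetP=> b; rewrite in_setI in_setD => /andP[bw bP2].
  rewrite bw andbT in_setI bw /=; apply/negP => bP1; exact: disj bw bP1 bP2.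
- by rewrite /reach last_cat eux; apply: in_path.
apply: linked_sub xz; apply/subsetP=> b; rewrite !in_setD => /andP[bP bw].
rewrite !in_setI bw /= andbT; apply/andP; split; apply: contra bP;
  rewrite !inE => /subset_trans; apply;
  apply/subsetP=> y; rewrite !inE mem_cat; last first.
  by move=> /orP[->|->]; rewrite ?orbT.
move=> /orP[/eqP ->|->]; rewrite ?orbT //.
by have := mem_last u q1; rewrite eux inE => /orP[->|->]; rewrite ?orbT.
Qed.

End Clusters.

(** * The Markov property and its consequences *)

Lemma mean_mem (R : realType) (I : finType) (p : R) (s : seq I) b :
  uniq s -> b \in s -> mean p s (fun w => (b \in w)%:R) = p.
Proof.
elim: s => [|c s IH] //= /andP[cs us]; rewrite inE; case: eqVneq => [-> _|bc /= bs].
  rewrite (@mean_eq _ _ _ s _ (fun=> 0)); last first.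
    by move=> w sw; case: (boolP (c \in w)) => // /sw; rewrite (negbTE cs).
  rewrite (@eq_mean _ _ _ s (fun w => (c \in c |: w)%:R) (fun=> 1)); last first.
    by move=> w; rewrite !inE eqxx.
  by rewrite !mean_cst; ring.
rewrite [X in _ + _ * X](_ : _ = mean p s (fun w => (b \in w)%:R)).
  by rewrite IH //; ring.
by apply: eq_mean => w; rewrite !inE (negbTE bc).
Qed.

(** The discrete derivative at [b] does not see the state of [b]. *)
Lemma mean_vacant (R : realType) (I : finType) (p : R) (s : seq I) b (F : R -> R)
    (X : {set I} -> R) : uniq s -> b \in s ->
  (1 - p) * mean p s (fun w => F (bond_diff X b w)) =
  mean p s (fun w => F (bond_diff X b w) * (b \notin w)%:R).
Proof.
move=> us bs; rewrite (@mean_indep _ _ _ _ [set b]); first 1 last.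
- move=> w; rewrite /bond_diff setDDl setUid (_ : b |: w :\ b = b |: w) //.
  by apply/setP=> x; rewrite !inE; case: (x == b).
- by move=> w; rewrite !inE eqxx andbT.
rewrite mulrC; congr (_ * _).
rewrite (_ : 1 - p = mean p s (fun w => 1 - (b \in w)%:R)).
  by apply: eq_mean => w; case: (b \in w); rewrite ?subrr ?subr0.
by rewrite meanB mean_cst mean_mem.
Qed.

Section PercolationBounds.
Variables (R : realType) (G : sgraph) (p : R).
Implicit Types (w : {set {set G}}) (x y z u v a o : G) (A B S T : {set G}).

Lemma ExpectE (X : {set {set G}} -> R) : Expect p X = mean p (enum (bonds G)) X.
Proof.
rewrite -powerset_mean ?enum_uniq //; apply: eq_big => [w|w _].
  by congr (w \in powerset _); apply/setP=> b; rewrite !inE mem_enum.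
by rewrite /weight big_enum.
Qed.

Local Notation E := (mean p (enum (bonds G))).

Lemma sum_indicator (F : {set G} -> R) A :
  \sum_B (A == B)%:R * F B = F A.
Proof.
rewrite (bigD1 A) //= eqxx mul1r big1 ?addr0 // => B.
by rewrite eq_sym => /negbTE ->; rewrite mul0r.
Qed.

(** The spatial Markov property: given the union [A] of the clusters of the
    vertices of [S], the bonds disjoint from [A] are fresh. *)
Lemma markov_cl S (F : {set G} -> {set {set G}} -> R) :
  E (fun w => F (cl w S) (w :&: offb (cl w S))) =
  E (fun w => E (fun w' => F (cl w S) (w' :&: offb (cl w S)))).
Proof.
transitivity (\sum_A E (fun w => (cl w S == A)%:R * F A (w :&: offb A))).
  rewrite -mean_sum; apply: eq_mean => w.
  by rewrite (sum_indicator (fun A => F A (w :&: offb A))).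
transitivity (\sum_A E (fun w => (cl w S == A)%:R * E (fun w' => F A (w' :&: offb A)))).
  apply: eq_bigr => A _; rewrite (@mean_indep _ _ _ _ (offb A)).
  - by rewrite mulrC -meanZ; apply: eq_mean => w; rewrite mulrC.
  - by move=> w; rewrite cl_setD_offb.
  - by move=> w; rewrite -setIA setIid.
rewrite -mean_sum; apply: eq_mean => w.
by rewrite (sum_indicator (fun A => E (fun w' => F A (w' :&: offb A)))).
Qed.

Hypothesis p01 : 0 <= p <= 1.

Section Subadditive.
Variable F : nat -> R.
Hypothesis F0 : F 0%N = 0.
Hypothesis F_mono : {homo F : m n / (m <= n)%N >-> m <= n}.
Hypothesis F_sub : forall m n, F (m + n)%N <= F m + F n.

Lemma F_ge0 n : 0 <= F n.
Proof. by rewrite -F0 F_mono. Qed.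

Lemma F_setU A B : F #|A :|: B| <= F #|A| + F #|B|.
Proof. by apply: le_trans (F_sub _ _); rewrite F_mono // leq_card_setU. Qed.

Lemma F_bigcup (J : finType) (Q : pred J) (D : J -> {set G}) :
  F #|\bigcup_(j | Q j) D j| <= \sum_(j | Q j) F #|D j|.
Proof.
elim/big_rec2: _ => [|j s A _ le]; first by rewrite cards0 F0.
by apply: le_trans (F_setU _ _) _; rewrite lerD2l.
Qed.

(** Explore the cluster [B] of [v] off [A]. If the cluster of [v] is larger than
    [B], it leaves [B] through occupied bonds to [A], and from each vertex of
    [A] so reached it continues off [B], in a fresh environment. *)
Lemma first_exit A v : v \notin A ->
  E (fun w => F #|cluster w v|) <= E (fun w => F #|cluster (w :&: offb A) v|) +
    \sum_(a in A) E (fun w => (exits w (cluster (w :&: offb A) v) a)%:R) *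
                  E (fun w => F #|cluster w a|).
Proof.
move=> vA; pose C w := cluster (w :&: offb A) v.
apply: (@le_trans _ _ (E (fun w => F #|C w| + \sum_(a in A) ((exits w (C w) a)%:R *
     F #|cluster (w :&: offb (C w)) a|)))).
  apply: mean_le => // w _.
  apply: le_trans (F_mono (subset_leq_card (first_exit_cover w vA))) _.
  apply: le_trans (F_setU _ _) _; rewrite lerD2l.
  apply: le_trans (F_bigcup _ _) _; rewrite big_mkcondr /=.
  by apply: ler_sum => a _; case: ifP; rewrite ?mul1r ?mul0r.
rewrite meanD lerD2l mean_sum; apply: ler_sum => a aA.
apply: (@le_trans _ _ (\sum_B E (fun w => ((C w == B) && exits w B a)%:R *
        F #|cluster (w :&: offb B) a|))).
  rewrite -mean_sum le_eqVlt; apply/orP; left; apply/eqP; apply: eq_mean => w.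
  rewrite -[LHS](sum_indicator (fun B => (exits w B a)%:R * F #|cluster (w :&: offb B) a|)).
  by apply: eq_bigr => B _; rewrite mulrA -natrM mulnb.
apply: (@le_trans _ _ (\sum_B E (fun w => ((C w == B) && exits w B a)%:R) *
        E (fun w => F #|cluster w a|))).
  apply: ler_sum => B _; rewrite (@mean_indep _ _ _ _ (offb B)); last first.
  - by move=> w; rewrite -setIA setIid.
  - move=> w; rewrite /C -!cl_set1 setIDAC cl_setD_offb; congr (_ && _)%:R.
    apply: eq_existsb => u; case uB: (u \in B) => //=.
    by rewrite in_setD in_offb2 uB.
  apply: ler_wpM2l; first by apply: mean_ge0 => // w _; apply: ler0n.
  apply: mean_le => // w _; apply: F_mono; apply: subset_leq_card.
  by apply: cluster_sub; rewrite subsetIl.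
rewrite -mulr_suml ler_wpM2r //; first by apply: mean_ge0 => // w _; apply: F_ge0.
rewrite -mean_sum le_eqVlt; apply/orP; left; apply/eqP; apply: eq_mean => w.
rewrite -[RHS](sum_indicator (fun B => (exits w B a)%:R)).
by apply: eq_bigr => B _; rewrite -natrM mulnb.
Qed.

End Subadditive.

Definition conn w x y : R := (linked w x y)%:R.

Lemma conn_ge0 w x y : 0 <= conn w x y.
Proof. exact: ler0n. Qed.

(** The two-point function [tau], as an iterated expectation. *)
Definition two_point x y : R := E (fun w => conn w x y).

Lemma two_point_ge0 x y : 0 <= two_point x y.
Proof. by apply: mean_ge0 => // w _; apply: ler0n. Qed.

Lemma two_pointC x y : two_point x y = two_point y x.
Proof. by apply: eq_mean => w; rewrite /conn linked_sym. Qed.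

Lemma exits_le_two_point A v a :
  E (fun w => (exits w (cluster (w :&: offb A) v) a)%:R) <= two_point v a.
Proof.
apply: mean_le => // w _; case: (boolP (exits _ _ _)) => [/exists_inP[u]|_]; last exact: ler0n.
rewrite mem_cluster => vu ua; rewrite /conn.
suff -> : linked w v a by [].
apply: (linked_trans (y := u)); last exact: linked1.
by apply: linked_sub vu; rewrite subsetIl.
Qed.

(** The crossing bond touches [A], hence is independent of the exploration off
    [A]. *)
Lemma exits_le_sum A v a : v \notin A -> a \in A ->
  E (fun w => (exits w (cluster (w :&: offb A) v) a)%:R) <=
  \sum_(u | (u \notin A) && joined (bonds G) u a) p * E (fun w => conn (w :&: offb A) v u).
Proof.
move=> vA aA.
apply: (@le_trans _ _ (\sum_(u | (u \notin A) && joined (bonds G) u a)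
   E (fun w => ([set u; a] \in w)%:R * conn (w :&: offb A) v u))).
  rewrite -mean_sum; apply: mean_le => // w sw.
  have ge0 u : 0 <= ([set u; a] \in w)%:R * conn (w :&: offb A) v u.
    by rewrite mulr_ge0 ?ler0n.
  case: (boolP (exits _ _ _)) => [/exists_inP[u]|_]; last by apply: sumr_ge0.
  rewrite mem_cluster => vu ua; rewrite (bigD1 u) /=.
    by rewrite ua /conn vu mul1r lerDl sumr_ge0.
  by rewrite (linked_offb_notin vA vu) /joined /= -mem_enum sw.
apply: ler_sum => u /andP[uA ua]; rewrite (@mean_indep _ _ _ _ (offb A)).
- by rewrite mean_mem ?enum_uniq // mem_enum.
- by move=> w; rewrite in_setD in_offb2 aA andbF.
- by move=> w; rewrite -setIA setIid.
Qed.

(** Two applications of the BK inequality to the three disjoint arms. The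
    restriction to [T] serves to apply the bound off an explored region. *)
Lemma tree_graph (T : {set {set G}}) u a z :
  E (fun w => conn (w :&: T) u a * conn (w :&: T) u z) <=
  \sum_x E (fun w => conn (w :&: T) u x) * E (fun w => conn (w :&: T) x a) *
         E (fun w => conn (w :&: T) x z).
Proof.
rewrite (mean_filter p _ T (fun w => conn w u a * conn w u z)).
under eq_bigr do rewrite (mean_filter p _ T (fun w => conn w u _))
  (mean_filter p _ T (fun w => conn w _ a)) (mean_filter p _ T (fun w => conn w _ z)).
set s := [seq b <- _ | _].
have us : uniq s by rewrite filter_uniq // enum_uniq.
apply: (@le_trans _ _ (\sum_x mean p s
   (fun w => (box (reach u x) (box (reach x a) (reach x z)) w)%:R))).
  rewrite -mean_sum; apply: mean_le => // w sw.
  have ge0 x : 0 <= (box (reach u x) (box (reach x a) (reach x z)) w)%:R :> R.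
    exact: ler0n.
  rewrite /conn; case: (boolP (linked w u a)) => ua; last by rewrite mul0r sumr_ge0.
  case: (boolP (linked w u z)) => uz; last by rewrite mulr0 sumr_ge0.
  have [|x hx] := tree_graph_event _ ua uz.
    move=> b /sw; rewrite mem_filter => /andP[_]; rewrite mem_enum.
    exact: bonds_card2.
  by rewrite (bigD1 x) //= hx mul1r lerDl sumr_ge0.
apply: ler_sum => x _; rewrite -mulrA.
apply: le_trans (BK_inequality p01 us (@reach_increasing _ _ _)
   (box_increasing (@reach_increasing _ _ _) (@reach_increasing _ _ _))) _.
apply: ler_wpM2l; first by apply: mean_ge0 => // w _; apply: ler0n.
by apply: BK_inequality => //; apply: reach_increasing.
Qed.

Lemma conn_sub_le (T : {set {set G}}) x y : E (fun w => conn (w :&: T) x y) <= two_point x y.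
Proof.
apply: mean_le => // w _; rewrite /conn ler_nat.
case: (boolP (linked (w :&: T) x y)) => // h.
by rewrite (linked_sub _ h) // subsetIl.
Qed.

End PercolationBounds.

(** * Green vertices and transitivity *)

Section GreenVertices.
Variables (R : realType) (T : finType) (g : R).

Lemma mean_avoid (s : seq T) (A : {set T}) : uniq s ->
  mean (1 - g) s (fun X => [disjoint A & X]%:R) = g ^+ count (mem A) s.
Proof.
elim: s => [|x s IH] /=; first by rewrite disjoint_sym -setI_eq0 set0I eqxx.
case/andP=> xs us; rewrite IH //.
have -> : mean (1 - g) s (fun X => [disjoint A & x |: X]%:R) =
    (x \notin A)%:R * mean (1 - g) s (fun X => [disjoint A & X]%:R).
  rewrite -meanZ; apply: eq_mean => X.
  by rewrite disjoint_sym disjoints_subset subUset sub1set inE -disjoints_subset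
             disjoint_sym -natrM mulnb.
rewrite IH //; case: (x \in A) => /=; rewrite ?exprS ?add0n; ring.
Qed.

(** Colour the vertices green independently with probability [1 - g]: the
    weights [g ^+ #|cluster w x|] are probabilities of meeting no green vertex.
    *)
Lemma mean_green (A : {set T}) :
  mean (1 - g) (enum T) (fun X => [disjoint A & X]%:R) = g ^+ #|A|.
Proof.
rewrite mean_avoid ?enum_uniq // -sum1_card -sum1_count big_enum_cond /=.
by congr (_ ^+ _); apply: eq_bigl.
Qed.

End GreenVertices.

Section Transitivity.
Variables (R : realType) (G : sgraph).
Implicit Types (f : {perm G}) (w : {set {set G}}) (x y : G).
Hypothesis tG : transitive_graph G.

Definition move_config (f : {perm G}) (w : {set {set G}}) : {set {set G}} :=
  [set [set f x | x in (b : {set G})] | b : {set G} in w].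

Lemma move_config_inj f : injective (move_config f).
Proof. by apply: imset_inj; apply: imset_inj; apply: perm_inj. Qed.

Lemma in_move_config f w x y :
  ([set f x; f y] \in move_config f w) = ([set x; y] \in w).
Proof.
have -> : [set f x; f y] = [set f z | z in [set x; y]].
  by rewrite imsetU1 imset_set1.
by rewrite mem_imset //; apply: imset_inj; apply: perm_inj.
Qed.

Lemma move_config_bonds f : automorphism f -> move_config f (bonds G) = bonds G.
Proof.
move=> af; apply/eqP; rewrite eqEcard card_imset; last first.
  by apply: imset_inj; apply: perm_inj.
rewrite leqnn andbT; apply/subsetP=> c /imsetP[b bB ->].
have /eqP/cards2P[x [y [_ eb]]] := bonds_card2 bB; rewrite eb in bB *.
rewrite imsetU1 imset_set1; have := af x y; rewrite /joined /= => ->; exact: bB.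
Qed.

Lemma linked_move f w x y : linked (move_config f w) (f x) (f y) = linked w x y.
Proof.
apply/idP/idP => h.
  suff: f y \in [set f z | z in cluster w x].
    by rewrite mem_imset ?mem_cluster //; apply: perm_inj.
  apply: linked_closed h _; last by rewrite mem_imset ?mem_cluster_self //; apply: perm_inj.
  move=> a b /imsetP[z]; rewrite mem_cluster => xz ->.
  rewrite -(permKV f b) in_move_config => zb; apply: imset_f.
  by rewrite mem_cluster; apply: linked_trans xz (linked1 zb).
suff: y \in [set z | linked (move_config f w) (f x) (f z)] by rewrite inE.
apply: linked_closed h _; last by rewrite inE linked0.
move=> a b; rewrite !inE => xa ab; apply: linked_trans xa _; apply: linked1.
by rewrite in_move_config.
Qed.

Lemma card_cluster_move f w x : #|cluster (move_config f w) (f x)| = #|cluster w x|.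
Proof.
rewrite -[RHS](card_imset _ (@perm_inj _ f)); congr #|pred_of_set _|.
apply/setP=> y; rewrite -(permKV f y) mem_imset; last exact: perm_inj.
by rewrite !mem_cluster linked_move.
Qed.

(** An automorphism permutes the bonds, hence preserves the weight of a
    configuration once it is moved along. *)
Lemma cluster_law_transitive (p : R) (F : nat -> R) x y :
  mean p (enum (bonds G)) (fun w => F #|cluster w x|) =
  mean p (enum (bonds G)) (fun w => F #|cluster w y|).
Proof.
have [f [af <-]] := tG x y.
have inj : injective (fun b : {set G} => [set f z | z in b]).
  by apply: imset_inj; apply: perm_inj.
rewrite -!ExpectE /Expect [RHS](reindex_inj (@move_config_inj f)) /=.
apply: eq_big => [w|w _].
  rewrite !inE -{2}(move_config_bonds af).
  apply/idP/idP => [|/subsetP h]; first exact: imsetS.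
  apply/subsetP=> b bw; have : [set f z | z in b] \in move_config f w by apply: imset_f.
  by move/h; rewrite mem_imset.
rewrite card_cluster_move; congr (_ * _); rewrite /weight.
rewrite -[in RHS](move_config_bonds af) big_imset /=; last by move=> a b _ _; apply: inj.
by apply: eq_bigr => b _; rewrite mem_imset.
Qed.

End Transitivity.

(** * The magnetization and its pivotal bonds *)

Section Inequalities.
Variables (R : realType) (G : sgraph).
Implicit Types (w : {set {set G}}) (x y z u v a o : G) (A B S : {set G}).

Section SumOverBonds.

Lemma joined_neq u v : joined (bonds G) u v -> u != v.
Proof.
rewrite /joined /= => /bonds_card2; rewrite cards2.
by case: (u != v).
Qed.

Lemma pair_set_eq (T : finType) (u v x y : T) : x != y ->
  ([set u; v] == [set x; y]) = ((u, v) == (x, y)) || ((u, v) == (y, x)).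
Proof.
move=> xy; rewrite !xpair_eqE; apply/eqP/orP => [e|]; last first.
  by case=> /andP[/eqP -> /eqP ->] //; rewrite setUC.
have : u \in [set x; y] by rewrite -e !inE eqxx.
have : v \in [set x; y] by rewrite -e !inE eqxx orbT.
have : x \in [set u; v] by rewrite e !inE eqxx.
have : y \in [set u; v] by rewrite e !inE eqxx orbT.
rewrite !inE => hy hx hv hu; move: hu hv hx hy xy.
case/orP=> /eqP ->; case/orP=> /eqP ->; rewrite ?eqxx ?orbb /=.
- by move=> _ /eqP ->; rewrite eqxx.
- by left.
- by right.
- by move=> /eqP ->; rewrite eqxx.
Qed.

Lemma sum_bonds (K : {set G} -> R) (H : G -> G -> R) :
  (forall u v, joined (bonds G) u v -> K [set u; v] = H u v + H v u) ->
  \sum_(b in bonds G) K b = \sum_u \sum_(v | joined (bonds G) u v) H u v.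
Proof.
move=> KH; rewrite pair_big_dep /=.
rewrite (partition_big (fun q : G * G => [set q.1; q.2]) (mem (bonds G))) //=.
apply: eq_bigr => b bB; have /eqP/cards2P[x [y [xy eb]]] := bonds_card2 bB.
have xyB : joined (bonds G) x y by rewrite /joined /= -eb.
rewrite eb KH // (bigD1 (x, y)) /=; last by rewrite xyB eqxx.
congr (_ + _); rewrite (big_pred1 (y, x)) // => -[u v] /=.
rewrite pair_set_eq //; case: (eqVneq (u, v) (x, y)) => [[-> ->]|ne] /=.
  by rewrite andbF xpair_eqE (negbTE xy).
rewrite andbT; case: (eqVneq (u, v) (y, x)) => [[-> ->]|] /=; rewrite ?andbF //.
by have := joined_sym (bonds G) y x; rewrite /joined /= in xyB * => ->; rewrite xyB.
Qed.

Lemma sum_joined (F : G -> R) (Omega : nat) : (forall x, degree x = Omega) ->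
  \sum_u \sum_(v | joined (bonds G) u v) F u = Omega%:R * \sum_u F u.
Proof.
move=> dO; rewrite mulr_sumr; apply: eq_bigr => u _.
rewrite sumr_const -(dO u) /degree mulr_natl.
by congr (_ *+ _); apply: eq_card => v; rewrite !inE.
Qed.

End SumOverBonds.

Lemma card_cluster_sum w x : #|cluster w x|%:R = \sum_z conn R w x z.
Proof.
rewrite -sum1_card natr_sum [LHS]big_mkcond /=; apply: eq_bigr => z _.
by rewrite mem_cluster /conn; case: ifP.
Qed.

Section FixedP.
Variables (p g : R).
Hypothesis p01 : 0 <= p <= 1.
Hypothesis g01 : 0 <= g <= 1.
Local Notation E := (mean p (enum (bonds G))).

(** The magnetization: the probability that the cluster of [x] contains a green
    vertex, when vertices are green with probability [h = 1 - g]. [chig] is the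
    mean size of the cluster on the complementary event, that is, [g] times the
    derivative of [mag] in [h]; [dmag] is the derivative of [mag] in [p]. *)
Definition mag x : R := E (fun w => 1 - g ^+ #|cluster w x|).
Definition chig x : R := E (fun w => #|cluster w x|%:R * g ^+ #|cluster w x|).

Definition dmag o : R :=
  diff_sum p (enum (bonds G)) (fun w => 1 - g ^+ #|cluster w o|).

Let g0 : 0 <= g. Proof. by case/andP: g01. Qed.
Let g1 : g <= 1. Proof. by case/andP: g01. Qed.

Lemma escape0 : 1 - g ^+ 0 = 0.
Proof. by rewrite expr0 subrr. Qed.

Lemma escape_mono : {homo (fun k => 1 - g ^+ k) : m n / (m <= n)%N >-> m <= n}.
Proof. by move=> m n mn; rewrite lerD2l lerN2 ler_wiXn2l. Qed.

Lemma escape_sub m n : 1 - g ^+ (m + n) <= (1 - g ^+ m) + (1 - g ^+ n).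
Proof.
rewrite -subr_ge0 exprD.
have -> : 1 - g ^+ m + (1 - g ^+ n) - (1 - g ^+ m * g ^+ n) =
  (1 - g ^+ m) * (1 - g ^+ n) by ring.
by rewrite mulr_ge0 // subr_ge0 exprn_ile1.
Qed.

Lemma escape_le_natr k : 1 - g ^+ k <= (1 - g) * k%:R.
Proof.
elim: k => [|k IH]; first by rewrite expr0 subrr mulr0.
apply: le_trans (_ : (1 - g ^+ k) + (1 - g) <= _).
  by rewrite -addn1 -{2}(expr1 g) escape_sub.
by rewrite -natr1 mulrDr mulr1 lerD2r.
Qed.

Lemma escape_ge0 k : 0 <= 1 - g ^+ k.
Proof. by rewrite subr_ge0 exprn_ile1. Qed.

Lemma mag_ge0 x : 0 <= mag x.
Proof. by apply: mean_ge0 => // w _; apply: escape_ge0. Qed.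

Lemma mag_le1 x : mag x <= 1.
Proof.
rewrite -(mean_cst p (enum (bonds G)) 1); apply: mean_le => // w _.
by rewrite gerBl exprn_ge0.
Qed.

Lemma chig_ge0 x : 0 <= chig x.
Proof. by apply: mean_ge0 => // w _; rewrite mulr_ge0 ?ler0n ?exprn_ge0. Qed.

Lemma cluster_add w u v x :
  cluster ([set u; v] |: w) x =
  if linked w x u || linked w x v then cluster w u :|: cluster w v else cluster w x.
Proof.
set w' := [set u; v] |: w.
have sw : w \subset w' by rewrite subsetUr.
have uv : linked w' u v by apply: linked1; rewrite !inE eqxx.
have clos (K : {set G}) : (forall y, y \in K -> cluster w y \subset K) ->
    (u \in K) = (v \in K) -> forall a b : G, a \in K -> [set a; b] \in w' -> b \in K.
  move=> cK uvK a b aK; rewrite in_setU1 => /orP[/eqP e|ab]; last first.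
    by apply: (subsetP (cK _ aK)); rewrite mem_cluster linked1.
  have : a \in [set u; v] by rewrite -e !inE eqxx.
  have : b \in [set u; v] by rewrite -e !inE eqxx orbT.
  rewrite !inE => /orP[]/eqP -> /orP[]/eqP ea; rewrite ea in aK => //.
    by rewrite uvK.
  by rewrite -uvK.
have sub y : cluster w y \subset cluster w' y by apply: cluster_sub.
apply/eqP; rewrite eqEsubset; apply/andP; split.
  have [h|] := boolP (_ || _).
    apply/subsetP=> y; rewrite mem_cluster => xy.
    apply: linked_closed xy _; last first.
      by rewrite in_setU !mem_cluster ![linked w _ x]linked_sym.
    apply: clos; last by rewrite !in_setU !mem_cluster_self orbT.
    move=> z; rewrite in_setU !mem_cluster => /orP[] /cluster_eq <-.
      by rewrite subsetUl.
    by rewrite subsetUr.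
  rewrite negb_or => /andP[xu xv]; apply/subsetP=> y; rewrite mem_cluster => xy.
  apply: linked_closed xy _; last exact: mem_cluster_self.
  apply: clos; last by rewrite !mem_cluster (negbTE xu) (negbTE xv).
  by move=> z; rewrite mem_cluster => /cluster_eq ->.
have [h|_] := boolP (_ || _); last exact: sub.
have xu : linked w' x u.
  case/orP: h => h; first exact: linked_sub h.
  apply: (linked_trans (y := v)); first exact: linked_sub h.
  by rewrite linked_sym.
rewrite (cluster_eq xu) subUset sub /= (cluster_eq uv).
exact: sub.
Qed.

(** The probability, over the colours, that the cluster of [u] has no green
    vertex while that of [v] has one. *)
Definition newly w u v : R :=
  g ^+ #|cluster w u| - g ^+ #|cluster w u :|: cluster w v|.

Lemma newly_linked w u v : linked w u v -> newly w u v = 0.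
Proof. by move=> uv; rewrite /newly (cluster_eq uv) setUid subrr. Qed.

Lemma card_clusterU w u v : ~~ linked w u v ->
  #|cluster w u :|: cluster w v| = (#|cluster w u| + #|cluster w v|)%N.
Proof.
move=> uv; rewrite cardsU (_ : _ :&: _ = set0) ?cards0 ?subn0 //.
apply/setP => y; rewrite in_setI !mem_cluster in_set0.
apply: contraNF uv => /andP[uy vy].
by apply: linked_trans uy _; rewrite linked_sym.
Qed.

(** A vacant bond [uv] is pivotal for connecting [o] to the green vertices when
    one endpoint is linked to [o] in a cluster without green vertex, and the
    cluster of the other endpoint contains one. *)
Lemma dmag_pivotal o :
  (1 - p) * dmag o =
  \sum_u \sum_(v | joined (bonds G) u v) E (fun w => conn R w o u * newly w u v).
Proof.
rewrite /dmag /diff_sum big_enum /= mulr_sumr; apply: sum_bonds => u v uv.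
have uvB : [set u; v] \in enum (bonds G) by rewrite mem_enum.
pose X w := 1 - g ^+ #|cluster w o|.
transitivity (E (fun w => bond_diff X [set u; v] w * ([set u; v] \notin w)%:R)).
  by rewrite (mean_vacant p id X (enum_uniq _) uvB).
rewrite -meanD; apply: eq_mean => w.
have [uvw|uvw] := boolP ([set u; v] \in w).
  have luv := linked1 uvw; have lvu : linked w v u by rewrite linked_sym.
  by rewrite /= mulr0 !newly_linked // !mulr0 addr0.
have ew : w :\ [set u; v] = w.
  by apply/setDidPl; rewrite disjoint_sym disjoints1.
rewrite /= mulr1 /bond_diff ew /X cluster_add /newly [cluster w v :|: _]setUC /conn.
have alg (r s : R) : 1 - r - (1 - s) = s - r by ring.
rewrite alg.
case: (boolP (linked w o u)) => ou; case: (boolP (linked w o v)) => ov /=.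
- have uv' : linked w u v by rewrite linked_sym in ou; apply: linked_trans ou ov.
  by rewrite (cluster_eq ou) (cluster_eq uv') setUid !subrr !mulr0 addr0.
- by rewrite (cluster_eq ou) mul1r mul0r addr0.
- by rewrite (cluster_eq ov) mul1r mul0r add0r.
- by rewrite subrr !mul0r addr0.
Qed.

Lemma dmag_ge0 o : 0 <= dmag o.
Proof.
apply: sumr_ge0 => b _; apply: mean_ge0 => // w _.
rewrite subr_ge0; apply: escape_mono; apply: subset_leq_card; apply: cluster_sub.
by apply: subset_trans (subsetUr _ _); apply: subsetDl.
Qed.

(** The contribution of the oriented bond [uv] to the derivative of the
    magnetization, summed over the starting vertex. *)
Definition pivot u v : R := E (fun w => #|cluster w u|%:R * newly w u v).

Lemma sum_dmag : (1 - p) * \sum_o dmag o =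
  \sum_u \sum_(v | joined (bonds G) u v) pivot u v.
Proof.
rewrite mulr_sumr; under eq_bigr do rewrite dmag_pivotal.
rewrite exchange_big /=.
apply: eq_bigr => u _; rewrite exchange_big /=; apply: eq_bigr => v _.
rewrite -mean_sum; apply: eq_mean => w; rewrite -mulr_suml card_cluster_sum.
by congr (_ * _); apply: eq_bigr => o _; rewrite /conn linked_sym.
Qed.

Lemma pivot_markov u v : pivot u v =
  E (fun w => E (fun w' => (v \notin cluster w u)%:R *
     (#|cluster w u|%:R * g ^+ #|cluster w u|) *
     (1 - g ^+ #|cluster (w' :&: offb (cluster w u)) v|))).
Proof.
pose F A w' : R := (v \notin A)%:R * (#|A|%:R * g ^+ #|A|) * (1 - g ^+ #|cluster w' v|).
transitivity (E (fun w => F (cl w [set u]) (w :&: offb (cl w [set u])))); last first.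
  by rewrite markov_cl; apply: eq_mean => w; rewrite cl_set1.
apply: eq_mean => w; rewrite /F cl_set1 mem_cluster.
have [uv|uv] := boolP (linked w u v) => /=; first by rewrite newly_linked // !mul0r mulr0.
by rewrite cluster_offb_cluster // /newly card_clusterU // exprD mul1r -mulrA
           [g ^+ _ * (1 - _)]mulrBr mulr1.
Qed.

(** Given the cluster of [u], the cluster of [v] lives off it and is smaller
    than an unrestricted one. *)
Lemma pivot_upper u v : pivot u v <= chig u * mag v.
Proof.
rewrite pivot_markov mulrC -meanZ; apply: mean_le => // w _; rewrite meanZ mulrC.
have h0 : 0 <= #|cluster w u|%:R * g ^+ #|cluster w u| by rewrite mulr_ge0 ?ler0n ?exprn_ge0.
apply: ler_pM.
- by apply: mean_ge0 => // w' _; apply: escape_ge0.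
- by rewrite mulr_ge0 ?ler0n.
- apply: mean_le => // w' _; apply: escape_mono; apply: subset_leq_card.
  by apply: cluster_sub; rewrite subsetIl.
by case: (v \notin _); rewrite ?mul1r ?mul0r.
Qed.

Lemma avoid_iff w A S : [disjoint \bigcup_(x in A) cluster w x & S] =
  [forall x in A, x \notin cl w S].
Proof.
apply/idP/forall_inP => [dis x xA|h].
  apply/clP=> -[s sS]; rewrite linked_sym => xs.
  have := disjointFl dis sS; move/negP; apply; apply/bigcupP.
  by exists x; rewrite ?mem_cluster.
apply/pred0P=> s /=; apply/negP => /andP[/bigcupP[x xA]].
rewrite mem_cluster => xs sS; move/negP: (h x xA); apply; apply/clP.
by exists s; rewrite // linked_sym.
Qed.

Lemma avoid1 w x :
  mean (1 - g) (enum G) (fun S => (x \notin cl w S)%:R) = g ^+ #|cluster w x|.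
Proof.
rewrite -(big_set1 (@setU _) x (fun x => cluster w x)) -mean_green; apply: eq_mean => S.
rewrite avoid_iff; congr ((_ : bool)%:R); apply/idP/forall_inP => [h y|-> //].
  by rewrite inE => /eqP ->.
by rewrite inE.
Qed.

(** Inclusion-exclusion: the union of the two clusters also has no green vertex
    with probability [g] to its cardinality. *)
Lemma avoid2 w u v :
  mean (1 - g) (enum G) (fun S => ((u \notin cl w S) && (v \in cl w S))%:R) =
  newly w u v.
Proof.
have eUV : cluster w u :|: cluster w v = \bigcup_(x in [set u; v]) cluster w x.
  have [->|uv] := eqVneq u v; first by rewrite setUid setUid big_set1.
  by rewrite big_setU1 ?inE //= big_set1.
rewrite /newly -avoid1 eUV -mean_green -meanB; apply: eq_mean => S; rewrite avoid_iff.
have -> : [forall x in [set u; v], x \notin cl w S] =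
   (u \notin cl w S) && (v \notin cl w S).
  apply/forall_inP/andP => [h|[hu hv] x]; first by rewrite !h // !inE eqxx ?orbT.
  by rewrite in_set2 => /orP[]/eqP ->.
by case: (u \in _); case: (v \in _); rewrite /= ?subr0 ?subrr.
Qed.

(** The tree-graph bound survives the conditioning that the cluster of [u]
    misses the green vertices: given the union of all green clusters, what is
    left is percolation off that union, where the three arms are bounded by
    monotonicity. *)
Lemma ghost_tree u a :
  E (fun w => conn R w u a * (#|cluster w u|%:R * g ^+ #|cluster w u|)) <=
  \sum_x two_point p u x * two_point p x a * chig x.
Proof.
pose gr := mean (1 - g) (enum G).
have gq : 0 <= 1 - g <= 1 by rewrite subr_ge0 g1 /= gerBl.
have -> : E (fun w => conn R w u a * (#|cluster w u|%:R * g ^+ #|cluster w u|)) =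
   gr (fun S => \sum_z E (fun w => (u \notin cl w S)%:R * (conn R w u a * conn R w u z))).
  transitivity (gr (fun S => E (fun w => \sum_z (u \notin cl w S)%:R *
       (conn R w u a * conn R w u z)))).
    rewrite /gr mean_swap; apply: eq_mean => w; rewrite -avoid1 mulrA [RHS]mean_sum.
    rewrite card_cluster_sum mulr_sumr mulr_suml; apply: eq_bigr => z _.
    by rewrite -meanZ; apply: eq_mean => S; rewrite mulrC.
  by apply: eq_mean => S; rewrite mean_sum.
have -> : \sum_x two_point p u x * two_point p x a * chig x = gr (fun S => \sum_z
    \sum_x two_point p u x * two_point p x a * E (fun w => (x \notin cl w S)%:R * conn R w x z)).
  rewrite /gr mean_sum; under [RHS]eq_bigr do rewrite mean_sum.
  rewrite exchange_big /=; apply: eq_bigr => x _.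
  under [RHS]eq_bigr do rewrite meanZ mean_swap.
  rewrite -mulr_sumr; congr (_ * _); rewrite -mean_sum; apply: eq_mean => w.
  rewrite card_cluster_sum mulr_suml; apply: eq_bigr => z _; rewrite -avoid1 -meanZ.
  by apply: eq_mean => S; rewrite mulrC.
apply: mean_le => // S _; apply: ler_sum => z _.
have mk x y z' : E (fun w => (x \notin cl w S)%:R * (conn R w x y * conn R w x z')) =
   E (fun w => (x \notin cl w S)%:R * E (fun w' => conn R (w' :&: offb (cl w S)) x y *
         conn R (w' :&: offb (cl w S)) x z')).
  have := markov_cl p S (fun A w' => (x \notin A)%:R * (conn R w' x y * conn R w' x z')).
  under [in X in _ = X -> _]eq_mean do rewrite meanZ.
  move=> <-; apply: eq_mean => w; case: (boolP (x \in cl w S)) => xS; first by rewrite !mul0r.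
  by rewrite /conn !linked_offb_cl.
have mk1 x z' : E (fun w => (x \notin cl w S)%:R * conn R w x z') =
   E (fun w => (x \notin cl w S)%:R * E (fun w' => conn R (w' :&: offb (cl w S)) x z')).
  have := markov_cl p S (fun A w' => (x \notin A)%:R * conn R w' x z').
  under [in X in _ = X -> _]eq_mean do rewrite meanZ.
  move=> <-; apply: eq_mean => w; case: (boolP (x \in cl w S)) => xS; first by rewrite !mul0r.
  by rewrite /conn !linked_offb_cl.
rewrite mk; under eq_bigr do rewrite mk1 -meanZ.
rewrite -mean_sum; apply: mean_le => // w _.
have term_ge0 x : 0 <= two_point p u x * two_point p x a * ((x \notin cl w S)%:R *
    E (fun w' => conn R (w' :&: offb (cl w S)) x z)).
  by rewrite !mulr_ge0 ?two_point_ge0 ?ler0n //; apply: mean_ge0 => // w' _; apply: conn_ge0.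
case: (boolP (u \in cl w S)) => uS; first by rewrite mul0r sumr_ge0.
rewrite mul1r; apply: le_trans (tree_graph p01 _ _ _ _) _.
apply: ler_sum => x _.
have e0 y t : 0 <= E (fun w' => conn R (w' :&: offb (cl w S)) y t).
  by apply: mean_ge0 => // w' _; apply: conn_ge0.
case: (boolP (x \in cl w S)) => xS.
  rewrite (_ : E (fun w' => conn R (w' :&: offb (cl w S)) u x) = 0).
    by rewrite !mul0r mulr0.
  rewrite -[RHS](mean_cst p (enum (bonds G)) 0); apply: eq_mean => w'; rewrite /conn.
  case: (boolP (linked _ u x)) => // /(linked_offb_notin uS).
  by rewrite xS.
rewrite mul1r; apply: ler_wpM2r => //.
by apply: ler_pM => //; apply: conn_sub_le.
Qed.

End FixedP.
End Inequalities.

(** * Differential inequalities on transitive graphs *)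

Section TransitiveGraph.
Variables (R : realType) (G : sgraph) (Omega : nat).
Hypothesis tG : transitive_graph G.
Hypothesis degG : forall x : G, degree x = Omega.
Implicit Types (w : {set {set G}}) (x y z u v a o : G) (A B S : {set G}).

Lemma mag_transitive (p g : R) x y : mag p g x = mag p g y.
Proof. exact: (@cluster_law_transitive _ _ tG p (fun k => 1 - g ^+ k)). Qed.

Lemma chig_transitive (p g : R) x y : chig p g x = chig p g y.
Proof. exact: (@cluster_law_transitive _ _ tG p (fun k => k%:R * g ^+ k)). Qed.

Lemma mag_is_derive (p g : R) o :
  is_derive p 1 (fun p => mag p g o) (dmag p g o).
Proof. exact: russo (enum_uniq _). Qed.

Lemma dmag_transitive (p g : R) x y : dmag p g x = dmag p g y.
Proof.
have dx := mag_is_derive p g x; have dy := mag_is_derive p g y.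
have e : (fun p => mag p g x) = (fun p => mag p g y).
  by apply/boolp.funext => q; apply: mag_transitive.
by rewrite -(@derive_val _ _ _ _ _ _ _ dx) -(@derive_val _ _ _ _ _ _ _ dy) e.
Qed.

Lemma sum_degree u (F : G -> R) c : (forall v, joined (bonds G) u v -> F v = c) ->
  \sum_(v | joined (bonds G) u v) F v = Omega%:R * c.
Proof.
move=> Fc; rewrite (eq_bigr _ Fc) sumr_const -(degG u) mulr_natl /degree.
by congr (_ *+ _); apply: eq_card => v; rewrite !inE.
Qed.

Lemma card_vertices_gt0 o : 0 < #|G|%:R :> R.
Proof. by rewrite ltr0n; apply/card_gt0P; exists o. Qed.

Section FixedP.
Variables (p g : R) (o : G).
Hypothesis p01 : 0 <= p <= 1.
Hypothesis g01 : 0 <= g <= 1.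
Local Notation E := (mean p (enum (bonds G))).

Let V0 := card_vertices_gt0 o.

Lemma sum_dmag_transitive :
  #|G|%:R * ((1 - p) * dmag p g o) =
  \sum_u \sum_(v | joined (bonds G) u v) pivot p g u v.
Proof.
rewrite -sum_dmag // mulrCA; congr (_ * _).
rewrite (eq_bigr (fun=> dmag p g o)); last by move=> x _; apply: dmag_transitive.
by rewrite sumr_const mulr_natl.
Qed.

Lemma dmag_upper : (1 - p) * dmag p g o <= Omega%:R * chig p g o * mag p g o.
Proof.
rewrite -(ler_pM2l V0) sum_dmag_transitive.
rewrite (_ : #|G|%:R * _ = \sum_(u : G) \sum_(v | joined (bonds G) u v)
    chig p g o * mag p g o); last first.
  under eq_bigr => u _ do rewrite (@sum_degree u _ (chig p g o * mag p g o)) //.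
  by rewrite sumr_const mulr_natl mulrA.
apply: ler_sum => u _; apply: ler_sum => v _.
apply: le_trans (pivot_upper p01 g01 u v) _.
by rewrite (chig_transitive p g u o) (mag_transitive p g v o).
Qed.

(** If every connection of [v] to the green vertices uses a vertex [a] of [A],
    then [v] first reaches such an [a], and [a] connects to the green vertices
    in a fresh environment. *)
Lemma mag_off A v : v \notin A ->
  mag p g o - \sum_(a in A) two_point p v a * mag p g o <=
  E (fun w => 1 - g ^+ #|cluster (w :&: offb A) v|).
Proof.
move=> vA; rewrite lerBlDr.
have := first_exit p01 (escape0 g) (escape_mono g01) (escape_sub g01) vA.
rewrite -/(mag p g v) (mag_transitive p g o v) => /le_trans; apply; rewrite lerD2l.
apply: ler_sum => a _; rewrite -/(mag p g a) (mag_transitive p g v a).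
by apply: ler_wpM2r; [apply: mag_ge0 | apply: exits_le_two_point].
Qed.

(** The lower bound matching [pivot_upper]. The loss, compared with independent
    clusters, is a connection from [v] back to a vertex [a] of the cluster of
    [u]; the tree bound for the arms [u], [a] and the free end closes a triangle
    through the bond [uv]. *)
Lemma pivot_lower u v :
  mag p g o * chig p g o *
    (1 - \sum_x \sum_a two_point p u x * two_point p x a * two_point p a v) <= pivot p g u v.
Proof.
set m := mag p g o; set c := chig p g o.
pose Wt w := #|cluster w u|%:R * g ^+ #|cluster w u| : R.
have W0 w : 0 <= Wt w.
  by rewrite mulr_ge0 ?ler0n // exprn_ge0 //; case/andP: g01.
have m0 : 0 <= m by apply: mag_ge0.
apply: (@le_trans _ _ (E (fun w => Wt w * (m - \sum_(a in cluster w u) two_point p v a * m)))).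
  have -> : E (fun w => Wt w * (m - \sum_(a in cluster w u) two_point p v a * m)) =
     m * c - \sum_a two_point p v a * m * E (fun w => conn R w u a * Wt w).
    under eq_bigr do rewrite -meanZ; rewrite -mean_sum.
    rewrite /c (chig_transitive p g o u) /chig -meanZ -meanB; apply: eq_mean => w.
    rewrite mulrBr [Wt w * m]mulrC; congr (_ - _); rewrite mulr_sumr big_mkcond /=.
    apply: eq_bigr => a _; rewrite mem_cluster /conn.
    by case: (linked w u a); rewrite ?mul1r ?mul0r ?mulr0 // mulrC.
  rewrite mulrBr mulr1 lerD2l lerN2 exchange_big /= mulr_sumr.
  apply: ler_sum => a _; rewrite -mulrA (mulrC m c) -mulrA.
  apply: (@le_trans _ _ (two_point p v a * (m * \sum_x two_point p u x * two_point p x a * c))).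
    apply: ler_wpM2l; first exact: two_point_ge0.
    apply: ler_wpM2l => //; apply: le_trans (ghost_tree p01 g01 u a) _.
    by apply: ler_sum => x _; rewrite (chig_transitive p g x o).
  rewrite le_eqVlt; apply/orP; left; apply/eqP.
  rewrite -!mulr_suml two_pointC; ring.
rewrite pivot_markov //; apply: mean_le => // w _; rewrite meanZ.
rewrite -/(Wt w); case: (boolP (v \in cluster w u)) => vC /=.
  rewrite !mul0r; apply: mulr_ge0_le0 => //.
  rewrite subr_le0 (bigD1 v) //=.
  have -> : two_point p v v = 1.
    rewrite -(mean_cst p (enum (bonds G)) 1); apply: eq_mean => w'.
    by rewrite /conn linked0.
  by rewrite mul1r lerDl sumr_ge0 // => a _; rewrite mulr_ge0 // two_point_ge0.
by rewrite mul1r; apply: ler_wpM2l => //; apply: mag_off.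
Qed.

Lemma two_pointE x y : tau p x y = two_point p x y.
Proof. exact: ExpectE. Qed.

(** Neighbours are distinct, so along a bond the triangle diagram is at most
    [a0], without the diagonal term. *)
Lemma dmag_lower (a0 : R) : triangle_condition G p a0 ->
  Omega%:R * chig p g o * mag p g o * (1 - a0) <= (1 - p) * dmag p g o.
Proof.
move=> tri; rewrite -(ler_pM2l V0) sum_dmag_transitive.
rewrite (_ : #|G|%:R * _ = \sum_(u : G) \sum_(v | joined (bonds G) u v)
    (mag p g o * chig p g o * (1 - a0))); last first.
  under eq_bigr => u _ do rewrite (@sum_degree u _ (mag p g o * chig p g o * (1 - a0))) //.
  by rewrite sumr_const mulr_natl; congr (_ *+ _); ring.
apply: ler_sum => u _; apply: ler_sum => v uv.
apply: le_trans (pivot_lower u v).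
apply: ler_wpM2l; first by rewrite mulr_ge0 ?mag_ge0 ?chig_ge0.
rewrite lerD2l lerN2.
have := tri u v; rewrite (negbTE (joined_neq uv)) add0r /triangle => h.
apply: le_trans h; apply: ler_sum => x _; apply: ler_sum => a _.
by rewrite !two_pointE.
Qed.

(** The Aizenman-Barsky inequality. Apply the first-exit bound in an independent
    copy, with [A] the set of vertices linked to the green vertices: if [o] is
    in [A] use the trivial bound; if not, either the cluster of [o] off [A] is
    green in the copy, or the copy leaves it through a pivotal bond of the
    original. *)
Lemma aizenman_barsky :
  mag p g o <= (1 - g) * chig p g o + mag p g o ^+ 2 +
               p * mag p g o * ((1 - p) * dmag p g o).
Proof.
set m := mag p g o; have m0 : 0 <= m by apply: mag_ge0.
have gq : 0 <= 1 - g <= 1 by case/andP: g01 => g0 g1; rewrite subr_ge0 g1 /= gerBl.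
have p0 : 0 <= p by case/andP: p01.
pose J A w' : R := (1 - g) * #|cluster (w' :&: offb A) o|%:R +
   p * m * \sum_u \sum_(a | joined (bonds G) u a)
     ((u \notin A) && (a \in A))%:R * conn R (w' :&: offb A) o u.
have step A : m <= (o \in A)%:R * m + (o \notin A)%:R * E (J A).
  case: (boolP (o \in A)) => oA /=; first by rewrite mul1r mul0r addr0.
  rewrite mul0r add0r mul1r.
  have := first_exit p01 (escape0 g) (escape_mono g01) (escape_sub g01) oA.
  rewrite -/(mag p g o) -/m => /le_trans; apply; rewrite [E (J A)]meanD; apply: lerD.
    by apply: mean_le => // w _; apply: escape_le_natr.
  rewrite meanZ mean_sum; under [X in _ <= _ * X]eq_bigr do rewrite mean_sum.
  apply: (@le_trans _ _ (\sum_(a in A) \sum_(u | (u \notin A) && joined (bonds G) u a)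
      p * E (fun w => conn R (w :&: offb A) o u) * m)).
    apply: ler_sum => a aA; rewrite -mulr_suml -/(mag p g a) (mag_transitive p g a o) -/m.
    by apply: ler_wpM2r => //; apply: exits_le_sum.
  rewrite le_eqVlt; apply/orP; left; apply/eqP.
  rewrite mulr_sumr big_mkcond /=.
  under eq_bigr do rewrite big_mkcond /=.
  under [RHS]eq_bigr do rewrite big_mkcond mulr_sumr /=.
  rewrite [RHS]exchange_big /=; apply: eq_bigr => a _; case: (a \in A) => /=.
    apply: eq_bigr => u _; case: (joined _ u a); rewrite ?andbF ?andbT ?mulr0 //.
    by rewrite meanZ; case: (u \notin A); rewrite ?mul1r ?mul0r ?mulr0 // mulrAC.
  rewrite big1 // => u _; case: ifP; rewrite ?mulr0 // andbF => _.
  by rewrite meanZ mul0r mulr0.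
have stepS S : m <= E (fun w => (o \in cl w S)%:R * m + (o \notin cl w S)%:R *
    ((1 - g) * #|cluster w o|%:R + p * m * \sum_u \sum_(a | joined (bonds G) u a)
     ((u \notin cl w S) && (a \in cl w S))%:R * conn R w o u)).
  pose K w' A : R := (1 - g) * #|cluster w' o|%:R + p * m *
    \sum_u \sum_(a | joined (bonds G) u a)
       ((u \notin A) && (a \in A))%:R * conn R w' o u.
  pose F A w' : R := (o \notin A)%:R * K w' A.
  rewrite -/(K _ _) meanD.
  have -> : E (fun w => (o \notin cl w S)%:R * K w (cl w S)) =
      E (fun w => F (cl w S) (w :&: offb (cl w S))); last first.
    rewrite markov_cl -meanD -[X in X <= _](mean_cst p (enum (bonds G)) m).
    by apply: mean_le => // w _; rewrite meanZ; apply: step.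
  rewrite /F /K.
  apply: eq_mean => w; case: (boolP (o \in cl w S)) => oS; first by rewrite !mul0r.
  rewrite cluster_offb_cl //; congr (_ * (_ + _ * _)).
  apply: eq_bigr => u _; apply: eq_bigr => a _; congr (_ * _).
  by rewrite /conn linked_offb_cl.
pose gr := mean (1 - g) (enum G).
rewrite -[X in X <= _](mean_cst (1 - g) (enum G) m).
apply: le_trans (mean_le gq (fun S _ => stepS S)) _.
rewrite mean_swap.
have grA w x : gr (fun S => (x \notin cl w S)%:R) = g ^+ #|cluster w x|.
  exact: avoid1.
have grB w u v : gr (fun S => ((u \notin cl w S) && (v \in cl w S))%:R) = newly g w u v.
  exact: avoid2.
rewrite dmag_pivotal //.
have -> : (1 - g) * chig p g o + m ^+ 2 + p * m *
    (\sum_u \sum_(v | joined (bonds G) u v) E (fun w => conn R w o u * newly g w u v)) =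
  E (fun w => (1 - g) * (#|cluster w o|%:R * g ^+ #|cluster w o|) +
    m * (1 - g ^+ #|cluster w o|) +
    p * m * \sum_u \sum_(v | joined (bonds G) u v) conn R w o u * newly g w u v).
  rewrite !meanD !meanZ mean_sum; under [X in _ = _ + _ * X]eq_bigr do rewrite mean_sum.
  by rewrite expr2.
apply: mean_le => // w _; rewrite le_eqVlt; apply/orP; left; apply/eqP.
rewrite meanD [RHS]addrAC [RHS]addrC.
transitivity (gr (fun S => m * (o \in cl w S)%:R) +
   gr (fun S => (1 - g) * #|cluster w o|%:R * (o \notin cl w S)%:R +
     p * m * \sum_u \sum_(a | joined (bonds G) u a)
     conn R w o u * ((u \notin cl w S) && (a \in cl w S))%:R)).
  congr (_ + _); apply: eq_mean => S; first by rewrite mulrC.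
  case: (boolP (o \in cl w S)) => oS /=; last first.
    rewrite mul1r mulr1; congr (_ + _ * _).
    by apply: eq_bigr => u _; apply: eq_bigr => a _; rewrite mulrC.
  rewrite mul0r mulr0 add0r big1 ?mulr0 // => u _; rewrite big1 // => a _.
  rewrite /conn; case: (boolP (linked w o u)) => ou; last by rewrite mul0r.
  by rewrite (cl_linked ou oS) mulr0.
congr (_ + _).
  rewrite /gr meanZ; congr (_ * _); rewrite -avoid1.
  transitivity (gr (fun S => 1 - (o \notin cl w S)%:R)).
    by apply: eq_mean => S; case: (o \in _); rewrite ?subr0 ?subrr.
  by rewrite /gr meanB mean_cst.
rewrite /gr meanD !meanZ -/gr grA mulrA; congr (_ + _ * _).
rewrite /gr mean_sum; apply: eq_bigr => u _; rewrite mean_sum; apply: eq_bigr => a _.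
by rewrite meanZ -/gr grB.
Qed.

End FixedP.
End TransitiveGraph.

(** * The exploration bound *)

Section ExplorationBound.
Variables (R : realType) (G : sgraph) (Omega : nat).
Hypothesis degG : forall x : G, degree x = Omega.
Variables (p g : R).
Hypothesis p01 : 0 <= p <= 1.
Hypothesis g01 : 0 <= g <= 1.
Hypothesis g_lt1 : g < 1.
Implicit Types (w : {set {set G}}) (x y z u v a o : G) (A B S : {set G}).
Implicit Types (s : seq {set G}).

Lemma cauchy_schwarz2 (a b F H F' H' : R) :
  0 <= F -> 0 <= H -> 0 <= F' -> 0 <= H' ->
  a ^+ 2 <= F * H -> b ^+ 2 <= F' * H' -> (a + b) ^+ 2 <= (F + F') * (H + H').
Proof.
move=> F0 H0 F'0 H'0 ha hb.
suff h : a * b *+ 2 <= F * H' + F' * H.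
  rewrite sqrrD mulrDl !mulrDr.
  by move: (F * H) (F * H') (F' * H) (F' * H') ha hb h => *; lra.
have k0 : 0 <= F * H' + F' * H by rewrite addr_ge0 // mulr_ge0.
apply: le_trans (ler_norm _) _; rewrite -ler_sqr ?nnegrE //.
rewrite real_normK ?num_real // -mulr_natr !exprMn.
apply: (@le_trans _ _ ((F * H) * (F' * H') * 2 ^+ 2)).
  by apply: ler_wpM2r; rewrite ?sqr_ge0 //; apply: ler_pM; rewrite ?sqr_ge0.
rewrite -subr_ge0.
have -> : (F * H' + F' * H) ^+ 2 - F * H * (F' * H') * 2 ^+ 2 =
  (F * H' - F' * H) ^+ 2 by ring.
exact: sqr_ge0.
Qed.

Lemma weighted_sqr (l a F H : R) :
  0 <= l -> a ^+ 2 <= F * H -> (l * a) ^+ 2 <= (l * F) * (l * H).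
Proof.
move=> l0 h; rewrite exprMn (_ : l * F * (l * H) = l ^+ 2 * (F * H)); last by ring.
by rewrite ler_wpM2l // sqr_ge0.
Qed.

Definition touches B : pred {set G} := fun b => ~~ [disjoint b & B].

Lemma count_incident v s : uniq s -> {subset s <= bonds G} ->
  (count (fun b : {set G} => v \in b) s <= Omega)%N.
Proof.
move=> us sB; rewrite -size_filter.
rewrite -(card_uniqP (filter_uniq _ us)) -(degG v) /degree.
apply: leq_trans (leq_imset_card (fun y => [set v; y]) _).
apply: subset_leq_card; apply/subsetP => b; rewrite mem_filter => /andP[vb /sB bB].
have /eqP/cards2P[x [y [_ eb]]] := bonds_card2 bB.
move: vb; rewrite eb !inE => /orP[]/eqP ->; apply/imsetP.
  by exists y; rewrite // inE /joined /= -eb.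
by exists x; rewrite ?inE /joined /= setUC // -eb.
Qed.

(** The probability, over the colours, that a green vertex is linked to [B]
    outside [B]. *)
Definition escape_from B w : R := 1 - g ^+ (#|cl w B| - #|B|).

Lemma cl_add_in w B u v : u \in B -> cl ([set u; v] |: w) B = cl w (v |: B).
Proof.
move=> uB; apply/eqP; rewrite eqEsubset; apply/andP; split; apply: cl_min.
- by apply: subset_trans (sub_cl _ _); rewrite subsetUr.
- move=> a b aK; rewrite in_setU1 => /orP[/eqP e|ab]; last exact: cl_closed ab.
  have : b \in [set u; v] by rewrite -e !inE eqxx orbT.
  rewrite in_set2 => /orP[]/eqP ->; apply: (subsetP (sub_cl _ _)).
    by rewrite in_setU1 uB orbT.
  by rewrite in_setU1 eqxx.
- rewrite subUset sub_cl andbT sub1set; apply: (@cl_closed _ _ _ u).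
    by apply: (subsetP (sub_cl _ _)).
  by rewrite in_setU1 eqxx.
- by move=> a b aK ab; apply: cl_closed aK _; rewrite in_setU1 ab orbT.
Qed.

Lemma escape_add w B u v : u \in B -> v \notin B ->
  escape_from B ([set u; v] |: w) = (1 - g) + g * escape_from (v |: B) w.
Proof.
move=> uB vB; rewrite /escape_from cl_add_in // cardsU1 vB add1n.
have : (#|B| < #|cl w (v |: B)|)%N.
  by have := subset_leq_card (sub_cl w (v |: B)); rewrite cardsU1 vB.
move=> h; rewrite -(subnSK h) exprS.
by move: (g ^+ _) => t; ring.
Qed.

Lemma escape_from_ge0 B w : 0 <= escape_from B w.
Proof. exact: escape_ge0. Qed.

(** Explore the cluster of [B] bond by bond, stopping at the first green vertex
    outside [B]; [f] is the probability to find one. Up to the factor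
    [p (1 - p)], the derivative of [f] is the mean, on that event, of the
    stopped martingale of centred bond variables. By Cauchy-Schwarz its square
    is at most [f] times the variance of the martingale, which is [p (1 - p)]
    times the mean number of explored bonds. That number is at most the number
    of bonds touching [B] plus [Omega] per new vertex, and the mean number of
    new vertices is [f / (1 - g)], since each is green with probability [1 - g].
    The shift [c], the value of the martingale at the current time, makes the
    bound inductive. *)
Lemma exploration s B c : uniq s -> {subset s <= bonds G} ->
  let f := mean p s (escape_from B) in
  (p * (1 - p) * diff_sum p s (escape_from B) + c * f) ^+ 2 <=
  f * (p * (1 - p) * ((count (touches B) s)%:R + Omega%:R / (1 - g) * f) + c ^+ 2).
Proof.
have [n] := ubnP (size s); elim: n s B c => // n IH s B c.
rewrite ltnS => sn us sB; cbv zeta; set f := mean p s (escape_from B).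
have p0 : 0 <= p by case/andP: p01.
have q0 : 0 <= 1 - p by rewrite subr_ge0; case/andP: p01.
have g0 : 0 <= g by case/andP: g01.
have y0 : 0 < 1 - g by rewrite subr_gt0.
(* without a bond touching [B] the exploration is over and all terms vanish *)
have [/hasP[b bs tb]|/hasPn nt] := boolP (has (touches B) s); last first.
  have z w : {subset w <= s} -> escape_from B w = 0.
    move=> sw; rewrite /escape_from (_ : cl w B = B) ?subnn ?expr0 ?subrr //.
    apply/eqP; rewrite eqEsubset sub_cl andbT; apply: cl_min => // a b aB /sw.
    move/nt; rewrite negbK => /pred0P/(_ a) /=.
    by rewrite !inE eqxx aB.
  have -> : f = 0 by rewrite -(mean_cst p s 0); apply: mean_eq.
  rewrite /diff_sum big1_seq ?mul0r ?mulr0 ?addr0 ?expr0n //= => b bs.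
  rewrite -(mean_cst p s 0); apply: mean_eq => w sw; rewrite /bond_diff !z ?subrr //.
    by move=> x; rewrite !inE => /andP[_ /sw].
  by move=> x; rewrite !inE => /orP[/eqP ->|/sw].
have pe : perm_eq s (b :: rem b s) by apply: perm_to_rem.
set s' := rem b s in pe.
have us' : uniq (b :: s') by rewrite -(perm_uniq pe).
have us0 : uniq s' by case/andP: us'.
have sB' : {subset s' <= bonds G}.
  by move=> x xs; apply: sB; rewrite (perm_mem pe) inE xs orbT.
have sz : (size s' < n)%N by move: sn; rewrite (perm_size pe).
have [u [v [uB eb]]] : exists u v, u \in B /\ b = [set u; v].
  have /eqP/cards2P[x [y [_ eb]]] := bonds_card2 (sB _ bs).
  move: tb; rewrite /touches eb => /pred0Pn[z /= /andP[]].
  rewrite !inE => /orP[]/eqP -> zB; first by exists x, y.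
  by exists y, x; rewrite setUC.
have cnt : count (touches B) s = (count (touches B) s').+1.
  by rewrite (seq.permP pe) /= tb.
rewrite /f (mean_perm _ _ pe) (diff_sum_perm _ _ pe) diff_sum_cons //= cnt.
set f0 := mean p s' (escape_from B); set D0 := diff_sum p s' (escape_from B).
have f00 : 0 <= f0 by apply: mean_ge0 => // w _; apply: escape_from_ge0.
set d0 := count (touches B) s'.
have k0 : 0 <= Omega%:R / (1 - g) by rewrite divr_ge0 ?ler0n ?ltW.
have [vB|vB] := boolP (v \in B).
  have e w : escape_from B (b |: w) = escape_from B w.
    rewrite /escape_from eb cl_add_in //; congr (1 - g ^+ (#|pred_of_set (cl w _)| - _)).
    by apply/setUidPr; rewrite sub1set.
  have -> : mean p s' (fun w => escape_from B (b |: w)) = f0 by apply: eq_mean.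
  have -> : diff_sum p s' (fun w => escape_from B (b |: w)) = D0.
    by apply: eq_bigr => j _; apply: eq_mean => w; rewrite /bond_diff !e.
  have := IH s' B c sz us0 sB'; rewrite /= -/f0 -/D0 -/d0.
  have -> : (1 - p) * f0 + p * f0 = f0 by ring.
  have -> : f0 - f0 + ((1 - p) * D0 + p * D0) = D0 by ring.
  move=> /le_trans; apply; apply: ler_wpM2l => //; rewrite lerD2r.
  by apply: ler_wpM2l; rewrite ?mulr_ge0 // lerD2r ler_nat.
set f1 := mean p s' (escape_from (v |: B)).
set D1 := diff_sum p s' (escape_from (v |: B)).
have f10 : 0 <= f1 by apply: mean_ge0 => // w _; apply: escape_from_ge0.
have -> : mean p s' (fun w => escape_from B (b |: w)) = (1 - g) + g * f1.
  rewrite -[X in X + _](mean_cst p s' (1 - g)) -meanZ -meanD; apply: eq_mean => w.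
  by rewrite eb escape_add.
have -> : diff_sum p s' (fun w => escape_from B (b |: w)) = g * D1.
  rewrite /D1 /diff_sum mulr_sumr; apply: eq_bigr => j _; rewrite -meanZ.
  by apply: eq_mean => w; rewrite /bond_diff eb !escape_add //; ring.
(* the martingale moves by [- p] when the bond is vacant, by [1 - p] when occupied *)
have := IH s' B (c - p) sz us0 sB'; rewrite /= -/f0 -/D0 -/d0.
have := IH s' (v |: B) (c + (1 - p)) sz us0 sB'; rewrite /= -/f1 -/D1.
set d1 := count (touches (v |: B)) s'.
set k := Omega%:R / (1 - g) in k0 *.
have d1_le : d1%:R <= d0%:R + Omega%:R :> R.
  rewrite -natrD ler_nat; apply: leq_trans (_ : d0 + count (fun b : {set G} => v \in b) s' <= _)%N.
    rewrite -count_predUI; apply: leq_trans (leq_addr _ _); apply: sub_count => j /=.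
    rewrite /touches /= -!setI_eq0 setIUr setU_eq0 negb_and orbC => /orP[->//|].
    by rewrite setI_eq0 disjoint_sym disjoints1 negbK => ->; rewrite orbT.
  by rewrite leq_add2l count_incident.
set q := 1 - p in q0 *; set y := 1 - g in y0 *.
set H1 := _ + (c + q) ^+ 2; set H0 := _ + (c - p) ^+ 2.
move=> h1 h0.
have H00 : 0 <= H0.
  by rewrite addr_ge0 ?sqr_ge0 // !mulr_ge0 // addr_ge0 ?ler0n // mulr_ge0.
have H10 : 0 <= H1.
  by rewrite addr_ge0 ?sqr_ge0 // !mulr_ge0 // addr_ge0 ?ler0n // mulr_ge0.
have h2 : (c + q) ^+ 2 <= 1 * (c + q) ^+ 2 by rewrite mul1r.
have py0 : 0 <= p * y := mulr_ge0 p0 (ltW y0).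
have pg0 : 0 <= p * g by apply: mulr_ge0.
have F'0 : 0 <= p * y * 1 + p * g * f1 by rewrite mulr1 addr_ge0 // mulr_ge0.
have H'0 : 0 <= p * y * (c + q) ^+ 2 + p * g * H1.
  by rewrite addr_ge0 // mulr_ge0 // sqr_ge0.
have c12 := cauchy_schwarz2 (mulr_ge0 py0 ler01) (mulr_ge0 py0 (sqr_ge0 (c + q)))
  (mulr_ge0 pg0 f10) (mulr_ge0 pg0 H10) (weighted_sqr py0 h2) (weighted_sqr pg0 h1).
have := cauchy_schwarz2 (mulr_ge0 q0 f00) (mulr_ge0 q0 H00) F'0 H'0
  (weighted_sqr q0 h0) c12.
have -> : q * (p * q * D0 + (c - p) * f0) + (p * y * (c + q) + p * g * (p * q * D1 + (c + q) * f1))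
  = p * q * (y + g * f1 - f0 + (q * D0 + p * (g * D1))) + c * (q * f0 + p * (y + g * f1)).
  by rewrite /q; ring.
have -> : q * f0 + (p * y * 1 + p * g * f1) = q * f0 + p * (y + g * f1) by ring.
move=> /le_trans; apply; apply: ler_wpM2l.
  apply: addr_ge0; apply: mulr_ge0 => //; apply: addr_ge0; first exact: ltW.
  exact: mulr_ge0.
have kO : k * y = Omega%:R by rewrite /k mulfVK // gt_eqF.
rewrite -subr_ge0 -natr1.
have -> : p * q * (d0%:R + 1 + k * (q * f0 + p * (y + g * f1))) + c ^+ 2 -
   (q * H0 + (p * y * (c + q) ^+ 2 + p * g * H1)) =
   p * q * (p * y * d0%:R + p * (k * y) - p * g * (d1%:R - d0%:R)).
  by rewrite /H0 /H1 /q /y; ring.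
rewrite kO mulr_ge0 ?mulr_ge0 // subr_ge0.
apply: (@le_trans _ _ (p * g * Omega%:R)).
  by apply: ler_wpM2l => //; rewrite lerBlDl.
apply: (@le_trans _ _ (p * Omega%:R)); last first.
  by rewrite lerDr mulr_ge0.
rewrite -mulrA ler_wpM2l // ler_piMl //.
by case/andP: g01.
Qed.

Lemma dmag_exploration o :
  dmag p g o ^+ 2 * (p * (1 - p) * (1 - g)) <= mag p g o ^+ 2 * Omega%:R.
Proof.
have p0 : 0 <= p by case/andP: p01.
have q0 : 0 <= 1 - p by rewrite subr_ge0; case/andP: p01.
have g0 : 0 <= g by case/andP: g01.
have y0 : 0 < 1 - g by rewrite subr_gt0.
have [pq|pq] := eqVneq (p * (1 - p)) 0.
  by rewrite pq mul0r mulr0 mulr_ge0 // sqr_ge0.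
have pq0 : 0 < p * (1 - p) by rewrite lt_def pq mulr_ge0.
have ubs : uniq (enum (bonds G)) := enum_uniq _.
have sB : {subset enum (bonds G) <= bonds G} by move=> b; rewrite mem_enum.
have := exploration [set o] 0 ubs sB; cbv zeta.
set f := mean p _ _; set D := diff_sum _ _ _.
have f0 : 0 <= f by apply: mean_ge0 => // w _; apply: escape_from_ge0.
have e w : 1 - g ^+ #|cluster w o| = (1 - g) + g * escape_from [set o] w.
  rewrite /escape_from cl_set1 cards1 -[in LHS](@prednK #|cluster w o|) ?exprS.
    by rewrite subn1; move: (g ^+ _) => t; ring.
  by apply/card_gt0P; exists o; apply: mem_cluster_self.
have -> : mag p g o = (1 - g) + g * f.
  rewrite -[X in X + _](mean_cst p (enum (bonds G)) (1 - g)) -meanZ -meanD.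
  exact: eq_mean.
have -> : dmag p g o = g * D.
  rewrite /dmag /D /diff_sum mulr_sumr; apply: eq_bigr => b _; rewrite -meanZ.
  by apply: eq_mean => w; rewrite /bond_diff !e; ring.
have cO : (count (touches [set o]) (enum (bonds G)))%:R <= Omega%:R :> R.
  rewrite ler_nat; apply: leq_trans (count_incident o ubs sB).
  apply: sub_count => b /=; rewrite /touches disjoint_sym disjoints1 negbK.
  by [].
rewrite mul0r addr0 expr0n addr0; set k := Omega%:R / (1 - g) => h.
have h1 : p * (1 - p) * D ^+ 2 <= f * (Omega%:R + k * f).
  rewrite -(ler_pM2l pq0).
  have -> : p * (1 - p) * (p * (1 - p) * D ^+ 2) = (p * (1 - p) * D) ^+ 2 by ring.
  apply: le_trans h _; rewrite [leRHS]mulrCA; apply: ler_wpM2l => //.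
  by apply: ler_wpM2l; [apply: ltW | rewrite lerD2r].
have kO : k * (1 - g) = Omega%:R by rewrite /k mulfVK // gt_eqF.
have -> : (g * D) ^+ 2 * (p * (1 - p) * (1 - g)) =
  g ^+ 2 * (1 - g) * (p * (1 - p) * D ^+ 2) by ring.
apply: le_trans (ler_wpM2l _ h1) _; first by rewrite mulr_ge0 ?sqr_ge0 ?ltW.
have -> : g ^+ 2 * (1 - g) * (f * (Omega%:R + k * f)) =
  g ^+ 2 * f * (Omega%:R * (1 - g) + (k * (1 - g)) * f) by ring.
rewrite kO -subr_ge0.
have -> : (1 - g + g * f) ^+ 2 * Omega%:R -
    g ^+ 2 * f * (Omega%:R * (1 - g) + Omega%:R * f) =
  Omega%:R * ((1 - g) ^+ 2 + (1 - g) * (g * f) * (1 + (1 - g))) by ring.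
have y1 := ltW y0.
by rewrite mulr_ge0 // addr_ge0 ?sqr_ge0 // !mulr_ge0 // addr_ge0.
Qed.

End ExplorationBound.

(** * Susceptibility, degree and variance *)

Section Susceptibility.
Variables (R : realType) (G : sgraph) (Omega : nat).
Hypothesis tG : transitive_graph G.
Hypothesis degG : forall x : G, degree x = Omega.
Implicit Types (w : {set {set G}}) (x y z u v a o : G) (A B S : {set G}).
Variables (p : R) (o : G).
Hypothesis p01 : 0 <= p <= 1.
Local Notation E := (mean p (enum (bonds G))).

Let p0 : 0 <= p. Proof. by case/andP: p01. Qed.
Let q0 : 0 <= 1 - p. Proof. by rewrite subr_ge0; case/andP: p01. Qed.

Definition mean_cluster x : R := E (fun w => #|cluster w x|%:R).

Lemma mean_cluster_transitive x y : mean_cluster x = mean_cluster y.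
Proof. exact: (@cluster_law_transitive _ _ tG p (fun k => k%:R)). Qed.

Lemma mean_cluster_ge0 x : 0 <= mean_cluster x.
Proof. by apply: mean_ge0 => // w _; apply: ler0n. Qed.

Lemma sum_two_point x : \sum_y two_point p x y = mean_cluster x.
Proof.
by rewrite -mean_sum; apply: eq_mean => w; rewrite card_cluster_sum.
Qed.

(** First exit from the single vertex [o]. *)
Lemma mean_cluster_bound :
  mean_cluster o <= 1 + Omega%:R * p * mean_cluster o.
Proof.
pose A := ~: [set o]; have oA : o \notin A by rewrite !inE eqxx.
have F0 : 0%:R = 0 :> R by [].
have Fm : {homo (fun k : nat => k%:R : R) : m n / (m <= n)%N >-> m <= n}.
  by move=> m n; rewrite ler_nat.
have Fs m n : (m + n)%:R <= m%:R + n%:R :> R by rewrite natrD.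
have := first_exit p01 F0 Fm Fs oA.
rewrite -/(mean_cluster o) => /le_trans; apply; apply: lerD.
  rewrite -[leRHS](mean_cst p (enum (bonds G)) 1); apply: mean_le => // w _.
  rewrite -[1]/(1%:R) ler_nat -(cards1 o); apply: subset_leq_card.
  apply/subsetP => y; rewrite mem_cluster => /(linked_offb_notin oA).
  by rewrite !inE negbK.
rewrite -mulrA -(@sum_degree R G Omega degG o (fun=> p * mean_cluster o)) //.
rewrite big_mkcond [leRHS]big_mkcond /=; apply: ler_sum => a _.
have pc0 : 0 <= p * mean_cluster o by rewrite mulr_ge0 ?mean_cluster_ge0.
case: ifP => aA; last by case: ifP.
rewrite -/(mean_cluster a) (mean_cluster_transitive a o).
apply: (@le_trans _ _ ((if joined (bonds G) o a then p else 0) * mean_cluster o)); last first.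
  by case: ifP => // _; rewrite mul0r.
apply: ler_wpM2r; first exact: mean_cluster_ge0.
apply: le_trans (exits_le_sum p01 oA aA) _.
rewrite big_mkcond (bigD1 o) //= big1 ?addr0.
  rewrite oA /=; case: ifP => // _; apply: ler_piMr => //.
  by apply: mean_prob.
by move=> u uo; rewrite !inE uo.
Qed.

Lemma second_moment :
  E (fun w => #|cluster w o|%:R ^+ 2) <= mean_cluster o ^+ 3.
Proof.
rewrite (@eq_mean _ _ _ _ _ (fun w => \sum_a \sum_z
    conn R (w :&: setT) o a * conn R (w :&: setT) o z)); last first.
  move=> w; rewrite setIT expr2 card_cluster_sum mulr_suml.
  by apply: eq_bigr => a _; rewrite mulr_sumr.
rewrite mean_sum.
apply: (@le_trans _ _ (\sum_a \sum_z \sum_x two_point p o x * two_point p x a * two_point p x z)).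
  apply: ler_sum => a _; rewrite mean_sum; apply: ler_sum => z _.
  apply: le_trans (tree_graph p01 _ _ _ _) _; apply: ler_sum => x _.
  have e y t : E (fun w => conn R (w :&: setT) y t) = two_point p y t.
    by apply: eq_mean => w; rewrite setIT.
  by rewrite !e.
rewrite le_eqVlt; apply/orP; left; apply/eqP.
under eq_bigr do rewrite exchange_big /=.
rewrite exchange_big /= (eq_bigr (fun x => two_point p o x * mean_cluster o ^+ 2)).
  by rewrite -mulr_suml sum_two_point; ring.
move=> x _; under eq_bigr do rewrite -mulr_sumr sum_two_point.
rewrite -mulr_suml -mulr_sumr sum_two_point (mean_cluster_transitive x o).
by ring.
Qed.

Lemma two_point_joined u v : joined (bonds G) u v -> p <= two_point p u v.
Proof.
move=> uv; rewrite -[leLHS](@mean_mem _ _ p (enum (bonds G)) [set u; v]) ?enum_uniq ?mem_enum //.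
apply: mean_le => // w _; rewrite /conn ler_nat.
by case: (boolP (_ \in w)) => // /linked1 ->.
Qed.

Lemma two_point_self u : two_point p u u = 1.
Proof.
by rewrite -(mean_cst p (enum (bonds G)) 1); apply: eq_mean => w; rewrite /conn linked0.
Qed.

(** The terms of the triangle diagram at [o] that go to a neighbour and back. *)
Lemma triangle_degree (a0 : R) : triangle_condition G p a0 ->
  Omega%:R * p ^+ 2 <= a0.
Proof.
move=> /(_ o o); rewrite eqxx /triangle (bigD1 o) //= => h.
have t0 x y : 0 <= tau p x y by rewrite two_pointE two_point_ge0.
rewrite -(lerD2l 1); apply: le_trans h; rewrite -[leLHS]addr0; apply: lerD; last first.
  by apply: sumr_ge0 => x _; apply: sumr_ge0 => y _; rewrite !mulr_ge0.
rewrite (bigD1 o) //= !two_pointE two_point_self !mul1r; apply: lerD => //.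
rewrite -(@sum_degree R G Omega degG o (fun=> p ^+ 2)) // big_mkcond [leRHS]big_mkcond /=.
apply: ler_sum => v _; case: ifP => ov; last by case: ifP => // _; rewrite !mulr_ge0.
rewrite eq_sym (joined_neq ov) !two_pointE mul1r expr2.
by apply: ler_pM => //; rewrite two_point_joined // joined_sym.
Qed.

Section Variance.
Variable N : R.
Hypothesis N0 : 0 <= N.

Definition large w x : R := (N <= #|cluster w x|%:R)%R%:R.
Definition small_size w x : R := #|cluster w x|%:R * (#|cluster w x|%:R < N)%R%:R.

Lemma small_size_ge0 w x : 0 <= small_size w x.
Proof. by rewrite mulr_ge0 ?ler0n. Qed.

Lemma small_size_le w x : small_size w x <= N.
Proof. by rewrite /small_size; case: ltP => h; rewrite ?mulr1 ?mulr0 // ltW. Qed.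

Definition large_count w : R := \sum_x large w x.

Lemma large_mono w w' x : w \subset w' -> large w x <= large w' x.
Proof.
move=> sw; rewrite /large ler_nat; case: (boolP (N <= _)) => // h.
suff -> : N <= #|cluster w' x|%:R by [].
by apply: le_trans h _; rewrite ler_nat subset_leq_card // cluster_sub.
Qed.

(** Only vertices in clusters of size below [N] can become large when one bond
    is switched on, and they all lie in the clusters of its endpoints. *)
Lemma large_count_diff w u v :
  0 <= large_count ([set u; v] |: w) - large_count w <= small_size w u + small_size w v.
Proof.
rewrite /large_count -sumrB; apply/andP; split.
  by apply: sumr_ge0 => x _; rewrite subr_ge0 large_mono // subsetUr.
rewrite /small_size !card_cluster_sum !mulr_suml -big_split /=; apply: ler_sum => x _.
rewrite -!card_cluster_sum.
have c0 y : 0 <= conn R w y x * (#|cluster w y|%:R < N)%R%:R by rewrite mulr_ge0 ?ler0n.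
have [N_x|N_x] := boolP (large w x == 1).
  rewrite (eqP N_x); apply: le_trans (addr_ge0 (c0 u) (c0 v)).
  by rewrite subr_le0 /large; case: (N <= _).
have {N_x} N_x : #|cluster w x|%:R < N.
  by rewrite ltNge; apply: contra N_x => h; rewrite /large h.
have -> : large w x = 0 by rewrite /large leNgt N_x.
rewrite subr0; have [h|] := boolP (linked w x u || linked w x v); last first.
  move=> h; have -> : large ([set u; v] |: w) x = 0.
    by rewrite /large cluster_add (negbTE h) leNgt N_x.
  exact: addr_ge0.
apply: le_trans (_ : 1 <= _); first by rewrite /large; case: (N <= _).
case/orP: h => h; rewrite /conn.
  rewrite [linked w u x]linked_sym h -(cluster_eq h) N_x mulr1 lerDl.
  exact: c0.
rewrite [linked w v x]linked_sym h -(cluster_eq h) N_x mulr1 lerDr.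
exact: c0.
Qed.

Lemma large_count_sensitivity u v : joined (bonds G) u v ->
  p * (1 - p) * E (fun w => bond_diff large_count [set u; v] w ^+ 2) <=
  p * (2 * N) * (E (small_size ^~ u) + E (small_size ^~ v)).
Proof.
move=> uv; rewrite -!mulrA; apply: ler_wpM2l => //; rewrite mulrA.
have uvB : [set u; v] \in enum (bonds G) by rewrite mem_enum.
rewrite (mean_vacant p (fun t => t ^+ 2) large_count (enum_uniq _) uvB).
rewrite -meanD -meanZ; apply: mean_le => // w _.
have s0 : 0 <= small_size w u + small_size w v by rewrite addr_ge0 ?small_size_ge0.
have [uvw|uvw] := boolP (_ \in w); first by rewrite mulr0 !mulr_ge0.
rewrite mulr1 /bond_diff (_ : w :\ [set u; v] = w); last first.
  by apply/setDidPl; rewrite disjoint_sym disjoints1.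
have /andP[d0 d1] := large_count_diff w u v.
rewrite expr2; apply: ler_pM => //; apply: le_trans d1 _.
by rewrite mulrDl mul1r lerD // small_size_le.
Qed.

(** Efron-Stein, where the squared sensitivity to a bond is at most [2 N] times
    the sizes of the small clusters at its endpoints. *)
Lemma large_count_variance :
  E (fun w => large_count w ^+ 2) - E large_count ^+ 2 <=
  2 * N * (Omega%:R * p) * #|G|%:R * E (small_size ^~ o).
Proof.
apply: le_trans (efron_stein p01 _ (enum_uniq _)) _.
pose K (b : {set G}) : R := \sum_(x in b) p * (2 * N) * E (small_size ^~ x).
apply: (@le_trans _ _ (\sum_(b in bonds G) K b)).
  rewrite big_enum /= mulr_sumr; apply: ler_sum => b bB.
  have /eqP/cards2P[u [v [uv eb]]] := bonds_card2 bB.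
  rewrite /K eb big_setU1 ?inE //= big_set1 -mulrDr.
  by apply: large_count_sensitivity; rewrite /joined /= -eb.
have small_tr x : E (small_size ^~ x) = E (small_size ^~ o).
  exact: (@cluster_law_transitive _ _ tG p (fun k => k%:R * (k%:R < N)%R%:R)).
rewrite (@sum_bonds R G K (fun u v => p * (2 * N) * E (small_size ^~ u))).
  rewrite (sum_joined _ degG) (eq_bigr (fun=> p * (2 * N) * E (small_size ^~ o))).
    rewrite sumr_const -[_ *+ _]mulr_natr le_eqVlt; apply/orP; left; apply/eqP.
    by move: (mean _ _ _) => e; rewrite cardT -cardE; ring.
  by move=> x _; rewrite small_tr.
by move=> u v uv; rewrite /K big_setU1 ?inE ?joined_neq //= big_set1.
Qed.

End Variance.
End Susceptibility.

(** * Elementary bounds on the magnetization *)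

Section Magnetization.
Variables (R : realType) (G : sgraph) (p : R) (o : G).
Implicit Types (w : {set {set G}}) (h r t N : R).
Hypothesis p01 : 0 <= p <= 1.
Local Notation E := (mean p (enum (bonds G))).

Lemma card_cluster_gt0 w : (0 < #|cluster w o|)%N.
Proof. by apply/card_gt0P; exists o; apply: mem_cluster_self. Qed.

Lemma bernoulli_inv h k : 0 <= h <= 1 -> (1 - h) ^+ k * (1 + k%:R * h) <= 1.
Proof.
case/andP=> h0 h1; elim: k => [|k IH]; first by rewrite mul0r addr0 mulr1.
apply: le_trans IH; rewrite exprSr -mulrA ler_wpM2l ?exprn_ge0 ?subr_ge0 // -subr_ge0.
have -> : 1 + k%:R * h - (1 - h) * (1 + k.+1%:R * h) = (k%:R + 1) * h ^+ 2.
  by rewrite -[k.+1%:R]natr1; ring.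
by rewrite mulr_ge0 ?addr_ge0 ?sqr_ge0.
Qed.

Lemma bernoulli h k : 0 <= h <= 1 -> 1 - k%:R * h <= (1 - h) ^+ k.
Proof.
move=> h01; have g01 : 0 <= 1 - h <= 1 by lra.
have := escape_le_natr g01 k; rewrite subKr => H.
by rewrite lerBlDr -lerBlDl mulrC.
Qed.

Lemma escape_second_order h k : 0 <= h <= 1 ->
  k%:R * h - (k%:R * h) ^+ 2 / 2 <= 1 - (1 - h) ^+ k.
Proof.
move=> h01; elim: k => [|k IH]; first by rewrite expr0; lra.
have := bernoulli k h01; rewrite [(1 - h) ^+ k.+1]exprS -[k.+1%:R]natr1.
move: ((1 - h) ^+ k) IH => x IH hx.
have hxx : h * (1 - k%:R * h) <= h * x by apply: ler_wpM2l => //; case/andP: h01.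
have h2 := sqr_ge0 h; move: (k%:R) hxx IH => K hxx IH.
lra.
Qed.

Lemma escape_lower h k : 0 <= h <= 1 -> k%:R * h <= 1 ->
  k%:R * h <= 2 * (1 - (1 - h) ^+ k).
Proof.
move=> h01 kh; have := escape_second_order k h01.
have kh0 : 0 <= k%:R * h by rewrite mulr_ge0 //; case/andP: h01.
by move: (k%:R * h) ((1 - h) ^+ k) kh kh0 => x y; nra.
Qed.

(** [mag_theta], [mag_small] and [mag_split] relate the magnetization at [h] to
    the cluster size cut at [N], mostly with [h] of order [1 / N]: a cluster
    larger than [N] has a green vertex with probability bounded below, and one
    smaller than [N] has one with probability of order [h] times its size. *)
Lemma mag_theta h N : 0 <= h <= 1 -> 0 <= N ->
  (1 - (1 + h * N)^-1) * E (fun w => large N w o) <= mag p (1 - h) o.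
Proof.
move=> h01 N0; rewrite -meanZ; apply: mean_le => // w _; rewrite /large.
have [h0 _] := andP h01.
case: (boolP (N <= _)) => Nk; last first.
  by rewrite mulr0 escape_ge0 //; lra.
rewrite mulr1 lerD2l lerN2.
have pos : 0 < 1 + h * N by rewrite ltr_wpDr // mulr_ge0.
have pos' : 0 < 1 + #|cluster w o|%:R * h by rewrite ltr_wpDr // mulr_ge0.
apply: (@le_trans _ _ (1 + #|cluster w o|%:R * h)^-1).
  by rewrite -[leRHS]mul1r ler_pdivlMr // bernoulli_inv.
by rewrite lef_pV2 ?posrE // lerD2l [leRHS]mulrC ler_wpM2l.
Qed.

Lemma mag_small h N : 0 <= h <= 1 -> h * N <= 1 ->
  h * E (fun w => small_size N w o) <= 2 * mag p (1 - h) o.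
Proof.
move=> h01 hN; rewrite -!meanZ; apply: mean_le => // w _; rewrite /small_size.
have [h0 h1] := andP h01.
case: (ltP #|cluster w o|%:R N) => kN; last first.
  by rewrite mulr0 mulr0 mulr_ge0 // escape_ge0 //; lra.
rewrite mulr1 [leLHS]mulrC; apply: escape_lower => //.
by apply: le_trans hN; rewrite [leLHS]mulrC ler_wpM2l // ltW.
Qed.

Lemma mag_split h N : 0 <= h <= 1 ->
  mag p (1 - h) o <= E (fun w => large N w o) + h * E (fun w => small_size N w o).
Proof.
move=> h01; rewrite -meanZ -meanD; apply: mean_le => // w _; rewrite /large /small_size.
have [h0 h1] := andP h01; have g01 : 0 <= 1 - h <= 1 by lra.
case: (leP N) => _; first by rewrite !mulr0 addr0 gerBl exprn_ge0 //; lra.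
by rewrite add0r mulr1; have := escape_le_natr g01 #|cluster w o|; rewrite subKr.
Qed.

(** With [h = 1 / (2 chi^2)] this gives [mag >= 1 / (4 chi)]. *)
Lemma mag_lower h (chi := mean_cluster p o) : 0 <= h <= 1 ->
  E (fun w => #|cluster w o|%:R ^+ 2) <= chi ^+ 3 ->
  h * chi - h ^+ 2 * chi ^+ 3 / 2 <= mag p (1 - h) o.
Proof.
move=> h01 sm; apply: (@le_trans _ _ (E (fun w =>
    h * #|cluster w o|%:R - h ^+ 2 / 2 * #|cluster w o|%:R ^+ 2))).
  rewrite meanB !meanZ lerD2l lerN2 [leRHS]mulrAC.
  by apply: ler_wpM2l => //; rewrite divr_ge0 // sqr_ge0.
apply: mean_le => // w _; apply: le_trans (escape_second_order _ h01).
by rewrite le_eqVlt; apply/orP; left; apply/eqP; move: (#|_|%:R) => k; field.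
Qed.

Lemma chig_lower h (chi := mean_cluster p o) : 0 <= h <= 1 ->
  E (fun w => #|cluster w o|%:R ^+ 2) <= chi ^+ 3 ->
  chi - h * chi ^+ 3 <= chig p (1 - h) o.
Proof.
move=> h01 sm; have [h0 h1] := andP h01.
apply: (@le_trans _ _ (E (fun w =>
    #|cluster w o|%:R - h * #|cluster w o|%:R ^+ 2))).
  by rewrite meanB !meanZ lerD2l lerN2; apply: ler_wpM2l.
apply: mean_le => // w _; set k := #|_|.
have := ler_wpM2l (ler0n R k) (bernoulli k h01).
by move: ((1 - h) ^+ k) => x; rewrite mulrBr mulr1 expr2; congr (_ <= _); ring.
Qed.

(** Concavity of the magnetization in [h], in a form without derivatives. *)
Lemma chig_concave h r : 0 <= h <= 1 -> 0 <= r <= 1 ->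
  (1 - r) * h * chig p (1 - h) o <= mag p (1 - h) o - mag p (1 - r * h) o.
Proof.
move=> h01 r01; have [h0 h1] := andP h01; have [r0 r1] := andP r01.
rewrite -meanZ -meanB; apply: mean_le => // w _.
have gle : 1 - h <= 1 - r * h by rewrite lerD2l lerN2 ler_piMl.
have g0 : 0 <= 1 - h by lra.
elim: #|cluster w o| => [|k IH]; first by rewrite !expr0 !mul0r mulr0; lra.
rewrite !exprS -[k.+1%:R]natr1; have := lerXn2r k g0 (le_trans g0 gle) gle.
move: ((1 - h) ^+ k) ((1 - r * h) ^+ k) (exprn_ge0 k g0) IH => x y x0 IH xy.
have h1' : (1 - h) * ((1 - r) * h * (k%:R * x)) <= (1 - h) * (1 - x - (1 - y)).
  exact: ler_wpM2l.
have h2' : (1 - r) * h * x <= (1 - r) * h * y.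
  by apply: ler_wpM2l => //; rewrite mulr_ge0 // subr_ge0.
have h3' : 0 <= (1 - r) * h * x * h by rewrite !mulr_ge0 // subr_ge0.
nra.
Qed.

Lemma mag_one : mag p 1 o = 0.
Proof.
rewrite -(mean_cst p (enum (bonds G)) 0); apply: eq_mean => w.
by rewrite expr1n subrr.
Qed.

Lemma chig_le_mag h : 0 <= h <= 1 -> h * chig p (1 - h) o <= mag p (1 - h) o.
Proof.
move=> h01; have := @chig_concave h 0 h01.
by rewrite lexx ler01 mul0r !subr0 mul1r mag_one subr0; apply.
Qed.

Lemma mag_mono h t : 0 <= h -> h <= t -> t <= 1 -> mag p (1 - h) o <= mag p (1 - t) o.
Proof.
move=> h0 ht t1; apply: mean_le => // w _; rewrite lerD2l lerN2.
by apply: lerXn2r; rewrite ?nnegrE; lra.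
Qed.

Lemma mag_ge_green h : 0 <= h <= 1 -> h <= mag p (1 - h) o.
Proof.
move=> h01; rewrite -[leLHS](mean_cst p (enum (bonds G)) h); apply: mean_le => // w _.
have := card_cluster_gt0 w; case: #|_| => // k _; rewrite exprS.
have : (1 - h) ^+ k <= 1 by apply: exprn_ile1; lra.
have : 0 <= 1 - h by lra.
by move: ((1 - h) ^+ k) => x; nra.
Qed.

Lemma mean_is_derive (s : seq {set G}) (F : R -> {set {set G}} -> R) F' t :
  (forall w, is_derive t 1 (F ^~ w) (F' w)) ->
  is_derive t 1 (fun t => mean p s (F t)) (mean p s F').
Proof.
elim: s F F' => [|b s IH] F F' dF /=; first exact: dF.
have d0 := IH F F' dF; have d1 := IH (fun t w => F t (b |: w)) (fun w => F' (b |: w))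
   (fun w => dF (b |: w)).
by apply: is_derive_eq; rewrite /GRing.scale /=; ring.
Qed.

Lemma is_derive_expn (u : R -> R) du k t : is_derive t 1 u du ->
  is_derive t 1 (fun x => u x ^+ k) (k%:R * u t ^+ k.-1 * du).
Proof.
move=> dut; elim: k => [|k IH].
  by rewrite !mul0r; apply: is_derive_cst.
rewrite (_ : (fun x => u x ^+ k.+1) = (fun x => u x * u x ^+ k)); last first.
  by apply/boolp.funext => x; rewrite exprS.
apply: is_derive_eq; rewrite /GRing.scale /= -[k.+1%:R]natr1.
by case: k {IH} => [|k]; rewrite /= ?expr0 ?exprS; ring.
Qed.

(** The variable [t] with [h = t^2] turns the square-root behaviour of the
    magnetization at criticality into linear behaviour. *)
Lemma mag_sqr_is_derive t : t ^+ 2 < 1 ->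
  is_derive t 1 (fun t => mag p (1 - t ^+ 2) o)
    (2 * t * chig p (1 - t ^+ 2) o / (1 - t ^+ 2)).
Proof.
move=> t1; rewrite /chig mulrAC -meanZ; apply: mean_is_derive => w.
have := card_cluster_gt0 w; case: #|_| => // k _ /=.
have dt2 : is_derive t 1 (fun x : R => x ^+ 2) (2 * t).
  rewrite (_ : 2 * t = 2%:R * t ^+ 1 * 1); last by ring.
  exact: (is_derive_expn 2 (is_derive_id t 1)).
have du : is_derive t 1 (fun x : R => 1 - x ^+ 2) (- (2 * t)).
  by apply: is_derive_eq; ring.
have dX := is_derive_expn k.+1 du.
apply: is_derive_eq; rewrite [(1 - t ^+ 2) ^+ k.+1]exprS /=.
by move: ((1 - t ^+ 2) ^+ k) => x; field; rewrite subr_eq0 gt_eqF.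
Qed.

End Magnetization.

(** * The critical point *)

Lemma deriv_ge_mean (R : realType) (f df : R -> R) (a b K : R) : a <= b ->
  (forall x, a <= x <= b -> is_derive x 1 f (df x)) ->
  (forall x, a <= x <= b -> K <= df x) -> K * (b - a) <= f b - f a.
Proof.
move=> ab dfx Kdf.
have der x : x \in `]a, b[%R -> is_derive x 1 f (df x).
  by rewrite in_itv /= => /andP[ax xb]; apply: dfx; rewrite !ltW.
have [|c] := MVT_segment ab der.
  apply: derivable_within_continuous => x; rewrite in_itv /= => xab.
  exact: (@ex_derive _ _ _ _ _ _ _ (dfx x xab)).
rewrite in_itv /= => cab ->; apply: ler_wpM2r; rewrite ?subr_ge0 //.
exact: Kdf.
Qed.

Section Window.
Variables (R : realType) (G : sgraph) (Omega : nat) (o : G).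
Hypothesis tG : transitive_graph G.
Hypothesis degG : forall x : G, degree x = Omega.
Implicit Types (h r t N q : R).

Local Notation M q h := (mag q (1 - h) o).

Let g01 h : 0 <= h <= 1 -> 0 <= 1 - h <= 1. Proof. by move=> ?; lra. Qed.

Lemma mag_pos q h : 0 <= q <= 1 -> 0 < h <= 1 -> 0 < M q h.
Proof.
move=> q01 /andP[h0 h1]; apply: (lt_le_trans h0); apply: mag_ge_green => //.
by rewrite h1 ltW.
Qed.

Lemma mag_mono_p q q' h : 0 <= q -> q <= q' -> q' <= 1 -> 0 <= h <= 1 ->
  M q h <= M q' h.
Proof.
move=> q0 qq q1 h01; rewrite -subr_ge0 -(mul0r (q' - q)).
apply: (@deriv_ge_mean _ (fun q => M q h) (fun q => dmag q (1 - h) o)) => // x /andP[qx xq].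
  exact: mag_is_derive.
apply: dmag_ge0; last exact: g01.
by rewrite (le_trans q0 qx) (le_trans xq).
Qed.

(** Integrate [M_p <= Omega M^2 / ((1 - p) h)], that is, the upper bound on the
    derivative combined with concavity in [h], in the form of a lower bound on
    the derivative of [1 / M]. *)
Lemma mag_extrapolation q q' h : 0 <= q -> q <= q' -> q' < 1 -> 0 < h <= 1 ->
  (M q h)^-1 - Omega%:R * (q' - q) / ((1 - q') * h) <= (M q' h)^-1.
Proof.
move=> q0 qq q1 h01; have [h0 h1] := andP h01.
have h01' : 0 <= h <= 1 by rewrite h1 ltW.
have pos : 0 < (1 - q') * h by rewrite mulr_gt0 // subr_gt0.
have := @deriv_ge_mean R (fun q => (M q h)^-1)
   (fun q => - (M q h) ^- 2 * dmag q (1 - h) o) q q'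
   (- (Omega%:R / ((1 - q') * h))) qq.
have range x : q <= x <= q' -> 0 <= x <= 1.
  by move=> /andP[qx xq]; rewrite (le_trans q0 qx) (le_trans xq) // ltW.
set K := Omega%:R / ((1 - q') * h) => H.
have -> : Omega%:R * (q' - q) / ((1 - q') * h) = K * (q' - q) by rewrite mulrAC.
rewrite lerBlDr -lerBlDl -lerN2 opprB -mulNr; apply: H => x xr.
  have dx := mag_is_derive x (1 - h) o.
  by apply: is_deriveV => //; rewrite gt_eqF // mag_pos // range.
have x01 := range _ xr; have m0 := mag_pos x01 h01; have [x0 x1] := andP xr.
have up := dmag_upper tG degG o x01 (g01 h01').
have cm := chig_le_mag o x01 h01'.
have D0 : 0 <= dmag x (1 - h) o by apply: dmag_ge0 => //; apply: g01.
rewrite mulNr lerN2 mulrC ler_pdivrMr ?exprn_gt0 // /K mulrAC ler_pdivlMr //.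
move: (dmag _ _ _) (chig _ _ _) (mag _ _ _) up cm D0 m0 => D c m up cm D0 m0.
have W0 : 0 <= Omega%:R :> R by [].
apply: (@le_trans _ _ (h * ((1 - x) * D))).
  rewrite (_ : D * ((1 - q') * h) = h * ((1 - q') * D)); last by ring.
  apply: ler_wpM2l; first exact: ltW.
  by apply: ler_wpM2r; rewrite // lerD2l lerN2.
apply: le_trans (ler_wpM2l (ltW h0) up) _.
rewrite (_ : h * (Omega%:R * c * m) = Omega%:R * m * (h * c)); last by ring.
rewrite expr2 [leRHS]mulrA; apply: ler_wpM2l => //.
by rewrite mulr_ge0 // ltW.
Qed.

Section AtCriticality.
Variables (pc a0 : R).
Hypothesis pc01 : 0 <= pc <= 1.
Let chi := mean_cluster pc o.
Hypothesis chi_large : 100 <= chi.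
Hypothesis tri : triangle_condition G pc a0.
Hypothesis a0_small : a0 <= 1 / 100.

Let pc0 : 0 <= pc. Proof. by case/andP: pc01. Qed.

Lemma degree_pc_lower : 99 / 100 <= Omega%:R * pc.
Proof.
have := mean_cluster_bound tG degG o pc01; rewrite -/chi.
by move: (Omega%:R * pc) chi_large => x; nra.
Qed.

Lemma pc_small : pc <= 1 / 99.
Proof.
have h1 := triangle_degree degG o pc01 tri.
have h2 := ler_wpM2r pc0 degree_pc_lower.
rewrite expr2 mulrA in h1; move: (Omega%:R * pc * pc) h1 h2 a0_small => x; lra.
Qed.

Lemma degree_large : 98 <= Omega%:R :> R.
Proof.
have h1 := degree_pc_lower; have W0 : 0 <= Omega%:R :> R by [].
have h2 := ler_wpM2l W0 pc_small; move: (Omega%:R : R) h1 h2 => x; lra.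
Qed.

(** Confront the two bounds on [dmag]: from below it is of order
    [Omega chig mag], by the triangle condition, and from above of order
    [mag sqrt (Omega / (p h))], by exploration. *)
Lemma chig_sqr h : 0 < h <= 1 ->
  Omega%:R * pc * h * (99 / 100) ^+ 2 * chig pc (1 - h) o ^+ 2 <= 1.
Proof.
move=> h01; have h01' : 0 <= h <= 1 by case/andP: h01 => h0 ->; rewrite ltW.
have g_lt1 : 1 - h < 1 by case/andP: h01; lra.
have m0 := mag_pos pc01 h01.
have c0 : 0 <= chig pc (1 - h) o by apply: chig_ge0 => //; apply: g01.
have D0 : 0 <= dmag pc (1 - h) o by apply: dmag_ge0 => //; apply: g01.
have O0 := degree_large.
have low := dmag_lower tG degG o pc01 (g01 h01') tri.
have up := dmag_exploration degG pc01 (g01 h01') g_lt1 o; rewrite subKr in up.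
move: (dmag _ _ _) (chig _ _ _) (mag _ _ _) (Omega%:R : R) m0 c0 D0 O0 low up
  => D c m W m0 c0 D0 W0 low up.
have W0' : 0 <= W by apply: le_trans W0.
have low' : W * c * m * (99 / 100) <= (1 - pc) * D.
  apply: le_trans low; apply: ler_wpM2l; last by move: a0_small; lra.
  by rewrite !mulr_ge0 // ltW.
have [h0 h1] := andP h01'.
have q0 : 0 <= 1 - pc by rewrite subr_ge0; case/andP: pc01.
have sq : (W * c * m * (99 / 100)) ^+ 2 * (pc * h) <= ((1 - pc) * D) ^+ 2 * (pc * h).
  apply: ler_wpM2r; first exact: mulr_ge0.
  have l0 : 0 <= W * c * m * (99 / 100).
    apply: mulr_ge0; last lra.
    by apply: mulr_ge0; [apply: mulr_ge0 | apply: ltW].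
  by rewrite ler_sqr ?nnegrE //; apply: mulr_ge0.
have e : ((1 - pc) * D) ^+ 2 * (pc * h) = (1 - pc) * (D ^+ 2 * (pc * (1 - pc) * h)) by ring.
have up' : (1 - pc) * (D ^+ 2 * (pc * (1 - pc) * h)) <= m ^+ 2 * W.
  apply: le_trans (ler_wpM2l q0 up) _; rewrite ler_piMl ?gerBl //.
  by rewrite mulr_ge0 // sqr_ge0.
rewrite e in sq; have := le_trans sq up'.
have pos : 0 < m ^+ 2 * W by rewrite mulr_gt0 ?exprn_gt0 // (lt_le_trans _ W0).
rewrite -[leRHS]mulr1 (_ : (W * c * m * (99 / 100)) ^+ 2 * (pc * h) =
   m ^+ 2 * W * (W * pc * h * (99 / 100) ^+ 2 * c ^+ 2)); last by ring.
by rewrite ler_pM2l.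
Qed.

(** Use [chig_sqr] at [h = 1 / (2 chi^2)], where [chig] is still at least
    [chi / 2] by the second moment bound. *)
Lemma degree_pc_upper : Omega%:R * pc <= 9.
Proof.
have chi0 : 0 < chi by apply: lt_le_trans chi_large.
pose h := (2 * chi ^+ 2)^-1.
have h01 : 0 < h <= 1.
  rewrite invr_gt0 mulr_gt0 ?exprn_gt0 //= invf_le1 ?mulr_gt0 ?exprn_gt0 //.
  by move: chi_large; move: chi => x; nra.
have h01' : 0 <= h <= 1 by case/andP: h01 => h0 ->; rewrite ltW.
have := chig_lower pc01 h01' (second_moment tG o pc01); rewrite -/chi.
have -> : chi - h * chi ^+ 3 = chi / 2 by rewrite /h; field; rewrite gt_eqF.
move=> c_low; have := chig_sqr h01.
have Op0 : 0 <= Omega%:R * pc by rewrite mulr_ge0.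
move=> H; have : Omega%:R * pc * h * (99 / 100) ^+ 2 * (chi / 2) ^+ 2 <= 1.
  apply: le_trans H; apply: ler_wpM2l.
    by rewrite mulr_ge0 ?sqr_ge0 // mulr_ge0 //; case/andP: h01'.
  by rewrite ler_sqr ?nnegrE ?divr_ge0 ?(ltW chi0) // (le_trans _ c_low) // divr_ge0 // ltW.
have -> : Omega%:R * pc * h * (99 / 100) ^+ 2 * (chi / 2) ^+ 2 =
   Omega%:R * pc * ((99 / 100) ^+ 2 / 8).
  by rewrite /h; field; rewrite gt_eqF.
by move: (Omega%:R * pc) => x; lra.
Qed.

(** By [chig_sqr], [t chig <= 51/50], so in the variable [t] with [h = t^2] the
    derivative of the magnetization is bounded by
    [2 (51/50) / (1 - t^2) <= 23/10]. The range is the one needed for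
    [t = 5 eps] with [eps <= 1/27]. *)
Lemma mag_sqrt t : 0 <= t <= 5 / 27 -> M pc (t ^+ 2) <= 23 / 10 * t.
Proof.
move=> /andP[t0 t1].
have bound x : 0 <= x <= t -> 0 <= 23 / 10 - 2 * x * chig pc (1 - x ^+ 2) o / (1 - x ^+ 2).
  move=> /andP[x0 xt]; rewrite subr_ge0.
  have x1 : x <= 5 / 27 by lra.
  have x2 : x ^+ 2 <= 25 / 729 by rewrite expr2; nra.
  have [->|xn0] := eqVneq x 0; first by rewrite mulr0 !mul0r; lra.
  have xp : 0 < x by rewrite lt_def xn0.
  have h01 : 0 < x ^+ 2 <= 1 by rewrite exprn_gt0 //=; lra.
  have H := chig_sqr h01; have W0 := degree_pc_lower.
  have c0 : 0 <= chig pc (1 - x ^+ 2) o by apply: chig_ge0 => //; apply: g01; rewrite sqr_ge0; lra.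
  rewrite ler_pdivrMr; last by lra.
  move: (chig _ _ _) (Omega%:R * pc) c0 W0 H => c W c0 W0 H.
  have xc0 : 0 <= x * c by rewrite mulr_ge0.
  have xc : x * c <= 51 / 50.
    rewrite -ler_sqr ?nnegrE //; last by lra.
    have : 99 / 100 * ((99 / 100) ^+ 2 * (x * c) ^+ 2) <= 1.
      apply: le_trans H; rewrite (_ : W * x ^+ 2 * (99 / 100) ^+ 2 * c ^+ 2 =
        W * ((99 / 100) ^+ 2 * (x * c) ^+ 2)); last by ring.
      by apply: ler_wpM2r => //; rewrite mulr_ge0 ?sqr_ge0.
    by move: ((x * c) ^+ 2) => y; lra.
  rewrite -mulrA; move: (x * c) (x ^+ 2) xc x2 => y z; lra.
have M0 : M pc (0 ^+ 2) = 0 by rewrite expr0n /= subr0; apply: mag_one.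
have H : 0 * (t - 0) <= (23 / 10 * t - M pc (t ^+ 2)) - (23 / 10 * 0 - M pc (0 ^+ 2)).
  apply: (deriv_ge_mean (f := fun x => 23 / 10 * x - M pc (x ^+ 2)) t0 _ bound).
  move=> x /andP[x0 xt]; have x21 : x ^+ 2 < 1 by rewrite expr2; nra.
  have dm := mag_sqr_is_derive pc o x21.
  by apply: is_derive_eq; rewrite /GRing.scale /= mulr1.
rewrite M0 in H; move: (mag _ _ _) H => m; lra.
Qed.

Lemma mag_sqrt_crude t : 0 <= t <= 1 -> M pc (t ^+ 2) <= 6 * t.
Proof.
move=> /andP[t0 t1]; have [h|h] := leP t (5 / 27).
  by have := @mag_sqrt t; rewrite t0 h => /(_ isT); lra.
apply: (@le_trans _ _ 1); last by lra.
apply: mag_le1 => //; apply: g01; rewrite sqr_ge0 expr2; nra.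
Qed.

End AtCriticality.
End Window.

(** * Just above the critical point *)

Section NearCritical.
Variables (R : realType) (G : sgraph) (Omega : nat) (o : G).
Hypothesis tG : transitive_graph G.
Hypothesis degG : forall x : G, degree x = Omega.
Variables (pc a0 eps p : R).
Hypothesis pc01 : 0 <= pc <= 1.
Hypothesis chi_large : 100 <= mean_cluster pc o.
Hypothesis tri : triangle_condition G pc a0.
Hypothesis a0_small : a0 <= 1 / 100.
Hypothesis eps_gt0 : 0 < eps.
Hypothesis pE : p = pc + eps * Omega%:R^-1.
Hypothesis p01 : 0 <= p <= 1.
Implicit Types (h r t N q : R).

Local Notation M q h := (mag q (1 - h) o).
Local Notation E := (mean p (enum (bonds G))).

Let pc0 : 0 <= pc. Proof. by case/andP: pc01. Qed.
Let W0 : 98 <= Omega%:R :> R. Proof. exact: (degree_large tG degG pc01 chi_large tri). Qed.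
Let Wpos : 0 < Omega%:R :> R. Proof. by apply: lt_le_trans W0. Qed.

Lemma gap : Omega%:R * (p - pc) = eps.
Proof. by rewrite pE addrAC subrr add0r mulrCA mulfV ?mulr1 // gt_eqF. Qed.

Lemma pc_le_p : pc <= p.
Proof. by rewrite pE lerDl mulr_ge0 ?invr_ge0 // ltW. Qed.

Lemma p_bound e : eps <= e -> p <= 1 / 99 + e / 98.
Proof.
move=> ee; rewrite pE; apply: lerD; first exact: (pc_small tG degG pc01 chi_large tri).
apply: ler_pM => //; [exact: ltW | by rewrite invr_ge0 ltW |].
by rewrite lef_pV2 ?posrE.
Qed.

Lemma degree_p_upper : eps <= 1 -> Omega%:R * p <= 10.
Proof.
move=> e1; have := gap; have := degree_pc_upper tG degG pc01 chi_large tri a0_small.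
by rewrite mulrBr; move: (Omega%:R * pc) (Omega%:R * p) => x y; lra.
Qed.

(** The form taken by [mag_extrapolation] at [h = (A eps)^2], when the
    magnetization at [pc] is at most [u sqrt h] and [s] bounds [1 / (1 - p)].
    The number [A] has to exceed [s u] for the extrapolation to be useful. *)
Lemma mag_near (u A s : R) : 0 < A -> 0 < u -> 0 < s ->
  A * eps <= 1 -> p < 1 -> (1 - p)^-1 <= s -> s * u < A ->
  M pc ((A * eps) ^+ 2) <= u * (A * eps) ->
  M p ((A * eps) ^+ 2) <= (A ^+ 2 * u / (A - s * u)) * eps.
Proof.
move=> A0 u0 s0 Ae p1 ps su Mpc; have Ae0 : 0 < A * eps by rewrite mulr_gt0.
have h01 : 0 < (A * eps) ^+ 2 <= 1 by rewrite exprn_gt0 //= exprn_ile1 // ltW.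
have := mag_extrapolation o tG degG pc0 pc_le_p p1 h01; rewrite gap.
have Mp0 : 0 < M p ((A * eps) ^+ 2) by apply: mag_pos.
have Mpc0 : 0 < M pc ((A * eps) ^+ 2) by apply: mag_pos.
move: (M p _) (M pc _) Mp0 Mpc0 Mpc => m mc m0 mc0 mcu H.
have mcV : (u * (A * eps))^-1 <= mc^-1 by rewrite lef_pV2 ?posrE // mulr_gt0.
have sub : eps / ((1 - p) * (A * eps) ^+ 2) <= s / (A ^+ 2 * eps).
  have -> : eps / ((1 - p) * (A * eps) ^+ 2) = (1 - p)^-1 / (A ^+ 2 * eps).
    by field; rewrite !gt_eqF // subr_gt0.
  by apply: ler_wpM2r => //; rewrite invr_ge0 mulr_ge0 ?sqr_ge0 // ltW.
have dpos : 0 < A - s * u by rewrite subr_gt0.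
have {H} H : ((A ^+ 2 * u / (A - s * u)) * eps)^-1 <= m^-1.
  apply: le_trans H; apply: le_trans (lerB mcV sub).
  rewrite le_eqVlt; apply/orP; left; apply/eqP; field.
  by rewrite !gt_eqF.
by rewrite lef_pV2 ?posrE // in H; rewrite mulr_gt0 // divr_gt0 // mulr_gt0 // exprn_gt0.
Qed.

(** With [A = 5] the magnetization at [h = (5 eps)^2] is at most [22 eps]. Since
    [h N >= 25], a cluster of size [N] has a green vertex with probability at
    least [25/26], and [22 (26/25) < 27]. Only [eps <= 1/27] matters, and then
    [p] is close to [0]. *)
Lemma theta_upper N : eps ^- 2 <= N -> E (fun w => large N w o) <= 27 * eps.
Proof.
move=> epsN; have [e1|e1] := leP eps (1 / 27); last first.
  by apply: le_trans (mean_prob p01 _ _) _; lra.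
have e0 := eps_gt0; have N0 : 0 <= N by apply: le_trans epsN; rewrite invr_ge0 sqr_ge0.
have p_le := p_bound e1.
have s1 : (1 - p)^-1 <= 90 / 89.
  rewrite -[90 / 89]invrK lef_pV2 ?posrE ?invr_gt0; last by lra.
    by rewrite invf_div; lra.
  by lra.
have t1 : 0 <= 5 * eps <= 5 / 27 by lra.
have := @mag_near (23 / 10) 5 (90 / 89) _ _ _ _ _ s1 _
   (mag_sqrt tG degG pc01 chi_large tri a0_small t1).
have e5 : 5 * eps <= 1 by lra.
have p1 : p < 1 by lra.
move=> /(_ ltac:(lra) ltac:(lra) ltac:(lra) e5 p1 ltac:(lra)) Mle.
have h01 : 0 <= (5 * eps) ^+ 2 <= 1.
  by rewrite sqr_ge0 exprn_ile1 //; lra.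
have := mag_theta o p01 h01 N0.
have hN : 25 <= (5 * eps) ^+ 2 * N.
  have -> : 25 = (5 * eps) ^+ 2 * eps ^- 2 :> R by field; rewrite gt_eqF.
  by apply: ler_wpM2l => //; apply: sqr_ge0.
have inv : (1 + (5 * eps) ^+ 2 * N)^-1 <= 26^-1.
  by rewrite lef_pV2 ?posrE; lra.
have th0 : 0 <= E (fun w => large N w o) by apply: mean_ge0 => // w _; apply: ler0n.
move: (mag _ _ _) Mle => m Mle; move: (mean _ _ _) th0 => th th0 H.
have : 25 / 26 * th <= m by apply: le_trans H; apply: ler_wpM2r => //; lra.
have : m <= 22 * eps.
  by apply: le_trans Mle _; apply: ler_wpM2r; [apply: ltW | rewrite ler_pdivrMr; lra].
lra.
Qed.

(** With the cruder constants [u = 6] and [s = 2], valid up to [eps = 1], the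
    choice [A = 24 = 2 s u] is optimal in [mag_near]. *)
Lemma mag_linear h : eps <= 1 -> 0 <= h <= eps ^+ 2 -> M p h <= 288 * eps.
Proof.
move=> e1 /andP[h0 he]; have e0 := eps_gt0.
have [big|small] := leP (24 * eps) 1; last first.
  apply: (@le_trans _ _ 1); last by lra.
  apply: mag_le1 => //; rewrite subr_ge0 gerBl h0 andbT (le_trans he) //.
  by rewrite exprn_ile1 // ltW.
have p_le := p_bound e1; have p1 : p < 1 by lra.
have s1 : (1 - p)^-1 <= 2.
  by rewrite -[2]invrK lef_pV2 ?posrE ?invr_gt0; lra.
have t1 : 0 <= 24 * eps <= 1 by lra.
have := @mag_near 6 24 2 _ _ _ big p1 s1 _
   (mag_sqrt_crude tG degG pc01 chi_large tri a0_small t1).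
move=> /(_ ltac:(lra) ltac:(lra) ltac:(lra) ltac:(lra)) Mle.
apply: (@le_trans _ _ (M p ((24 * eps) ^+ 2))).
  apply: mag_mono => //; last by rewrite exprn_ile1; lra.
  apply: le_trans he _; rewrite exprMn ler_peMl ?sqr_ge0 //; lra.
by apply: le_trans Mle _; apply: ler_wpM2r; [apply: ltW | rewrite ler_pdivrMr; lra].
Qed.

Lemma small_upper N : eps <= 1 -> eps ^- 2 <= N ->
  E (fun w => small_size N w o) <= 576 * eps * N.
Proof.
move=> e1 epsN; have e0 := eps_gt0.
have N0 : 0 < N by apply: lt_le_trans epsN; rewrite invr_gt0 exprn_gt0.
have NV : N^-1 <= eps ^+ 2.
  by rewrite -[eps ^+ 2]invrK lef_pV2 ?posrE ?invr_gt0 ?exprn_gt0.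
have NV0 : 0 <= N^-1 by rewrite invr_ge0 ltW.
have h01 : 0 <= N^-1 <= 1.
  by rewrite NV0 (le_trans NV) // exprn_ile1 // ltW.
have hN : N^-1 * N <= 1 by rewrite mulVf ?gt_eqF.
have hNV : 0 <= N^-1 <= eps ^+ 2 by rewrite NV0.
have := mag_small o p01 h01 hN; have := mag_linear e1 hNV.
move: (mean _ _ _) (mag _ _ _) => x m mle; rewrite mulrC ler_pdivrMr //.
move=> /le_trans; apply; apply: ler_wpM2r; first exact: ltW.
lra.
Qed.

(** Sum the Aizenman-Barsky inequality, divided by [M], over the geometric
    sequence [Gam r^j], [j < J]: by concavity the terms [h dM/dh / M] telescope
    to the logarithm of the ratio of the extreme values of [M]. If this
    logarithm is smaller than [(1 - r) J] by a fixed factor, the sum over [j] of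
    [p M_p] is at least of order [J] throughout the interval from [pc] to [p],
    so the average of [M p] over the sequence is at least of order
    [(p - pc) / p]. *)
Lemma mag_lower_telescoped (Gam r delta m0 : R) (J : nat) :
  0 < Gam <= 1 -> 0 < r < 1 -> (0 < J)%N -> 0 < m0 -> m0 <= M pc (Gam * r ^+ J) ->
  M p Gam <= delta ->
  ln (M p Gam) - ln m0 <= (1 - 2 * delta) * (1 - r) * J%:R ->
  (p - pc) * delta <= p * M p Gam.
Proof.
move=> Gam01 /andP[r0 r1] J0 m00 m0le Mdelta lnle.
have [Gam0 Gam1] := andP Gam01.
pose y j := Gam * r ^+ j.
have y01 j : 0 < y j <= 1.
  rewrite mulr_gt0 ?exprn_gt0 //= mulr_ile1 ?exprn_ge0 ?exprn_ile1 //; exact: ltW.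
have y01' j : 0 <= y j <= 1 by case/andP: (y01 j) => h ->; rewrite ltW.
have g01 j : 0 <= 1 - y j <= 1 by have := y01' j; lra.
have yS j : y j.+1 = r * y j by rewrite /y exprS mulrCA.
have y_le j : y j <= Gam by rewrite /y ler_piMr ?exprn_ile1 // ltW.
have range q : pc <= q <= p -> 0 <= q <= 1.
  by move=> /andP[pq qp]; rewrite (le_trans pc0 pq) (le_trans qp) //; case/andP: p01.
have dF q : is_derive q 1 (fun q => \sum_(j < J) M q (y j)) (\sum_(j < J) dmag q (1 - y j) o).
  elim: J {J0 m0le lnle} => [|n IH].
    rewrite big_ord0 (_ : (fun q => _) = (fun=> 0)); first exact: is_derive_cst.
    by apply/boolp.funext => z; rewrite big_ord0.
  rewrite big_ord_recr /= (_ : (fun q => _) =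
    (fun q => \sum_(j < n) M q (y j) + M q (y n))); last first.
    by apply/boolp.funext => z; rewrite big_ord_recr.
  by have dm := mag_is_derive q (1 - y n) o; apply: is_deriveD.
have [p_gt0|p_le0] := ltP 0 p; last first.
  have := degree_pc_lower tG degG pc01 chi_large.
  have pp : pc <= 0 by apply: le_trans pc_le_p _.
  by rewrite (@le_anti _ _ pc 0) ?pp ?pc0 // mulr0; lra.
have delta0 : 0 < delta by apply: lt_le_trans Mdelta; apply: mag_pos.
have step q : pc <= q <= p -> J%:R * delta / p <= \sum_(j < J) dmag q (1 - y j) o.
  move=> qr; have q01 := range q qr; have [pq qp] := andP qr.
  have [q0 q1] := andP q01.
  have Mq_le j : M q (y j) <= delta.
    apply: le_trans Mdelta; apply: (@le_trans _ _ (M p (y j))).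
      by apply: mag_mono_p => //; case/andP: p01.
    by apply: mag_mono => //; case/andP: (y01' j).
  have term j : (1 - delta) - (1 - r)^-1 * (ln (M q (y j)) - ln (M q (y j.+1))) <=
      p * dmag q (1 - y j) o.
    have mj := mag_pos o q01 (y01 j); have mj1 := mag_pos o q01 (y01 j.+1).
    have D0 := dmag_ge0 q01 (g01 j) o.
    have ab := aizenman_barsky tG o q01 (g01 j); rewrite subKr in ab.
    have r01 : 0 <= r <= 1 by rewrite !ltW.
    have cc := chig_concave o q01 (y01' j) r01; rewrite -yS in cc.
    have lnb : 1 - M q (y j.+1) / M q (y j) <= ln (M q (y j)) - ln (M q (y j.+1)).
      rewrite -lerN2 !opprB -ln_div ?posrE //.
      have := @le_ln1Dx R (M q (y j.+1) / M q (y j) - 1).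
      rewrite addrCA subrr addr0 => -> //.
      by rewrite ltrBrDl subrr divr_gt0.
    have md := Mq_le j.
    move: (ln _ - ln _) lnb => L lnb.
    move: (dmag _ _ _) (chig _ _ _) (M q (y j)) (M q (y j.+1)) mj mj1 D0 ab cc md lnb
      => D c m m' mj mj1 D0 ab cc md lnb.
    have r1' : 0 < 1 - r by rewrite subr_gt0.
    have cc' : y j * c <= (1 - r)^-1 * (m - m').
      by rewrite [leRHS]mulrC ler_pdivlMr // [leLHS]mulrC mulrA.
    have {}lnb : (1 - r)^-1 * (m - m') <= (1 - r)^-1 * L * m.
      rewrite -mulrA; apply: ler_wpM2l; first by rewrite invr_ge0 ltW.
      by rewrite -ler_pdivrMr // mulrBl divff ?gt_eqF.
    have pD : q * ((1 - q) * D) <= p * D.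
      apply: ler_pM => //; first by rewrite mulr_ge0 // subr_ge0.
      by rewrite ler_piMl // gerBl.
    rewrite -(ler_pM2r mj).
    have pDm := ler_wpM2r (ltW mj) pD.
    have mm : m ^+ 2 <= delta * m by rewrite expr2; apply: ler_wpM2r => //; apply: ltW.
    rewrite mulrBl mulrBl mul1r.
    have e : q * m * ((1 - q) * D) = q * ((1 - q) * D) * m by ring.
    rewrite e in ab.
    move: (q * ((1 - q) * D) * m) (p * D * m) pDm ab => u v pDm ab.
    move: ((1 - r)^-1 * L * m) ((1 - r)^-1 * (m - m')) (y j * c) cc' lnb ab
      => a1 a2 a3 cc' lnb ab.
    move: (m ^+ 2) (delta * m) mm ab => b1 b2; lra.
  rewrite ler_pdivrMr // mulrC [leRHS]mulrC mulr_sumr.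
  apply: le_trans (ler_sum _ (fun (j : 'I_J) _ => term j)).
  rewrite sumrB sumr_const card_ord -mulr_sumr -[(1 - delta) *+ J]mulr_natr.
  have -> : \sum_(j < J) (ln (M q (y j)) - ln (M q (y j.+1))) =
     ln (M q (y 0%N)) - ln (M q (y J)).
    elim: J {J0 m0le lnle dF} => [|n IH]; first by rewrite big_ord0 subrr.
    by rewrite big_ord_recr /= IH addrA subrK.
  have l1 : ln (M q (y 0%N)) <= ln (M p Gam).
    rewrite ler_ln ?posrE ?mag_pos // /y expr0 mulr1.
    by apply: mag_mono_p => //; [case/andP: p01 | rewrite Gam1 ltW].
  have l2 : ln m0 <= ln (M q (y J)).
    rewrite ler_ln ?posrE ?mag_pos //; apply: le_trans m0le _.
    exact: (mag_mono_p o pc0 pq q1 (y01' J)).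
  have r1' : 0 < 1 - r by rewrite subr_gt0.
  have : (1 - r)^-1 * (ln (M q (y 0%N)) - ln (M q (y J))) <= (1 - 2 * delta) * J%:R.
    rewrite mulrC ler_pdivrMr // mulrAC; apply: le_trans lnle.
    by move: l1 l2; move: (ln _) (ln _) (ln _) (ln _) => *; lra.
  by move: ((1 - r)^-1 * _) (J%:R : R) => a b; nra.
have := deriv_ge_mean pc_le_p (fun q _ => dF q) step.
have F0 : 0 <= \sum_(j < J) M pc (y j).
  by apply: sumr_ge0 => j _; apply: mag_ge0.
have FJ : \sum_(j < J) M p (y j) <= J%:R * M p Gam.
  rewrite -[J in J%:R]card_ord mulr_natl -sumr_const; apply: ler_sum => j _.
  by apply: mag_mono => //; case/andP: (y01' j).
move=> H; have {}H : J%:R * delta / p * (p - pc) <= J%:R * M p Gam.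
  apply: le_trans FJ; apply: le_trans H _; by rewrite gerBl.
have J0' : 0 < J%:R :> R by rewrite ltr0n.
have {}H := ler_wpM2r (ltW p_gt0) H.
rewrite -(ler_pM2l J0') [p * M p Gam]mulrC [leRHS]mulrA.
rewrite (_ : J%:R * ((p - pc) * delta) = J%:R * delta / p * (p - pc) * p) //.
by field; rewrite gt_eqF.
Qed.

End NearCritical.

(** * The lower bound on the density of large clusters *)

Lemma arith_start (R : realFieldType) (k1 k2 K x b : R) :
  k1 + k2 + 1 <= x / 2 -> - K <= k2 -> 0 <= k1 -> 0 <= b -> 0 <= x ->
  1 <= K + (x + b).
Proof. by move=> *; lra. Qed.

Lemma arith_log (R : realFieldType) (m s e c K k1 k2 x b r3 r4 r2 : R) :
  m <= e -> - s = c -> e + c = K + x -> r2 <= 1 -> x + b <= r3 -> - k2 <= r4 ->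
  k1 + k2 + 1 <= b -> K <= k1 -> m - s <= r4 + r3 - r2.
Proof. by move=> *; lra. Qed.

Lemma arith_tenth (R : realFieldType) (d e : R) :
  0 <= d * e -> d * e <= d -> d / 10 * e <= d.
Proof. by move=> *; lra. Qed.

Lemma arith_ten (R : realFieldType) (d e m y : R) :
  e * d <= y -> y <= 10 * m -> d / 10 * e <= m.
Proof. by move=> *; lra. Qed.

Lemma arith_theta (R : realFieldType) (b e m t y : R) :
  b / 16 / 10 * e <= m -> m <= t + y -> y <= 576 * (b / 160 / 1152) * e ->
  b / 320 * e <= t.
Proof. by move=> *; lra. Qed.

Lemma arith_r1 (R : realFieldType) (r : R) : 0 <= r -> r <= 1 -> r * (1 - r) <= 1.
Proof. by move=> *; nra. Qed.

Lemma arith_r2 (R : realFieldType) (b : R) : 1 - b / 4 <= (1 - b / 8) ^+ 2.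
Proof. by have := sqr_ge0 (b / 8); nra. Qed.

Lemma arith_r3 (R : realFieldType) (b : R) :
  0 <= b -> b <= 1 -> 1 + b / 2 <= (1 - b / 4) * (1 + b).
Proof. by move=> *; nra. Qed.

Section ThetaLower.
Variables (R : realType) (G : sgraph) (Omega : nat) (o : G).
Hypothesis tG : transitive_graph G.
Hypothesis degG : forall x : G, degree x = Omega.
Variables (pc a0 eps p : R).
Hypothesis pc01 : 0 <= pc <= 1.
Hypothesis chi_large : 100 <= mean_cluster pc o.
Hypothesis tri : triangle_condition G pc a0.
Hypothesis a0_small : a0 <= 1 / 100.
Hypothesis eps_gt0 : 0 < eps.
Hypothesis eps_le1 : eps <= 1.
Hypothesis pE : p = pc + eps * Omega%:R^-1.
Hypothesis p01 : 0 <= p <= 1.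
Variables (alpha lambda v : R).
Hypothesis alpha01 : 0 < alpha < 1.
Hypothesis lambda_gt0 : 0 < lambda.
Hypothesis v_gt0 : 0 < v.
Hypothesis chiE : mean_cluster pc o = lambda * v.

Let beta := 1 - alpha.
Let kappa := beta / 160 / 1152.
Let K1 := ln (1152 * lambda).
Let K2 := ln (2 * kappa * lambda ^+ 2).

(** The value of [ln (eps V^(1/3))] above which the constants of the lower bound
    are absorbed by the margin [1 - alpha]. *)
Definition window_threshold : R :=
  2 / (1 - alpha) * (`|K1| + `|K2| + 1).

Let X := eps * v.
Hypothesis X_large : window_threshold <= ln X.
Let N := eps ^- 2 * X `^ alpha.

Local Notation M q h := (mag q (1 - h) o).

Let beta0 : 0 < beta. Proof. by rewrite /beta; case/andP: alpha01; lra. Qed.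
Let beta1 : beta <= 1. Proof. by rewrite /beta; case/andP: alpha01; lra. Qed.
Let kappa0 : 0 < kappa. Proof. by rewrite !divr_gt0. Qed.
Let X0 : 0 < X. Proof. exact: mulr_gt0. Qed.

Lemma lnX_bounds : `|K1| + `|K2| + 1 <= beta / 2 * ln X /\
  `|K1| + `|K2| + 1 <= ln X / 2.
Proof.
have h : `|K1| + `|K2| + 1 <= beta / 2 * ln X.
  apply: le_trans (ler_wpM2l _ X_large); last by rewrite divr_ge0 // ltW.
  rewrite le_eqVlt; apply/orP; left; apply/eqP; rewrite /window_threshold -/beta.
  by field; rewrite gt_eqF.
split => //; apply: (le_trans h).
have S0 : 0 < beta / 2 * ln X by apply: lt_le_trans h; rewrite ltr_wpDl ?addr_ge0.
rewrite pmulr_rgt0 ?divr_gt0 // in S0.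
by have := ler_wpM2r (ltW S0) beta1; lra.
Qed.

Lemma X_ge1 : 1 <= X.
Proof.
have [_ h] := lnX_bounds; rewrite leNgt; apply/negP => X1.
have : ln X <= 0 by apply: ln_le0; apply: ltW.
by have := normr_ge0 K1; have := normr_ge0 K2; lra.
Qed.

(** Apply [mag_lower_telescoped] between [h = kappa / N] and
    [h = 1 / (2 chi^2)], at which the magnetization at [pc] is at least
    [1 / (4 chi)]. Write [X] for [eps V^(1/3)]. Up to constants, the ratio of
    the two values of [h] is [X^(2 - alpha)] and the ratio of the two
    magnetizations is at most [X], because the larger one is at most [288 eps].
    As [2 - alpha > 1] the hypothesis on logarithms holds for large [X], which
    gives a magnetization of order [eps] at [kappa / N]. Clusters smaller than
    [N] contribute at most [576 kappa eps] to it; a small [kappa] leaves half of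
    it to the larger ones. *)
Lemma theta_lower :
  beta / 320 * eps <= mean p (enum (bonds G)) (fun w => large N w o).
Proof.
have X1 := X_ge1; have [lnX1 lnX2] := lnX_bounds.
have k1 := ler_norm K1; have k2 := ler_norm (- K2); rewrite normrN in k2.
have n1 := normr_ge0 K1; have n2 := normr_ge0 K2.
have e0 := eps_gt0; have e1 := eps_le1.
pose r := 1 - beta / 8; pose delta := beta / 16.
have b0 := beta0; have b1 := beta1.
have r0 : 7 / 8 <= r by rewrite /r; lra.
have r1 : r < 1 by rewrite /r; lra.
have Xa1 : 1 <= X `^ alpha.
  rewrite -(powRr0 X); apply: ler_powR => //; by case/andP: alpha01 => /ltW.
have Xa0 : 0 < X `^ alpha by apply: lt_le_trans Xa1.
have epsN : eps ^- 2 <= N by rewrite /N ler_peMr // invr_ge0 sqr_ge0.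
have N0 : 0 < N by rewrite mulr_gt0 // invr_gt0 exprn_gt0.
pose Gam := kappa / N.
have Gam0 : 0 < Gam by rewrite divr_gt0.
have kappa1 : kappa <= 1 by rewrite /kappa; lra.
have GamE : Gam * N = kappa by rewrite /Gam mulfVK // gt_eqF.
have Gam_le : Gam <= eps ^+ 2.
  rewrite ler_pdivrMr //; apply: (le_trans kappa1).
  rewrite -[1](@mulfV _ (eps ^+ 2)) ?gt_eqF ?exprn_gt0 //.
  by apply: ler_wpM2l epsN; apply: sqr_ge0.
have eps2_1 : eps ^+ 2 <= 1 by rewrite exprn_ile1 // ltW.
have Gam01 : 0 < Gam <= 1 by rewrite Gam0 (le_trans Gam_le).
have Gam01' : 0 <= Gam <= 1 by rewrite ltW //; case/andP: Gam01.
have GamE2 : 0 <= Gam <= eps ^+ 2 by rewrite ltW.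
have chi_E := chiE; have chi_l := chi_large.
set chi := mean_cluster pc o in chi_E chi_l *.
have chi0 : 0 < chi by apply: lt_le_trans chi_l.
pose hs := (2 * chi ^+ 2)^-1.
have hs01 : 0 < hs <= 1.
  rewrite invr_gt0 mulr_gt0 ?exprn_gt0 //= invf_le1 ?mulr_gt0 ?exprn_gt0 //.
  by move: (chi) chi_l => x; nra.
have hs01' : 0 <= hs <= 1 by case/andP: hs01 => h ->; rewrite ltW.
pose m0 := (4 * chi)^-1.
have m00 : 0 < m0 by rewrite invr_gt0 mulr_gt0.
have start : m0 <= M pc hs.
  have := mag_lower pc01 hs01' (second_moment tG o pc01); rewrite -/chi.
  apply: le_trans; rewrite -subr_ge0 /m0 /hs.
  have -> : (2 * chi ^+ 2)^-1 * chi - (2 * chi ^+ 2)^-1 ^+ 2 * chi ^+ 3 / 2 - (4 * chi)^-1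
    = (8 * chi)^-1 by field; rewrite gt_eqF.
  by rewrite invr_ge0 mulr_ge0 // ltW.
pose l := - ln r; pose L := ln (Gam / hs).
have rp : 0 < r by lra.
have l0 : 0 < l by rewrite /l oppr_gt0 ln_lt0 // rp.
have l_le : l <= (1 - r) / r.
  rewrite /l -lnV ?posrE //; have := @le_ln1Dx R (r^-1 - 1).
  rewrite addrCA subrr addr0 => h; apply: le_trans (h _) _.
    by rewrite ltrBrDl subrr invr_gt0.
  by rewrite mulrBl mul1r divff // gt_eqF.
have LE : L = K2 + (1 + beta) * ln X.
  have -> : 1 + beta = 2 - alpha by rewrite /beta; ring.
  rewrite /L (_ : Gam / hs = 2 * kappa * lambda ^+ 2 * (X ^+ 2 / X `^ alpha)); last first.
    rewrite /Gam /hs /N /X chi_E; field.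
    by rewrite !gt_eqF // mulr_gt0.
  have c0 : 0 < 2 * kappa * lambda ^+ 2 by apply: mulr_gt0; [apply: mulr_gt0 | apply: exprn_gt0].
  rewrite lnM ?posrE ?divr_gt0 ?exprn_gt0 // ln_div ?posrE ?exprn_gt0 // ln_powR lnXn //.
  by rewrite -/K2; move: (ln X) (K2) => a b; ring.
have L1 : 1 <= L.
  have lnX0 := ln_ge0 X1; have bX : 0 <= beta * ln X by rewrite mulr_ge0 // ltW.
  rewrite LE mulrDl mul1r; move: lnX2 k2 n1 bX lnX0; exact: arith_start.
pose J := Num.truncn (L / l).
have LlJ : J%:R <= L / l < J.+1%:R 
  by apply: Num.Theory.truncn_itv; rewrite divr_ge0 // ?(le_trans ler01 L1) // ltW.
have J0 : (0 < J)%N.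
  have l1 : l <= 1.
    by apply: (le_trans l_le); rewrite ler_pdivrMr // mul1r lerBlDr; lra.
  have : 1 <= L / l by rewrite ler_pdivlMr // mul1r (le_trans l1).
  case/andP: LlJ => _ + h1; move=> /(le_lt_trans h1); rewrite -[1]/(1%:R) ltr_nat.
  by rewrite ltnS.
have hs_le : hs <= Gam * r ^+ J.
  have hsp : 0 < hs by case/andP: hs01.
  have rJ : 0 < r ^+ J by apply: exprn_gt0.
  suff : ln hs <= ln (Gam * r ^+ J) by rewrite ler_ln ?posrE // mulr_gt0.
  rewrite lnM ?posrE // lnXn //.
  have : J%:R * l <= ln Gam - ln hs.
    by rewrite -ln_div ?posrE // -/L -ler_pdivlMr //; case/andP: LlJ.
  by rewrite -[ln r *+ J]mulr_natl /l mulrN lerBrDl lerBlDr.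
have m0le : m0 <= M pc (Gam * r ^+ J).
  apply: (le_trans start); apply: mag_mono => //; first by case/andP: hs01'.
  rewrite mulr_ile1 ?exprn_ge0 ?exprn_ile1 //; try exact: ltW.
  by case/andP: Gam01.
have Mp0 : 0 < M p Gam by apply: mag_pos.
have Mlin := mag_linear tG degG pc01 chi_large tri a0_small eps_gt0 pE p01 eps_le1 GamE2.
have main : delta / 10 * eps <= M p Gam.
  have [Md|Md] := leP (M p Gam) delta; last first.
    apply: (le_trans _ (ltW Md)).
    have d0 : 0 <= delta by rewrite divr_ge0 // ltW.
    exact: arith_tenth (mulr_ge0 d0 (ltW e0)) (ler_piMr d0 e1).
  have r01 : 0 < r < 1 by rewrite rp.
  have lnle : ln (M p Gam) - ln m0 <= (1 - 2 * delta) * (1 - r) * J%:R.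
    have lnM1 : ln (M p Gam) <= ln (288 * eps) by rewrite ler_ln ?posrE // mulr_gt0.
    have lnm0 : - ln m0 = ln (4 * chi) by rewrite /m0 lnV ?posrE ?opprK // mulr_gt0.
    have K1E : ln (288 * eps) + ln (4 * chi) = K1 + ln X.
      rewrite /K1 -!lnM ?posrE ?mulr_gt0 // chi_E /X; congr ln; ring.
    have -> : 1 - 2 * delta = r by rewrite /delta /r; field.
    have JL : L - l <= J%:R * l.
      case/andP: LlJ => _; rewrite ltr_pdivrMr // -[J.+1%:R]natr1 mulrDl mul1r => /ltW.
      by rewrite lerBlDr.
    have rl : r * l <= 1 - r by rewrite mulrC -ler_pdivlMr.
    have step1 : r * (r * (L - l)) <= r * (1 - r) * J%:R.
      rewrite -mulrA; apply: ler_wpM2l; first exact: ltW.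
      apply: (@le_trans _ _ (r * l * J%:R)); last by apply: ler_wpM2r.
      by rewrite -mulrA ler_wpM2l ?(ltW rp) // mulrC.
    apply: le_trans step1.
    have r2 : 1 - beta / 4 <= r ^+ 2 by apply: arith_r2.
    have r2' : r ^+ 2 <= 1 by rewrite exprn_ile1 // ltW.
    have step2 : r * (r * l) <= 1.
      by apply: le_trans (ler_wpM2l (ltW rp) rl) _; apply: arith_r1; apply: ltW.
    have lnX0 : 0 <= ln X by apply: ln_ge0.
    have step3 : (1 + beta / 2) * ln X <= r ^+ 2 * ((1 + beta) * ln X).
      rewrite mulrA; apply: ler_wpM2r => //.
      apply: (@le_trans _ _ ((1 - beta / 4) * (1 + beta))).
        by apply: arith_r3; [apply: ltW | ].
      by apply: ler_wpM2r => //; rewrite addr_ge0 // ltW.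
    have step4 : - `|K2| <= r ^+ 2 * K2.
      apply: (@le_trans _ _ (r ^+ 2 * - `|K2|)).
        by rewrite mulrN lerN2 ler_piMl.
      by apply: ler_wpM2l; [apply: sqr_ge0 | rewrite lerNl].
    have -> : r * (r * (L - l)) = r ^+ 2 * K2 + r ^+ 2 * ((1 + beta) * ln X) - r * (r * l).
      by rewrite LE; ring.
    rewrite mulrDl mul1r in step3.
    exact: (arith_log lnM1 lnm0 K1E step2 step3 step4 lnX1 k1).
  have := mag_lower_telescoped tG degG pc01 chi_large eps_gt0 pE p01
    Gam01 r01 J0 m00 m0le Md lnle.
  have W0 : 0 <= Omega%:R :> R by [].
  move=> /(ler_wpM2l W0); rewrite [_ * (_ * delta)]mulrA [_ * (p * _)]mulrA.
  rewrite (gap tG degG pc01 chi_large tri a0_small pE).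
  have := degree_p_upper tG degG pc01 chi_large tri a0_small pE eps_le1.
  by move=> /(ler_wpM2r (ltW Mp0)) h1 h2; apply: arith_ten h2 h1.
have := mag_split o p01 N Gam01'.
have := small_upper tG degG pc01 chi_large tri a0_small eps_gt0 pE p01 eps_le1 epsN.
move: (mean _ _ _) (mean _ _ _) => S th hS hM.
have hS' := ler_wpM2l (ltW Gam0) hS.
have e : Gam * (576 * eps * N) = 576 * kappa * eps by rewrite -GamE; ring.
rewrite e in hS'; exact: arith_theta main hM hS'.
Qed.

End ThetaLower.

(** * The largest cluster *)

Section LargestCluster.
Variables (R : realType) (G : sgraph) (Omega : nat) (o : G).
Hypothesis tG : transitive_graph G.
Hypothesis degG : forall x : G, degree x = Omega.
Variables (p N delta : R).
Implicit Types (w : {set {set G}}) (x y : G).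
Hypothesis p01 : 0 <= p <= 1.
Hypothesis N0 : 0 <= N.
Hypothesis delta0 : 0 < delta.
Local Notation E := (mean p (enum (bonds G))).
Local Notation V := (#|G|%:R : R).
Let th := E (fun w => large N w o).
Hypothesis th0 : 0 < th.
Hypothesis N_le : N <= th * V.

Lemma large_count_mean : E (large_count N) = th * V.
Proof.
rewrite mean_sum (eq_bigr (fun=> th)); first by rewrite sumr_const mulr_natr.
move=> x _.
exact: (@cluster_law_transitive _ _ tG p (fun k => (N <= k%:R)%R%:R)).
Qed.

(** All vertices of a cluster of size at least [N] are counted. *)
Lemma Cmax_le_large_count w : N <= (Cmax w)%:R -> (Cmax w)%:R <= large_count N w.
Proof.
have VG : (0 < #|G|)%N by apply/card_gt0P; exists o.
have [x e] := @bigop.eq_bigmax G (fun x => #|cluster w x|) VG; rewrite /Cmax e => Nx.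
rewrite card_cluster_sum; apply: ler_sum => y _; rewrite /conn.
case: (boolP (linked w x y)) => xy; last exact: ler0n.
by rewrite /large -(cluster_eq xy) Nx.
Qed.

(** If the largest cluster exceeds [(1 + delta) th V >= N], so does the number
    of vertices in large clusters, whose mean is [th V]: Chebyshev's inequality.
    *)
Lemma Cmax_deviation :
  1 - 2 * N * (Omega%:R * p) * V * E (fun w => small_size N w o) /
      (delta * (th * V)) ^+ 2 <=
  Prob p (fun w : {set {set G}} => (Cmax w)%:R <= (1 + delta) * th * V).
Proof.
have V0 := card_vertices_gt0 R o; have thV0 : 0 < th * V by apply: mulr_gt0.
rewrite /Prob ExpectE lerBlDr -lerBlDl.
have := chebyshev p01 (mulr_gt0 delta0 thV0) large_count_mean.
move=> /(_ (2 * N * (Omega%:R * p) * V * E (fun w => small_size N w o))) cheb.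
apply: le_trans (cheb _); last first.
  by rewrite -large_count_mean; apply: large_count_variance.
rewrite -[X in X - _](mean_cst p (enum (bonds G)) 1) -meanB; apply: mean_le => // w _.
case: (leP (Cmax w)%:R ((1 + delta) * th * V)) => h; first by rewrite subrr ler0n.
rewrite subr0; suff -> : delta * (th * V) < large_count N w - th * V by [].
rewrite ltrBrDl; have -> : th * V + delta * (th * V) = (1 + delta) * th * V by ring.
apply: (lt_le_trans h); apply: Cmax_le_large_count; apply: (le_trans N_le).
apply: le_trans (ltW h); rewrite -mulrA ler_peMl ?(ltW thV0) // lerDl ltW //.
Qed.

End LargestCluster.

(** Both sides have the same logarithm. *)
Lemma eq_of_ln (R : realType) (e V A B h c t a : R) :
  0 < e -> 0 < V -> 0 < A -> 0 < B -> c + 2 * a = 5 -> c * h + 2 * (a * t) = 1 ->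
  ln A = c * (ln e + h * ln V) -> ln B = a * (ln e + t * ln V) ->
  A * (e ^- 2 * B) ^+ 2 = e * V.
Proof.
move=> e0 V0 A0 B0 ca cht lA lB.
have e2 : 0 < e ^+ 2 by apply: exprn_gt0.
have eV0 : 0 < e ^- 2 by rewrite invr_gt0.
have N0 := mulr_gt0 eV0 B0; have N20 : 0 < (e ^- 2 * B) ^+ 2 by apply: exprn_gt0.
apply: ln_inj; rewrite ?posrE; [exact: mulr_gt0 | exact: mulr_gt0 |].
rewrite (lnM A0 N20) (lnXn 2 N0) (lnM eV0 B0) lA lB (lnM e0 V0) (lnV e2) (lnXn 2 e0).
move: (ln e) (ln V) => x y; rewrite -mulr_natr.
have -> : x + y = (c + 2 * a - 4) * x + (c * h + 2 * (a * t)) * y.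
  by rewrite ca cht; ring.
by ring.
Qed.

Lemma powR_exponents (R : realType) (e V h c t a : R) : 0 < e -> 0 < V ->
  c + 2 * a = 5 -> c * h + 2 * (a * t) = 1 ->
  (e * V `^ h) `^ c * (e ^- 2 * (e * V `^ t) `^ a) ^+ 2 = e * V.
Proof.
move=> e0 V0 ca cht.
have Vh : 0 < V `^ h by apply: powR_gt0.
have Vt : 0 < V `^ t by apply: powR_gt0.
apply: (eq_of_ln e0 V0 _ _ ca cht); [| | by rewrite ln_powR (lnM e0 Vh) ln_powR
  | by rewrite ln_powR (lnM e0 Vt) ln_powR]; by apply: powR_gt0; apply: mulr_gt0.
Qed.

Lemma powR_add2 (R : realType) (Y c : R) : 0 < Y -> Y `^ c * Y ^+ 2 = Y `^ (c + 2).
Proof.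
move=> Y0; rewrite powRD; last by apply/implyP => _; rewrite gt_eqF.
by rewrite -[X in _ = _ * Y `^ X]/(2%:R) powR_mulrn // ltW.
Qed.

(** This identity determines the exponent [eta]: the deviation probability, of
    order [Y^2 N^2 / (eps V)] with [Y = eps V^eta], is then a power of [Y]. *)
Lemma powR_scaling (R : realType) (alpha eps V : R) : alpha < 1 -> 0 < eps -> 0 < V ->
  (eps * V `^ eta alpha) `^ (5 - 2 * alpha) *
    (eps ^- 2 * (eps * V `^ (1 / 3)) `^ alpha) ^+ 2 = eps * V.
Proof.
move=> a1 e0 V0; apply: powR_exponents => //; first by rewrite subrK.
have n0 : 5 - 2 * alpha != 0 by rewrite gt_eqF // subr_gt0; lra.
by rewrite /eta; field.
Qed.

Theorem theorem1p6 (R : realType) :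
  exists b0 : R, 0 < b0 /\
  forall lambda alpha : R, 0 < lambda -> 0 < alpha < 1 ->
  exists b9 b10 b11 b12 : R,
    [/\ 0 < b9, 0 < b10, 0 < b11 & 0 < b12] /\
  forall (G : sgraph) (o : G) (Omega : nat) (pc a0 eps p : R),
    let V : R := nvert R G in
    connected_graph G ->
    transitive_graph G ->
    (forall x : G, degree x = Omega) ->
    1 < lambda * V `^ (1 / 3) < V ->
    is_pc o lambda pc ->
    a0 <= b0 ->
    triangle_condition G pc a0 ->
    b0^-1 <= lambda * V `^ (1 / 3) ->
    0 < eps ->
    p = pc + eps * Omega%:R^-1 ->
    0 <= p <= 1 ->
    (* (i) *)
    (b9 * V `^ (- (1 / 3)) <= eps <= 1 -> b10 * eps <= theta o alpha eps p) /\
    (1 <= eps * V `^ (1 / 3) -> theta o alpha eps p <= 27 * eps) /\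
    (* (ii) *)
    (Num.max (b12 * V `^ (- (1 / 3))) (V `^ (- eta alpha)) <= eps <= 1 ->
     1 - b11 / (eps * V `^ eta alpha) `^ (3 - 2 * alpha) <=
     Prob p (fun w : {set {set G}} =>
       (Cmax w)%:R <= (1 + (eps * V `^ eta alpha)^-1) * theta o alpha eps p * V)).
Proof.
exists (1 / 100); split; first by lra.
move=> lambda alpha lambda_gt0 alpha01; have [alpha0 alpha1] := andP alpha01.
pose b9 : R := sequences.expR (window_threshold alpha lambda).
pose b10 : R := (1 - alpha) / 320.
pose b11 : R := 11520 / b10 ^+ 2.
pose b12 : R := Num.max b9 b10^-1.
have b9_gt0 : 0 < b9 by apply: expR_gt0.
have b10_gt0 : 0 < b10 by rewrite divr_gt0 // subr_gt0.
have b11_gt0 : 0 < b11 by rewrite divr_gt0 // exprn_gt0.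
have b12_gt0 : 0 < b12 by rewrite lt_max b9_gt0.
exists b9, b10, b11, b12; split => //.
move=> G o Omega pc a0 eps p V _ tG degG _ [pc01 pcE] a0_small tri chi_large e0 pE p01.
have V0 : 0 < V by apply: card_vertices_gt0.
pose v := V `^ (1 / 3); have v0 : 0 < v by apply: powR_gt0.
have chiE : mean_cluster pc o = lambda * v by rewrite -pcE /chi ExpectE.
have {}chi_large : 100 <= mean_cluster pc o.
  by rewrite chiE; apply: le_trans chi_large; rewrite invf_div divr1.
pose X := eps * v; pose N := Nsize G alpha eps.
have X0 : 0 < X by apply: mulr_gt0.
have NE : N = eps ^- 2 * X `^ alpha by [].
have thE : theta o alpha eps p = mean p (enum (bonds G)) (fun w => large N w o).
  by rewrite /theta /Prob ExpectE.
have N_ge : 1 <= X -> eps ^- 2 <= N.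
  move=> X1; rewrite NE ler_peMr // ?invr_ge0 ?sqr_ge0 // -(powRr0 X).
  by apply: ler_powR => //; apply: ltW.
have XE b : (b * V `^ (- (1 / 3)) <= eps) = (b <= X).
  by rewrite powRN ler_pdivrMr.
have thr : b9 <= X -> window_threshold alpha lambda <= ln X.
  by move=> bX; rewrite -ler_expR lnK ?posrE.
have lower : b9 <= X -> eps <= 1 -> b10 * eps <= theta o alpha eps p.
  move=> bX e1; rewrite thE NE.
  apply: (theta_lower tG degG pc01 chi_large tri a0_small e0 e1 pE p01 alpha01
    lambda_gt0 v0 chiE).
  exact: thr.
have b9_X1 : b9 <= X -> 1 <= X by move=> /thr; apply: X_ge1.
split; first by move=> /andP[]; rewrite XE; apply: lower.
split.
  move=> X1; rewrite thE.
  exact: (theta_upper tG degG pc01 chi_large tri a0_small e0 pE p01 (N_ge X1)).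
case/andP; rewrite ge_max XE => /andP[b12X VY] e1.
have [b9X b10X] : b9 <= X /\ b10^-1 <= X by move: b12X; rewrite ge_max => /andP.
have X1 := b9_X1 b9X; have epsN := N_ge X1; have th_low := lower b9X e1.
set Y := eps * V `^ eta alpha; have Y0 : 0 < Y by rewrite mulr_gt0 // powR_gt0.
have N0 : 0 < N by apply: lt_le_trans epsN; rewrite invr_gt0 exprn_gt0.
have th0 : 0 < theta o alpha eps p.
  by apply: lt_le_trans th_low; apply: mulr_gt0.
have N_le : N <= theta o alpha eps p * V.
  apply: (@le_trans _ _ (b10 * eps * V)); last by apply: ler_wpM2r => //; apply: ltW.
  have Xa : X `^ alpha <= X.
    by rewrite -[leRHS](powRr1 (ltW X0)); apply: ler_powR => //; apply: ltW.
  have vE : V = v ^+ 3.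
    rewrite -(powR_mulrn 3 (ltW v0)) -powRrM (_ : 1 / 3 * 3%:R = 1); last by field.
    by rewrite powRr1 // ltW.
  have -> : b10 * eps * V = eps ^- 2 * (b10 * X * X * X).
    by rewrite vE /X; field; rewrite gt_eqF.
  rewrite NE; apply: ler_wpM2l; first by rewrite invr_ge0 sqr_ge0.
  apply: (le_trans Xa); rewrite -[leLHS]mul1r; apply: ler_wpM2r; first exact: ltW.
  have bX : 1 <= b10 * X by rewrite mulrC -ler_pdivrMr // div1r.
  by rewrite -[1]mulr1; apply: ler_pM.
have scal : Y `^ (3 - 2 * alpha) * Y ^+ 2 * N ^+ 2 = eps * V.
  rewrite -(powR_scaling alpha1 e0 V0) -/Y -/v -/X -NE; congr (_ * _).
  by rewrite (powR_add2 _ Y0); congr (_ `^ _); ring.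
rewrite thE in th0 th_low N_le *.
have Yi0 : 0 < Y^-1 by rewrite invr_gt0.
apply: le_trans (Cmax_deviation tG degG p01 (ltW N0) Yi0 th0 N_le).
rewrite lerD2l lerN2.
have S_le := small_upper tG degG pc01 chi_large tri a0_small e0 pE p01 e1 epsN.
have S0 : 0 <= mean p (enum (bonds G)) (fun w => small_size N w o).
  by apply: mean_ge0 => // w _; apply: small_size_ge0.
have Wp := degree_p_upper tG degG pc01 chi_large tri a0_small pE e1.
have Wp0 : 0 <= Omega%:R * p by rewrite mulr_ge0 //; case/andP: p01.
have YA0 : 0 < Y `^ (3 - 2 * alpha) by apply: powR_gt0.
rewrite -[#|G|%:R]/V.
set S := mean p (enum (bonds G)) (fun w => small_size N w o) in S_le S0 *.
move: S (mean _ _ _) (Omega%:R * p) (Y `^ (3 - 2 * alpha))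
  S_le S0 Wp Wp0 th0 th_low scal YA0 => S th W A S_le S0 Wp Wp0 th0 th_low scal A0.
have den0 : 0 < Y^-1 * (b10 * eps * V) := mulr_gt0 Yi0 (mulr_gt0 (mulr_gt0 b10_gt0 e0) V0).
have den1 : 0 < Y^-1 * (th * V) := mulr_gt0 Yi0 (mulr_gt0 th0 V0).
have N0' := ltW N0; have V0' := ltW V0.
have -> : b11 / A = 11520 * eps * N ^+ 2 * V / (Y^-1 * (b10 * eps * V)) ^+ 2.
  have -> : (Y^-1 * (b10 * eps * V)) ^+ 2 = b10 ^+ 2 * (eps * V * (eps * V)) / Y ^+ 2.
    by field; rewrite gt_eqF.
  rewrite -{1}scal /b11; field.
  by rewrite !gt_eqF.
apply: ler_pM.
- apply: mulr_ge0 => //; apply: mulr_ge0 => //; apply: mulr_ge0 => //.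
  by apply: mulr_ge0.
- by rewrite invr_ge0 sqr_ge0.
- rewrite (_ : 11520 * eps * N ^+ 2 * V = 2 * N * 10 * V * (576 * eps * N)); last by ring.
  have N2 : 0 <= 2 * N by apply: mulr_ge0.
  apply: ler_pM => //; first by apply: mulr_ge0 => //; apply: mulr_ge0.
  by apply: ler_wpM2r => //; apply: ler_wpM2l.
rewrite lef_pV2 ?posrE ?exprn_gt0 //.
apply: lerXn2r; rewrite ?nnegrE; [exact: ltW | exact: ltW |].
by rewrite ler_pM2l // ler_pM2r.
Qed.
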